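(* Any closed rectifiable curve $\alpha$ in a geodesic $\mathrm{CAT}(0)$ space is majorized by a convex plane figure.
   Context: A geodesic is a distance-preserving map from a real interval to a metric space; a metric space is geodesic if any two of its points are joined by a geodesic. A curve is rectifiable if it has finite length. $\mathrm{CAT}(0)$: a metric space $\mathcal{X}$ is $\mathrm{CAT}(0)$ if every quadruple $p,q,x,y\in\mathcal{X}$ satisfies the following. Let $[\tilde p\tilde x\tilde y]$ and $[\tilde q\tilde x\tilde y]$ be triangles in the Euclidean plane $\mathbb{E}^2$ with common side $[\tilde x\tilde y]$ and with the same side lengths as the triples $(p,x,y)$ and $(q,x,y)$, respectively. Then $|p-q|_{\mathcal X}\le|\tilde p-\tilde z|_{\mathbb{E}^2}+|\tilde z-\tilde q|_{\mathbb{E}^2}$ for every $\tilde z\in[\tilde x\tilde y]$. Majorization: let $\mathcal{X}$ be a metric space, $\tilde\alpha$ a simple closed curve of finite length in $\mathbb{E}^2$, and $D\subset\mathbb{E}^2$ a closed region bounded by $\tilde\alpha$. A length-nonincreasing map $F\colon D\to\mathcal{X}$ is called majorizing if it is length-preserving on $\tilde\alpha$. In this case one says that $D$ majorizes the curve $\alpha=F\circ\tilde\alpha$ under the map $F$. The theorem asserts that for the given $\alpha$ there is such a majorizing $D$ that is a convex subset of $\mathbb{E}^2$.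
   Formalization: Constant curves and geodesics run forth and back, which no figure bounded by a simple closed curve can majorize, are majorized instead by a degenerate figure (a segment or point, F distance-preserving); the curve α equals F∘α̃ up to monotone reparametrization, as α may pause. *)

(* Defs.v *)
From HB Require Import structures.
From mathcomp Require Import all_boot all_order all_algebra.
From mathcomp Require Import all_classical all_reals all_analysis.
From mathcomp Require Import ring lra.

Set Implicit Arguments.
Unset Strict Implicit.
Unset Printing Implicit Defensive.

Import Order.TTheory GRing.Theory Num.Theory.
Import numFieldNormedType.Exports.

Local Open Scope classical_set_scope.
Local Open Scope ring_scope.

(* The Euclidean plane.  An alias of the vector space R^2 is needed because the
   library equips R * R with the sup distance; on the alias, balls, topology
   and distance [mdist] all come from the Euclidean norm. *)
Definition euclid2 (R : realType) : Type := (R^o * R^o)%type.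

HB.instance Definition _ (R : realType) :=
  GRing.Lmodule.copy (euclid2 R) (R^o * R^o)%type.

Section EuclideanDistance.
Variable R : realType.
Implicit Types p q r : euclid2 R.

Definition edist p q : R :=
  Num.sqrt ((p.1 - q.1) ^+ 2 + (p.2 - q.2) ^+ 2).

Lemma edistxx p : edist p p = 0.
Proof. by rewrite /edist !subrr expr0n /= addr0 sqrtr0. Qed.

Lemma edist_positivity p q : edist p q = 0 -> p = q.
Proof.
move/eqP; rewrite sqrtr_eq0 => h.
have h1 := sqr_ge0 (p.1 - q.1); have h2 := sqr_ge0 (p.2 - q.2).
have /eqP : (p.1 - q.1) ^+ 2 = 0 by lra.
have /eqP : (p.2 - q.2) ^+ 2 = 0 by lra.
rewrite !sqrf_eq0 !subr_eq0; move: p q {h h1 h2} => [? ?] [? ?] /=.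
by move=> /eqP -> /eqP ->.
Qed.

Lemma edist_sym p q : edist p q = edist q p.
Proof. by rewrite /edist -(sqrrN (p.1 - _)) -(sqrrN (p.2 - _)) !opprB. Qed.

Lemma edist_triangle q p r : edist p r <= edist p q + edist q r.
Proof.
rewrite /edist.
set x := p.1 - q.1; set y := p.2 - q.2.
set z := q.1 - r.1; set w := q.2 - r.2.
have -> : p.1 - r.1 = x + z by rewrite /x /z; ring.
have -> : p.2 - r.2 = y + w by rewrite /y /w; ring.
set A := x ^+ 2 + y ^+ 2; set B := z ^+ 2 + w ^+ 2.
have A0 : 0 <= A by rewrite addr_ge0 ?sqr_ge0.
have B0 : 0 <= B by rewrite addr_ge0 ?sqr_ge0.
have SA := sqrtr_ge0 A; have SB := sqrtr_ge0 B.
rewrite -(ger0_norm (addr_ge0 SA SB)) -sqrtr_sqr ler_wsqrtr //.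
rewrite [leRHS]sqrrD !sqr_sqrtr // -sqrtrM //.
have : x * z + y * w <= Num.sqrt (A * B).
  rewrite (le_trans (ler_norm _)) // -sqrtr_sqr ler_wsqrtr // /A /B.
  have := sqr_ge0 (x * w - y * z); lra.
rewrite /A /B; lra.
Qed.

HB.instance Definition _ :=
  isMetric.Build R (euclid2 R) edistxx edist_positivity edist_sym
    edist_triangle.

End EuclideanDistance.

Definition segment (R : realType) (x y : euclid2 R) : set (euclid2 R) :=
  [set z | exists2 t : R, 0 <= t <= 1 & z = (1 - t) *: x + t *: y].

Section Curves.
Variables (R : realType) (X : metricType R).
Implicit Types (g : R -> X) (a b : R).

(* A curve is a function on all of R of which only the values on [a, b]
   matter. *)
Definition curve g a b := a <= b /\ {within `[a, b], continuous g}.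

Definition closed_curve g a b := [/\ a < b, curve g a b & g a = g b].

Definition simple_closed_curve g a b :=
  closed_curve g a b /\
  forall s t, a <= s -> s < t -> t <= b -> g s = g t -> s = a /\ t = b.

(* As in the library's [variation], a partition of [a, b] is a strictly
   increasing sequence s such that a :: s ends at b. *)
Definition polygonal_length g a b (s : seq R) : R :=
  \sum_(0 <= n < size s) mdist (g (nth b (a :: s) n)) (g (nth b (a :: s) n.+1)).

Definition curve_length g a b : \bar R :=
  ereal_sup [set (polygonal_length g a b s)%:E | s in itv_partition a b].

Definition rectifiable g a b := (curve_length g a b < +oo)%E.

Definition geodesic g a b :=
  a <= b /\ {in `[a, b] &, forall s t, mdist (g s) (g t) = `|s - t|}.

(* g on [a, b] is h on [c, d] run through by a continuous nondecreasing change
   of parameter, which may be constant on intervals. *)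
Definition reparametrization g a b (h : R -> X) (c d : R) :=
  exists theta : R -> R,
    [/\ {within `[a, b], continuous theta},
        {in `[a, b] &, {homo theta : s t / s <= t}},
        theta a = c, theta b = d &
        {in `[a, b], forall t, g t = h (theta t)}].

End Curves.

Definition geodesic_space (R : realType) (X : metricType R) :=
  forall x y : X, exists (g : R -> X) (a b : R),
    [/\ geodesic g a b, g a = x & g b = y].

Definition CAT0 (R : realType) (X : metricType R) :=
  forall (p q x y : X) (p' q' x' y' : euclid2 R),
    mdist p' x' = mdist p x -> mdist p' y' = mdist p y ->
    mdist q' x' = mdist q x -> mdist q' y' = mdist q y ->
    mdist x' y' = mdist x y ->
    forall z', segment x' y' z' -> mdist p q <= mdist p' z' + mdist z' q'.

(* The closed region bounded by the curve g: the image of g together with the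
   bounded components of its complement. *)
Definition region_bounded_by (R : realType) (g : R -> euclid2 R) (a b : R) :
    set (euclid2 R) :=
  let C := g @` `[a, b] in
  C `|` [set z | ~ C z /\
                 exists r, connected_component (~` C) z `<=` ball z r].

Section Majorization.
Variables (R : realType) (X : metricType R).
Implicit Types (D : set (euclid2 R)) (F : euclid2 R -> X).

Definition length_nonincreasing_on D F :=
  forall (g : R -> euclid2 R) (u v : R), curve g u v -> g @` `[u, v] `<=` D ->
    (curve_length (F \o g) u v <= curve_length g u v)%E.

Definition length_preserving_along (g : R -> euclid2 R) (c d : R) F :=
  forall s t, c <= s -> s <= t -> t <= d ->
    curve_length (F \o g) s t = curve_length g s t.

Definition majorizing (g : R -> euclid2 R) (c d : R) D F :=
  [/\ simple_closed_curve g c d, rectifiable g c d,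
      D = region_bounded_by g c d,
      length_nonincreasing_on D F & length_preserving_along g c d F].

(* Curves are taken up to reparametrization: alpha may be constant on an
   interval, whereas F \o g never is if g is simple and F preserves the length
   of its arcs. *)
Definition majorizes D (alpha : R -> X) (a b : R) :=
  exists (g : R -> euclid2 R) (c d : R) (F : euclid2 R -> X),
    majorizing g c d D F /\ reparametrization alpha a b (F \o g) c d.

(* The degenerate convex figures are the segments, points included, with the
   segment run once forth and once back as boundary curve: a closed curve that
   covers [x, y] and has length 2 |x - y|.  They are needed because a constant
   curve, or a geodesic run forth and back, is not majorized by any region
   bounded by a simple closed curve.  F is required to be distance-preserving,
   so that these are the only curves majorized in the degenerate sense. *)
Definition degenerately_majorizes D (alpha : R -> X) (a b : R) :=
  exists (x y : euclid2 R) (g : R -> euclid2 R) (F : euclid2 R -> X),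
    [/\ D = segment x y,
        closed_curve g a b /\ g @` `[a, b] = D,
        curve_length g a b = (2 * mdist x y)%:E,
        (forall z w, D z -> D w -> mdist (F z) (F w) = mdist z w) &
        {in `[a, b], forall t, alpha t = F (g t)}].

End Majorization.

(* Main.v *)
(* Let alpha be parametrized by arc length and p = alpha 0.  A closed polygon p_0, ..., p_n with
   p_0 = p_n = p inscribed in alpha is treated one vertex at a time: the comparison triangle of
   p, p_k, p_(k+1) is attached along a side, the door, to the convex plane polygon found for
   p_0, ..., p_k, and if the result is not convex it is unfolded at the ends of the door, which
   does not decrease any distance between vertices.  By Kirszbraun's theorem there is then a
   1-Lipschitz map from the plane to two half planes glued along the door, which is composed
   with the maps, 1-Lipschitz by the CAT(0) inequality, of the two halves into the fan of
   geodesics from p.  An ultrafilter limit of finer and finer polygons yields a plane curve g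
   such that any two chords of g that interlace meet, and a 1-Lipschitz F with F o g = alpha;
   the limit of the maps exists without completeness, the fan over alpha being compact.

   If g is not collinear, it is a simple closed curve that bounds the convex union of the
   chords from g 0.  If it is collinear, alpha is geodesic on both sides of p; if this also
   happens for a second starting point, alpha is a geodesic run forth and back. *)

Require Import Defs.
From mathcomp Require Import all_boot all_order all_algebra.
From mathcomp Require Import all_classical all_reals all_analysis.
From mathcomp Require Import ring lra zify.

Set Implicit Arguments.
Unset Strict Implicit.
Unset Printing Implicit Defensive.

Import Order.TTheory GRing.Theory Num.Theory.
Import numFieldNormedType.Exports.

Local Open Scope classical_set_scope.
Local Open Scope ring_scope.

(** Unfolding leaves X: the new distances are those of glued half planes. The induction therefore
    runs over abstract cyclic pseudometrics that keep only the triangle inequality and a four-point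
    inequality for interlacing pairs, and both survive the gluing.

    Kirszbraun's theorem is not applied to maps into X, where minima need not exist; its target is a
    compact part of the glued half planes. The interior of a comparison triangle has no image in the
    fan, so the map to the fan is Lipschitz only up to the mesh. This error vanishes on the closing
    side, the next door, and the mesh tends to 0.

    A collinear limit says less than it seems. Domination leaves the angle between two geodesics
    from p free, so if each of them is run forth and back, the plane curve may be straight although
    alpha is not one geodesic run forth and back. For this reason the polygons also remember that
    the geodesic from p to an intermediate point separates the fan, and the second starting point is
    chosen inside one of the two geodesics. *)

Local Notation edist := Defs.edist.

(** * Plane geometry *)

(** The weight [t = a / (a + b)] turns the right-hand side into [a * b] and the inequality into
    [c <= a + b]. In the proof [a] and [b] are enlarged by half of the supposed excess, which keeps
    the weight inside the open interval when one of them is 0. *)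
Lemma le_sum_of_weighted (R : realFieldType) (a b c : R) :
  0 <= a -> 0 <= b -> 0 <= c ->
  (forall t, 0 < t < 1 -> t * (1 - t) * c ^+ 2 <= (1 - t) * a ^+ 2 + t * b ^+ 2) ->
  c <= a + b.
Proof.
move=> a0 b0 c0 H; rewrite leNgt; apply/negP => hc.
have c1 : 0 < c by lra.
pose e := (c - (a + b)) / 2.
have e0 : 0 < e by rewrite /e; lra.
have ce : c = a + e + (b + e) by rewrite /e; field.
have ab : 0 < a + e + (b + e) by lra.
have := H ((a + e) / (a + e + (b + e))).
have -> : 1 - (a + e) / (a + e + (b + e)) = (b + e) / (a + e + (b + e)).
  by field; lra.
rewrite [in c ^+ 2]ce.
have t0 : 0 < (a + e) / (a + e + (b + e)) < 1.
  by rewrite divr_gt0 ?ltr_pdivrMr //; lra.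
move=> /(_ t0).
set D := a + e + (b + e).
have -> : (a + e) / D * ((b + e) / D) * D ^+ 2 = (a + e) * (b + e).
  by field; rewrite /D; lra.
have -> : (b + e) / D * a ^+ 2 + (a + e) / D * b ^+ 2 =
   ((b + e) * a ^+ 2 + (a + e) * b ^+ 2) / D by field; rewrite /D; lra.
rewrite ler_pdivlMr // /D.
apply/negP; rewrite -ltNge.
have h1 : (b + e) * a ^+ 2 <= (b + e) * ((a + e) * a).
  by rewrite ler_wpM2l //; [lra|nra].
have h2 : (a + e) * b ^+ 2 <= (a + e) * ((b + e) * b).
  by rewrite ler_wpM2l //; [lra|nra].
have h3 : 0 < (a + e) * (b + e) * (e + e).
  by rewrite !mulr_gt0 //; lra.
lra.
Qed.

Section Plane.
Variable R : realType.
Implicit Types (x y z w : euclid2 R) (s t u v l : R).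

Lemma edtri y x z : edist x z <= edist x y + edist y z.
Proof. exact: Defs.edist_triangle. Qed.

Lemma edC x y : edist x y = edist y x.
Proof. exact: Defs.edist_sym. Qed.

Lemma edxx x : edist x x = 0.
Proof. exact: Defs.edistxx. Qed.

Lemma ed0_eq x y : edist x y = 0 -> x = y.
Proof. exact: Defs.edist_positivity. Qed.

Definition esq x y : R := (x.1 - y.1) ^+ 2 + (x.2 - y.2) ^+ 2.

Definition lerp t x y : euclid2 R :=
  ((1 - t) * x.1 + t * y.1, (1 - t) * x.2 + t * y.2).

Definition seg x y z := exists2 t : R, 0 <= t <= 1 & z = lerp t x y.

Definition cross4 x y z w := exists2 m, seg x z m & seg y w m.

Lemma esq_ge0 x y : 0 <= esq x y.
Proof. by rewrite addr_ge0 ?sqr_ge0. Qed.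

Lemma edist_ge0 x y : 0 <= edist x y.
Proof. exact: sqrtr_ge0. Qed.
Hint Resolve edist_ge0 : core.

Lemma edistE x y : edist x y ^+ 2 = esq x y.
Proof. by rewrite sqr_sqrtr ?esq_ge0. Qed.

Lemma edist_sqrt x y : edist x y = Num.sqrt (esq x y).
Proof. by []. Qed.

Lemma edist_le x y c : 0 <= c -> esq x y <= c ^+ 2 -> edist x y <= c.
Proof. by move=> c0; rewrite -edistE ler_sqr ?nnegrE. Qed.

Lemma edist_ge x y c : 0 <= c -> c ^+ 2 <= esq x y -> c <= edist x y.
Proof. by move=> c0; rewrite -edistE ler_sqr ?nnegrE. Qed.

Lemma edist_leP x y z w : (edist x y <= edist z w) = (esq x y <= esq z w).
Proof. by rewrite -!edistE ler_sqr ?nnegrE. Qed.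

Lemma edist_eqP x y c : 0 <= c -> esq x y = c ^+ 2 -> edist x y = c.
Proof. by move=> c0 e; rewrite edist_sqrt e sqrtr_sqr ger0_norm. Qed.

Lemma esq_sym x y : esq x y = esq y x.
Proof. by rewrite /esq; ring. Qed.

(** Stewart's theorem. The comparison inequalities below say that a distance in X or in glued half
    planes satisfies it with [<=]. *)
Lemma esq_lerp t x y z :
  esq z (lerp t x y) = (1 - t) * esq z x + t * esq z y - t * (1 - t) * esq x y.
Proof. by rewrite /esq /lerp /=; ring. Qed.

Lemma esq_lerp2 s t x y z :
  esq (lerp s x y) (lerp t x z) =
    s * (s - t) * esq x y + t * (t - s) * esq x z + s * t * esq y z.
Proof. by rewrite /esq /lerp /=; ring. Qed.

Lemma lerp0 x y : lerp 0 x y = x.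
Proof. by case: x => a b; rewrite /lerp /= !mul0r !addr0 !subr0 !mul1r. Qed.

Lemma lerp1 x y : lerp 1 x y = y.
Proof. by case: y => a b; rewrite /lerp /= !subrr !mul0r !add0r !mul1r. Qed.

Lemma lerpC t x y : lerp t x y = lerp (1 - t) y x.
Proof. by rewrite /lerp; congr pair; ring. Qed.

Lemma edist_lerp s t x y : edist (lerp s x y) (lerp t x y) = `|s - t| * edist x y.
Proof.
apply: edist_eqP; first by rewrite mulr_ge0.
by rewrite exprMn edistE real_normK ?num_real // /esq /lerp /=; ring.
Qed.

Lemma edist_lerpl t x y : 0 <= t -> edist x (lerp t x y) = t * edist x y.
Proof.
by move=> t0; rewrite -{1}(lerp0 x y) edist_lerp sub0r normrN ger0_norm.
Qed.

Lemma edist_lerpr t x y : t <= 1 -> edist (lerp t x y) y = (1 - t) * edist x y.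
Proof.
move=> t0; rewrite -{2}(lerp1 x y) edist_lerp distrC ger0_norm //; lra.
Qed.

Lemma lerp_lerp a s t x y : lerp a (lerp s x y) (lerp t x y) = lerp ((1 - a) * s + a * t) x y.
Proof. by rewrite /lerp /=; congr pair; ring. Qed.

Lemma lerp_conv s t u : 0 <= s <= 1 -> 0 <= t <= 1 -> 0 <= u <= 1 ->
  0 <= (1 - u) * s + u * t <= 1.
Proof. move=> /andP[? ?] /andP[? ?] /andP[? ?]; apply/andP; split; nra. Qed.

Lemma segl x y : seg x y x.
Proof. by exists 0; rewrite ?lerp0 // lexx ler01. Qed.

Lemma segr x y : seg x y y.
Proof. by exists 1; rewrite ?lerp1 // lexx ler01. Qed.
Hint Resolve segl segr : core.

Lemma segC x y z : seg x y z -> seg y x z.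
Proof. by move=> [t t01 ->]; exists (1 - t); rewrite -?lerpC //; lra. Qed.

Lemma seg_sub x y a b z : seg x y a -> seg x y b -> seg a b z -> seg x y z.
Proof.
move=> [s s01 ->] [t t01 ->] [u u01 ->]; rewrite lerp_lerp.
by exists ((1 - u) * s + u * t) => //; exact: lerp_conv.
Qed.

Lemma seg_lerp x y t : 0 <= t <= 1 -> seg x y (lerp t x y).
Proof. by exists t. Qed.

Lemma seg_dist x y z : seg x y z -> edist x z + edist z y = edist x y.
Proof.
move=> [t /andP[t0 t1] ->]; rewrite edist_lerpl // edist_lerpr //; ring.
Qed.

Lemma edist_lerp_le t x y z w : 0 <= t <= 1 ->
  edist (lerp t x y) (lerp t z w) <= (1 - t) * edist x z + t * edist y w.
Proof.
move=> /andP[t0 t1].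
apply: le_trans (edtri (lerp t z y) _ _) _.
suff [-> ->] : edist (lerp t x y) (lerp t z y) = (1 - t) * edist x z /\
   edist (lerp t z y) (lerp t z w) = t * edist y w by [].
split; apply: edist_eqP; rewrite ?mulr_ge0 ?subr_ge0 //;
  by rewrite exprMn edistE /esq /lerp /=; ring.
Qed.

(** It carries the later arguments about crossing chords, so no general position is assumed. *)
Lemma pasch o a b p q w : seg o a p -> seg o b q -> seg a b w ->
  exists2 m, seg p q m & seg o w m.
Proof.
move=> [s /andP[s0 s1] ->] [t /andP[t0 t1] ->] [u /andP[u0 u1] ->].
have [->|sN] := eqVneq s 0; first by exists o; rewrite ?lerp0 //.
have [->|tN] := eqVneq t 0; first by exists o; rewrite ?lerp0 //.
have sp : 0 < s by rewrite lt_def sN.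
have tp : 0 < t by rewrite lt_def tN.
(* If [lam] is the parameter of the crossing point on the segment from [o] to [w], its weights at
   [p] and [q] are [lam * (1 - u) / s] and [lam * u / t]; they add up to 1 for [lam = s * t / N]. *)
pose N := (1 - u) * t + u * s.
have [h1 h2] : 0 <= (1 - u) * t /\ 0 <= u * s by rewrite !mulr_ge0 ?subr_ge0.
have h0 : (1 - u) * t + u * s != 0.
  have [->|uN] := eqVneq u 0; first by rewrite subr0 mul0r addr0 mul1r.
  have : 0 < u * s by rewrite mulr_gt0 // lt_def uN.
  by move=> ?; apply/eqP => ?; lra.
have N0 : 0 < N by rewrite lt_def h0 addr_ge0.
exists (lerp (s * t / N) o (lerp u a b)); last first.
  exists (s * t / N) => //; rewrite divr_ge0 ?mulr_ge0 ?ler_pdivrMr ?mul1r ?(ltW N0) //=.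
  have : 0 <= (1 - u) * t * (1 - s) + u * s * (1 - t).
    by rewrite addr_ge0 // mulr_ge0 // subr_ge0.
  by rewrite /N; lra.
exists (u * s / N).
  by rewrite divr_ge0 ?mulr_ge0 ?ler_pdivrMr ?mul1r ?(ltW N0) //= /N; lra.
by rewrite /lerp /N /=; congr pair; field.
Qed.

End Plane.
#[global] Hint Resolve edist_ge0 segl segr : core.

(** * Shortest paths through a door *)

Section Door.
Variable R : realType.
Implicit Types (x y z w q m : euclid2 R) (s t u v l : R).

(* [q'] is [q] turned about [e0] into the extension of the segment from [m] to
   [e0]: this is how a shortest path from [q] to [m] through the door [e0, e1]
   that bends at [e0] is unfolded. *)
Definition unfolds (e0 e1 : euclid2 R) q m := exists2 q' : euclid2 R,
  forall w, seg e0 e1 w -> edist q' w <= edist q w &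
  edist q' m = edist q e0 + edist e0 m.

Definition sees (e0 e1 : euclid2 R) q m := exists2 w, seg e0 e1 w & seg q m w.

(** If the way to [m] bends at [e0], so does the way to the neighbour [m']: a way from [q] through
    [w] to [m'] crosses the segment from [e0] to [m] in a point [B], and since [q'], [e0], [m] are
    in line, [q'] is at least as far from [B] as the broken line from [q] over [e0] is long. *)
Lemma unfolds_next (e0 e1 : euclid2 R) q m m' A : unfolds e0 e1 q m ->
  seg e0 m A -> seg m' e1 A ->
  forall w, seg e0 e1 w -> edist q e0 + edist e0 m' <= edist q w + edist w m'.
Proof.
move=> [q' hw hm] mA m'A w ew.
have [B AB wB] := pasch m'A (segr m' e0) (segC ew).
have oB : seg e0 m B by exact: seg_sub mA (segl _ _) AB.
have q0 : edist q' e0 <= edist q e0 by exact: hw.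
have h1 := seg_dist oB.
have h2 := edtri B q' m.
have h3 := edtri w q' B.
have h4 := seg_dist (segC wB).
have h5 := edtri B e0 m'.
have h6 := hw _ ew.
lra.
Qed.

Lemma ray_opposite (a b : R) (m : euclid2 R) (r : R) : 0 <= r -> m != 0 ->
  let q' : euclid2 R := (- (r / edist 0 m) * m.1, - (r / edist 0 m) * m.2) in
  edist q' 0 = r /\ edist q' m = r + edist 0 m.
Proof.
move=> r0 m0 q'.
have d0 : edist 0 m != 0.
  by apply: contra m0 => /eqP h; rewrite eq_sym; apply/eqP/ed0_eq.
have e : m.1 ^+ 2 + m.2 ^+ 2 = edist 0 m ^+ 2 by rewrite edistE /esq /=; ring.
split; apply: edist_eqP; rewrite ?addr_ge0 ?edist_ge0 //.
  have -> : esq q' 0 = (r / edist 0 m) ^+ 2 * (m.1 ^+ 2 + m.2 ^+ 2).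
    by rewrite /esq /q' /=; ring.
  by rewrite e; field.
have -> : esq q' m = (r / edist 0 m + 1) ^+ 2 * (m.1 ^+ 2 + m.2 ^+ 2).
  by rewrite /esq /q' /=; ring.
by rewrite e; field.
Qed.

(** Turning [q] about 0 keeps its norm, so distances to the points [(x, 0)] of the door compare as
    scalar products do; the hypothesis is this comparison for the ray opposite to [m]. *)
Lemma unfolds0 l q m : 0 <= l ->
  m = 0 \/ (forall (x : R), 0 <= x <= l -> - (edist q 0 / edist 0 m) * m.1 * x >= q.1 * x) ->
  unfolds 0 (l, 0) q m.
Proof.
move=> l0 [->|H]; first by exists q => //; rewrite edxx addr0.
have [->|m0] := eqVneq m 0; first by exists q => //; rewrite edxx addr0.
have [] := @ray_opposite 0 0 m (edist q 0) _ m0 => //.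
set q' : euclid2 R := (_, _) => e1 e2.
exists q' => // w [t /andP[t0 t1] ->].
rewrite edist_leP.
have := congr1 (fun c : R => c ^+ 2) e1; rewrite !edistE /esq /lerp /= => e3.
have := H (t * l) _; rewrite mulr_ge0 //= ler_piMl // => /(_ isT).
move: e3; lra.
Qed.

Definition flipx l (z : euclid2 R) : euclid2 R := (l - z.1, z.2).
Definition flipy (z : euclid2 R) : euclid2 R := (z.1, - z.2).

Lemma edist_flipx l x y : edist (flipx l x) (flipx l y) = edist x y.
Proof. by rewrite !edist_sqrt; congr Num.sqrt; rewrite /esq /=; ring. Qed.
Lemma edist_flipy x y : edist (flipy x) (flipy y) = edist x y.
Proof. by rewrite !edist_sqrt; congr Num.sqrt; rewrite /esq /=; ring. Qed.
Lemma flipxK l : involutive (flipx l).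
Proof. by case=> a b; rewrite /flipx /=; congr pair; ring. Qed.
Lemma flipyK : involutive flipy.
Proof. by case=> a b; rewrite /flipy /= opprK. Qed.
Lemma flipx_lerp l t x y : flipx l (lerp t x y) = lerp t (flipx l x) (flipx l y).
Proof. by rewrite /flipx /lerp /=; congr pair; ring. Qed.
Lemma flipy_lerp t x y : flipy (lerp t x y) = lerp t (flipy x) (flipy y).
Proof. by rewrite /flipy /lerp /=; congr pair; ring. Qed.
Lemma flipx_seg l x y z : seg x y z -> seg (flipx l x) (flipx l y) (flipx l z).
Proof. by move=> [t ht ->]; exists t => //; rewrite flipx_lerp. Qed.
Lemma flipy_seg x y z : seg x y z -> seg (flipy x) (flipy y) (flipy z).
Proof. by move=> [t ht ->]; exists t => //; rewrite flipy_lerp. Qed.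

Lemma unfolds_flipx l (e0 e1 : euclid2 R) q m : unfolds (flipx l e0) (flipx l e1) (flipx l q) (flipx l m) ->
  unfolds e0 e1 q m.
Proof.
move=> [q' h1 h2]; exists (flipx l q').
  move=> w ew; rewrite -(flipxK l w) edist_flipx -(edist_flipx l q) flipxK.
  exact/h1/flipx_seg.
by rewrite -(flipxK l m) edist_flipx h2 !edist_flipx flipxK.
Qed.

Lemma unfolds_flipy (e0 e1 : euclid2 R) q m : unfolds (flipy e0) (flipy e1) (flipy q) (flipy m) ->
  unfolds e0 e1 q m.
Proof.
move=> [q' h1 h2]; exists (flipy q').
  move=> w ew; rewrite -(flipyK w) edist_flipy -(edist_flipy q) flipyK.
  exact/h1/flipy_seg.
by rewrite -(flipyK m) edist_flipy h2 !edist_flipy flipyK.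
Qed.

Lemma unfolds_left l q m : 0 <= l -> q.2 <= 0 -> 0 <= m.2 ->
  (q.1 <= 0 /\ m.1 <= 0) \/ (q.1 * m.2 <= m.1 * q.2 /\ 0 < m.2 - q.2) ->
  unfolds 0 (l, 0) q m.
Proof.
move=> l0 q2 m2 H; apply: unfolds0 => //.
have [->|m0] := eqVneq m 0; first by left.
right => x /andP[x0 _]; apply: ler_wpM2r => //.
have d0 : 0 < edist 0 m.
  rewrite lt_def edist_ge0 andbT; apply: contra m0 => /eqP h.
  by rewrite eq_sym; apply/eqP/ed0_eq.
(* In terms of cosines: the angles of [q] and [m] with the door add up to at least a straight angle.
   The inequality is squared once the signs are known. *)
suff : q.1 * edist 0 m <= - m.1 * edist q 0.
  have -> : - (edist q 0 / edist 0 m) * m.1 = - m.1 * edist q 0 / edist 0 m by ring.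
  by rewrite ler_pdivlMr.
have q0 := edist_ge0 q 0; have dm := edist_ge0 0 m.
have em : edist 0 m ^+ 2 = m.1 ^+ 2 + m.2 ^+ 2 by rewrite edistE /esq /=; ring.
have eq : edist q 0 ^+ 2 = q.1 ^+ 2 + q.2 ^+ 2 by rewrite edistE /esq /=; ring.
case: H => [[q1 m1]|[H D0]].
  apply: (@le_trans _ _ 0); first by rewrite mulr_le0_ge0.
  by rewrite mulr_ge0 // oppr_ge0.
have [q1|q1] := leP q.1 0.
  have [m1|m1] := leP m.1 0.
    apply: (@le_trans _ _ 0); first by rewrite mulr_le0_ge0.
    by rewrite mulr_ge0 // oppr_ge0.
  suff : m.1 * edist q 0 <= - q.1 * edist 0 m by lra.
  rewrite -ler_sqr ?nnegrE ?mulr_ge0 ?oppr_ge0 ?(ltW m1) ?(ltW q1) //.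
  rewrite !exprMn em eq.
  have : (- m.1 * q.2) ^+ 2 <= (- q.1 * m.2) ^+ 2.
    rewrite !mulNr ler_sqr ?nnegrE ?oppr_ge0 ?lerN2 //.
      by rewrite mulr_ge0_le0 // ltW.
    by rewrite mulr_le0_ge0.
  lra.
have h : 0 <= q.1 * m.2 by rewrite mulr_ge0 // ltW.
have q2N : q.2 < 0.
  rewrite lt_neqAle q2 andbT; apply/eqP => e; rewrite e mulr0 in H.
  have m20 : 0 < m.2 by move: D0; rewrite e subr0.
  have : 0 < q.1 * m.2 by rewrite mulr_gt0.
  lra.
have m1 : m.1 <= 0.
  rewrite leNgt; apply/negP => m1.
  have : m.1 * q.2 < 0 by rewrite pmulr_rlt0.
  lra.
rewrite -ler_sqr ?nnegrE ?mulr_ge0 ?oppr_ge0 ?(ltW m1) ?(ltW q1) //.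
rewrite !exprMn em eq.
have : (q.1 * m.2) ^+ 2 <= (m.1 * q.2) ^+ 2.
  by rewrite ler_sqr ?nnegrE // (le_trans h H).
lra.
Qed.

Lemma unfolds_right l q m : 0 <= l -> q.2 <= 0 -> 0 <= m.2 ->
  (l <= q.1 /\ l <= m.1) \/
  ((l - q.1) * m.2 <= (l - m.1) * q.2 /\ 0 < m.2 - q.2) ->
  unfolds (l, 0) 0 q m.
Proof.
move=> l0 q2 m2 H; apply: (@unfolds_flipx l).
have -> : flipx l (l, 0) = 0 by rewrite /flipx /= subrr.
have -> : flipx l 0 = (l, 0) by rewrite /flipx /= subr0.
apply: unfolds_left => //; case: H => [[? ?]|?]; [left|by right].
by split; rewrite /flipx /=; lra.
Qed.

(** The sides are given by the signs of [l * q.2] and [l * m.2], conditions that become empty when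
    the door is a point; then every way bends at 0. Otherwise the place where the line from [q] to
    [m] meets the axis of the door decides. *)
Lemma sees_or_unfolds l q m : 0 <= l -> l * q.2 <= 0 -> 0 <= l * m.2 ->
  [\/ sees 0 (l, 0) q m, unfolds 0 (l, 0) q m | unfolds (l, 0) 0 q m].
Proof.
move=> l0 q2 m2; have [l0'|lN] := eqVneq l 0.
  constructor 2; apply: unfolds0 => //; right => x; rewrite l0' => xx.
  have -> : x = 0 by apply/eqP; rewrite eq_le andbC.
  by rewrite !mulr0 lexx.
have lp : 0 < l by rewrite lt_def lN.
move: q2 m2; rewrite pmulr_rle0 // pmulr_rge0 // => q2 m2.
have [D0|D0] := leP (m.2 - q.2) 0.
  have q20 : q.2 = 0 by lra.
  have m20 : m.2 = 0 by lra.
  have [h|h] := boolP ((q.1 <= 0) && (m.1 <= 0)).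
    by constructor 2; apply: unfolds_left => //; left; apply/andP.
  have [h'|h'] := boolP ((l <= q.1) && (l <= m.1)).
    by constructor 3; apply: unfolds_right => //; left; apply/andP.
  constructor 1.
  have door (x : R) : 0 <= x <= l -> seg 0 (l, 0) (x, 0).
    move=> /andP[x0 xl]; exists (x / l); first by rewrite divr_ge0 //= ler_pdivrMr // mul1r.
    by rewrite /lerp /=; congr pair; field.
  have qE : q = (q.1, 0) by case: (q) q20 => a b /= ->.
  have mE : m = (m.1, 0) by case: (m) m20 => a b /= ->.
  have [hq|hq] := boolP (0 <= q.1 <= l).
    by exists q; [rewrite qE; exact: door|exact: segl].
  have [hm|hm] := boolP (0 <= m.1 <= l).
    by exists m; [rewrite mE; exact: door|exact: segr].
  exists (0, 0); first by apply: door; rewrite lexx l0.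
  have N : m.1 - q.1 != 0 by apply/eqP; lra.
  exists (- q.1 / (m.1 - q.1)); last first.
    by rewrite qE mE /lerp /=; congr pair; field.
  have [s|s] := ltP 0 (m.1 - q.1).
    by apply/andP; split; rewrite ?ler_pdivlMr ?ler_pdivrMr //; lra.
  have s' : m.1 - q.1 < 0 by rewrite lt_neqAle N.
  by apply/andP; split; rewrite ?ler_ndivlMr ?ler_ndivrMr //; lra.
(* Abscissa of the point where the line through [q] and [m] crosses the axis. *)
pose x := (q.1 * m.2 - m.1 * q.2) / (m.2 - q.2).
have N : m.2 - q.2 != 0 by exact: lt0r_neq0.
have xD : q.1 * m.2 - m.1 * q.2 = x * (m.2 - q.2) by rewrite /x; field.
have [x0|x0] := ltP x 0.
  constructor 2; apply: unfolds_left => //; right; split=> //.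
  have : x * (m.2 - q.2) < 0 by rewrite pmulr_llt0.
  lra.
have [xl|xl] := ltP l x.
  constructor 3; apply: unfolds_right => //; right; split=> //.
  have : l * (m.2 - q.2) < x * (m.2 - q.2) by rewrite ltr_pM2r.
  lra.
constructor 1; exists (x, 0).
  exists (x / l); first by rewrite divr_ge0 //= ler_pdivrMr // mul1r.
  by rewrite /lerp /=; congr pair; field; exact: lt0r_neq0.
exists (- q.2 / (m.2 - q.2)).
  by apply/andP; split; rewrite ?ler_pdivlMr ?ler_pdivrMr //; lra.
by rewrite /lerp /x /=; congr pair; field.
Qed.

End Door.

Lemma lipschitz_continuous (R : realType) (f : R -> R) (K : R) :
  (forall x y, `|f x - f y| <= K * `|x - y|) -> continuous f.
Proof.
move=> fK x; apply/cvgrPdist_le => e e0.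
pose K' := `|K| + 1; have K'0 : 0 < K' by rewrite /K' ltr_wpDl.
near=> y.
apply: le_trans (fK x y) _; apply: (@le_trans _ _ (K' * `|x - y|)).
  by rewrite ler_wpM2r // /K' (le_trans (ler_norm _)) // lerDl.
rewrite mulrC -ler_pdivlMr //; near: y.
by apply: cvgr_dist_le; [exact: cvg_id|rewrite divr_gt0].
Unshelve. all: by end_near. Qed.

Lemma lipschitz_min (R : realType) (f : R -> R) (K a b : R) : a <= b ->
  (forall x y, `|f x - f y| <= K * `|x - y|) ->
  exists2 c, a <= c <= b & forall t, a <= t <= b -> f c <= f t.
Proof.
move=> ab fK; have [|c cab hc] := @EVT_min R f a b ab.
  by apply: continuous_subspaceT; exact: lipschitz_continuous fK.
exists c => //.
Qed.

Section Rho.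
Variable R : realType.
Implicit Types (x y z w q m : euclid2 R) (s t u v l : R).

Lemma door_min (e0 e1 : euclid2 R) q m : exists w, seg e0 e1 w /\
  forall w', seg e0 e1 w' -> edist q w + edist w m <= edist q w' + edist w' m.
Proof.
pose f t := edist q (lerp t e0 e1) + edist (lerp t e0 e1) m.
have [|c c01 hc] := @lipschitz_min R f (2 * edist e0 e1) 0 1 ler01.
  move=> s t; rewrite /f.
  have e : edist (lerp s e0 e1) (lerp t e0 e1) = `|s - t| * edist e0 e1.
    exact: edist_lerp.
  have h1 := edtri (lerp s e0 e1) q (lerp t e0 e1).
  have h2 := edtri (lerp t e0 e1) q (lerp s e0 e1).
  have h3 := edtri (lerp s e0 e1) (lerp t e0 e1) m.
  have h4 := edtri (lerp t e0 e1) (lerp s e0 e1) m.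
  rewrite (edC (lerp t e0 e1) (lerp s e0 e1)) in h2 h3.
  by rewrite ler_norml; apply/andP; split; lra.
by exists (lerp c e0 e1); split; [exists c|move=> w' [t t01 ->]; exact: hc].
Qed.

(* Length of a shortest path from [q] to [m] through the door [e0, e1]. *)
Definition rho (e0 e1 : euclid2 R) q m : R :=
  let w := projT1 (cid (door_min e0 e1 q m)) in edist q w + edist w m.

Section RhoTheory.
Variables e0 e1 : euclid2 R.

Lemma rhoP q m : exists2 w, seg e0 e1 w & rho e0 e1 q m = edist q w + edist w m.
Proof. by rewrite /rho; case: (cid _) => w [we h] /=; exists w. Qed.

Lemma rho_le q m w : seg e0 e1 w -> rho e0 e1 q m <= edist q w + edist w m.
Proof. by rewrite /rho; case: (cid _) => w' [we h] /= hw; exact: h. Qed.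

Lemma rho_ge0 q m : 0 <= rho e0 e1 q m.
Proof. by have [w _ ->] := rhoP q m; rewrite addr_ge0 ?edist_ge0. Qed.

Lemma rhoC q m : rho e0 e1 q m = rho e0 e1 m q.
Proof.
suff h a b : rho e0 e1 a b <= rho e0 e1 b a by apply/eqP; rewrite eq_le !h.
have [w we ->] := rhoP b a.
by rewrite addrC (edC w) (edC b); exact: rho_le.
Qed.

Lemma rho_tri q m m' : rho e0 e1 q m <= rho e0 e1 q m' + edist m' m.
Proof.
have [w we ->] := rhoP q m'; apply: le_trans (rho_le _ _ we) _.
by rewrite -addrA lerD2l edtri.
Qed.

Lemma rho_tri2 q m m' : edist m m' <= rho e0 e1 q m + rho e0 e1 q m'.
Proof.
have [w we ->] := rhoP q m; have [w' we' ->] := rhoP q m'.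
have := edtri w m m'; have := edtri w' w m'; have := edtri q w w'.
by rewrite (edC m w) (edC w q); lra.
Qed.

Lemma edist_le_rho q m : edist q m <= rho e0 e1 q m.
Proof. by have [w we ->] := rhoP q m; exact: edtri. Qed.

Lemma rho_seg q m w : seg e0 e1 w -> seg q m w -> rho e0 e1 q m = edist q m.
Proof.
move=> we wq; apply/eqP; rewrite eq_le edist_le_rho andbT.
by rewrite -(seg_dist wq) rho_le.
Qed.

Lemma rho_end0 m : rho e0 e1 e0 m = edist e0 m.
Proof. by apply: (@rho_seg _ _ e0); exact: segl. Qed.

Lemma rho_end1 m : rho e0 e1 e1 m = edist e1 m.
Proof. by apply: (@rho_seg _ _ e1); [exact: segr|exact: segl]. Qed.

(** Common weakening of [sees], with [q' = q], and of [unfolds] at either end of the door. *)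
Definition unfolded q m := exists2 q' : euclid2 R,
  forall w, seg e0 e1 w -> edist q' w <= edist q w & rho e0 e1 q m <= edist q' m.

Lemma unfolded_dist q q' z :
  (forall w, seg e0 e1 w -> edist q' w <= edist q w) ->
  edist q' z <= rho e0 e1 q z.
Proof.
move=> h; have [w we ->] := rhoP q z.
by apply: le_trans (edtri w _ _) _; rewrite lerD2r h.
Qed.

(** Stewart's theorem for [q'], which is at least as far from the intermediate point as [rho] tells
    for [q], and at most as far from the two ends. *)
Lemma unfolded_convex q x y t : 0 <= t <= 1 -> unfolded q (lerp t x y) ->
  rho e0 e1 q (lerp t x y) ^+ 2 <=
  (1 - t) * rho e0 e1 q x ^+ 2 + t * rho e0 e1 q y ^+ 2 - t * (1 - t) * esq x y.
Proof.
move=> /andP[t0 t1] [q' h1 h2].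
apply: (@le_trans _ _ (esq q' (lerp t x y))).
  by rewrite -edistE ler_sqr ?nnegrE ?edist_ge0 ?rho_ge0.
rewrite esq_lerp lerD2r lerD // ler_wpM2l ?subr_ge0 // -edistE;
  by rewrite ler_sqr ?nnegrE ?edist_ge0 ?rho_ge0 //; exact: unfolded_dist.
Qed.
End RhoTheory.

Definition opposite l q m := (l * q.2 <= 0 /\ 0 <= l * m.2) \/ (0 <= l * q.2 /\ l * m.2 <= 0).

Lemma unfolds_unfolded (e0 e1 : euclid2 R) q m : unfolds e0 e1 q m -> unfolded e0 e1 q m.
Proof.
by move=> [q' h1 h2]; exists q' => //; rewrite h2; apply: rho_le; exact: segl.
Qed.

Lemma unfolds_unfolded_sym (e0 e1 : euclid2 R) q m : unfolds e1 e0 q m -> unfolded e0 e1 q m.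
Proof.
move=> [q' h1 h2]; exists q'; first by move=> w /segC; exact: h1.
by rewrite h2; apply: rho_le; exact: segr.
Qed.

Lemma opposite_unfolded l q m : 0 <= l -> opposite l q m -> unfolded 0 (l, 0) q m.
Proof.
move=> l0 [[h1 h2]|[h1 h2]].
  have [[w we wq]|h|h] := sees_or_unfolds l0 h1 h2.
  - by exists q => //; rewrite (rho_seg we wq).
  - exact: unfolds_unfolded.
  - exact: unfolds_unfolded_sym.
have f0 : flipy 0 = 0 :> euclid2 R by rewrite /flipy /= oppr0.
have f1 : flipy (l, 0) = (l, 0) :> euclid2 R by rewrite /flipy /= oppr0.
have [||[w we wq]|h|h] := @sees_or_unfolds R l (flipy q) (flipy m) l0.
- by rewrite /= mulrN oppr_le0.
- by rewrite /= mulrN oppr_ge0.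
- exists q => //; move: (flipy_seg wq) (flipy_seg we); rewrite f0 f1 !flipyK => h3 h4.
  by rewrite (rho_seg h4 h3).
- by apply: unfolds_unfolded; apply: unfolds_flipy; rewrite f0 f1.
- by apply: unfolds_unfolded_sym; apply: unfolds_flipy; rewrite f0 f1.
Qed.

Lemma rho_convex l q x y t : 0 <= l -> 0 <= t <= 1 -> opposite l q (lerp t x y) ->
  rho 0 (l, 0) q (lerp t x y) ^+ 2 <=
  (1 - t) * rho 0 (l, 0) q x ^+ 2 + t * rho 0 (l, 0) q y ^+ 2
    - t * (1 - t) * esq x y.
Proof. by move=> l0 t01 h; apply: unfolded_convex => //; exact: opposite_unfolded. Qed.

End Rho.

(** * Convex polygons dominating a cyclic metric *)

Section CyclicMetric.
Variable R : realType.
Implicit Types (x y z w q : euclid2 R) (s t u v : R) (i j k m n : nat).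

(** In the Euclidean plane the right side minus the left side is the squared distance between the
    point at [s] from [p] to [q] and the point at [t] from [x] to [y]. *)
Definition quad4 (T : Type) (d : T -> T -> R) (p q x y : T) :=
  forall s t, 0 <= s <= 1 -> 0 <= t <= 1 ->
  s * (1 - s) * d p q ^+ 2 + t * (1 - t) * d x y ^+ 2 <=
  (1 - s) * (1 - t) * d p x ^+ 2 + (1 - s) * t * d p y ^+ 2 +
  (s * (1 - t) * d q x ^+ 2 + s * t * d q y ^+ 2).

Record cycmet n (d : nat -> nat -> R) : Prop := Cycmet {
  cm_ge0 : forall i j, (i <= n)%N -> (j <= n)%N -> 0 <= d i j;
  cm_refl : forall i, (i <= n)%N -> d i i = 0;
  cm_sym : forall i j, (i <= n)%N -> (j <= n)%N -> d i j = d j i;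
  cm_tri : forall i j k, (i <= n)%N -> (j <= n)%N -> (k <= n)%N ->
    d i k <= d i j + d j k;
  cm_quad : forall i j k m, (i < j)%N -> (j < k)%N -> (k < m)%N -> (m <= n)%N ->
    quad4 d i k j m }.

(** Convex position in cyclic order, in a form that admits repeated and collinear vertices and
    passes to limits. *)
Definition chords_meet n (g : nat -> euclid2 R) :=
  forall i j k m, (i <= j)%N -> (j <= k)%N -> (k <= m)%N -> (m <= n)%N ->
    cross4 (g i) (g j) (g k) (g m).

(** [a] and [b] play the distances from [p] and [q] to a point at [t] between [x] and [y]; the rest
    is that [s * (1 - s) * (a + b) ^+ 2] is at most [(1 - s) * a ^+ 2 + s * b ^+ 2]. *)
Lemma quad4_mid (T : Type) (d : T -> T -> R) (p q x y : T) :
  (forall t, 0 <= t <= 1 -> exists a b : R, [/\ 0 <= d p q <= a + b,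
     a ^+ 2 <= (1 - t) * d p x ^+ 2 + t * d p y ^+ 2 - t * (1 - t) * d x y ^+ 2 &
     b ^+ 2 <= (1 - t) * d q x ^+ 2 + t * d q y ^+ 2 - t * (1 - t) * d x y ^+ 2]) ->
  quad4 d p q x y.
Proof.
move=> H s t /andP[s0 s1] /H[a [b [/andP[d0 dab] ha hb]]].
have h1 : s * (1 - s) * d p q ^+ 2 <= s * (1 - s) * (a + b) ^+ 2.
  rewrite ler_wpM2l ?mulr_ge0 ?subr_ge0 // ler_sqr ?nnegrE //.
  exact: le_trans dab.
have h2 : s * (1 - s) * (a + b) ^+ 2 <= (1 - s) * a ^+ 2 + s * b ^+ 2.
  have := sqr_ge0 ((1 - s) * a - s * b); lra.
have s1' : 0 <= 1 - s by rewrite subr_ge0.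
have h3 := ler_wpM2l s1' ha.
have h4 := ler_wpM2l s0 hb.
lra.
Qed.

Lemma quad4_sym (T : Type) (d : T -> T -> R) (p q x y : T) :
  d x p = d p x -> d y p = d p y -> d x q = d q x -> d y q = d q y ->
  quad4 d x y p q -> quad4 d p q x y.
Proof.
move=> h1 h2 h3 h4 H s t s01 t01; have := H t s t01 s01.
rewrite h1 h2 h3 h4; lra.
Qed.

Lemma quad4_edist (p q x y : euclid2 R) : quad4 (@Defs.edist R) p q x y.
Proof.
move=> s t _ _; rewrite !edistE.
have := esq_ge0 (lerp s p q) (lerp t x y); rewrite esq_lerp.
rewrite !(esq_sym (lerp s p q)) !esq_lerp (esq_sym x p) (esq_sym x q) (esq_sym y p) (esq_sym y q); lra.
Qed.

Section Attach.
Variables (n : nat) (g : nat -> euclid2 R) (l : R) (q : euclid2 R).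

(** The metric of two half planes glued along the door, restricted to the polygon [g] above it and
    the point [q] below it, which gets the index [n.+1]. *)
Definition attach i j : R :=
  if (i <= n)%N then
    if (j <= n)%N then edist (g i) (g j) else rho 0 (l, 0) q (g i)
  else if (j <= n)%N then rho 0 (l, 0) q (g j) else 0.

Hypotheses (l0 : 0 <= l) (gl : forall i, (i <= n)%N -> 0 <= l * (g i).2)
  (ql : l * q.2 <= 0).

Lemma attach_opp i j t : 0 <= t <= 1 -> (i <= n)%N -> (j <= n)%N ->
  opposite l q (lerp t (g i) (g j)).
Proof.
move=> /andP[t0 t1] hi hj; left; split => //.
have := gl hi; have := gl hj => h1 h2.
have -> : l * (lerp t (g i) (g j)).2 = (1 - t) * (l * (g i).2) + t * (l * (g j).2).
  by rewrite /lerp /=; ring.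
by rewrite addr_ge0 // mulr_ge0 // subr_ge0.
Qed.

Lemma attach_cycmet : cycmet n.+1 attach.
Proof.
split.
- move=> i j _ _; rewrite /attach.
  by case: ifP => _; case: ifP => _; rewrite ?edist_ge0 ?rho_ge0.
- move=> i _; rewrite /attach; case: ifP => hi; rewrite hi //; exact: edxx.
- move=> i j _ _; rewrite /attach; case: ifP => hi; case: ifP => hj //.
  exact: edC.
- move=> i j k _ _ _; rewrite /attach.
  case: ifP => hi; case: ifP => hk; case: ifP => hj.
  + exact: edtri.
  + exact: rho_tri2.
  + by rewrite addrC (edC (g i)); exact: rho_tri.
  + by rewrite addr0.
  + by exact: rho_tri.
  + by rewrite add0r.
  + by rewrite addr_ge0 ?rho_ge0.
  + by rewrite addr0.
- move=> i j k m ij jk km; rewrite leq_eqVlt => /orP[/eqP mn|mn].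
  + have [hi hj hk] : [/\ (i <= n)%N, (j <= n)%N & (k <= n)%N] by split; lia.
    have hm : (m <= n)%N = false by rewrite mn ltnn.
    apply: quad4_sym; rewrite /attach ?hi ?hj ?hk ?hm; try exact: edC; try by [].
    (* The chord from [g i] to [g k] stays above the door, so its points compare with [g j] by
       Stewart's theorem and with [q] by [rho_convex]. *)
    apply: quad4_mid => t t01.
    exists (edist (g j) (lerp t (g i) (g k))), (rho 0 (l, 0) q (lerp t (g i) (g k))).
    rewrite hj hi hk hm; split.
    * by rewrite rho_ge0 addrC (edC (g j)) rho_tri.
    * by rewrite !edistE esq_lerp.
    * by rewrite edistE; apply: rho_convex => //; exact: attach_opp.
  + have [hi hj hk hm] : [/\ (i <= n)%N, (j <= n)%N, (k <= n)%N & (m <= n)%N].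
      by split; lia.
    move=> s t s01 t01; rewrite /attach hi hj hk hm; exact: quad4_edist.
Qed.

End Attach.

Lemma cycmet_le n d : cycmet n.+1 d -> cycmet n d.
Proof.
case=> h1 h2 h3 h4 h5; split.
- by move=> i j hi hj; apply: h1; lia.
- by move=> i hi; apply: h2; lia.
- by move=> i j hi hj; apply: h3; lia.
- by move=> i j k hi hj hk; apply: h4; lia.
- by move=> i j k m ij jk km hm; apply: h5 => //; lia.
Qed.

Lemma cycmet_shift n d : cycmet n.+1 d -> cycmet n (fun i j => d i.+1 j.+1).
Proof.
case=> h1 h2 h3 h4 h5; split.
- by move=> i j hi hj; apply: h1; lia.
- by move=> i hi; apply: h2; lia.
- by move=> i j hi hj; apply: h3; lia.
- by move=> i j k hi hj hk; apply: h4; lia.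
- by move=> i j k m ij jk km hm; apply: (h5 i.+1 j.+1 k.+1 m.+1) => //; lia.
Qed.

(* reflection of the cyclic order 0, ..., n+1 that fixes n+1 *)
Definition crev n i := if (i <= n)%N then (n - i)%N else i.

Lemma crevK n i : crev n (crev n i) = i.
Proof.
rewrite /crev; case: (leqP i n) => hi; first by rewrite leq_subr subKn.
by rewrite leqNgt hi.
Qed.

Lemma crev_le n i : (i <= n.+1)%N -> (crev n i <= n.+1)%N.
Proof. by rewrite /crev; case: ifP; lia. Qed.

Lemma cycmet_crev n d : cycmet n.+1 d -> cycmet n.+1 (fun i j => d (crev n i) (crev n j)).
Proof.
case=> h1 h2 h3 h4 h5; split.
- by move=> i j hi hj; apply: h1; exact: crev_le.
- by move=> i hi; apply: h2; exact: crev_le.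
- by move=> i j hi hj; apply: h3; exact: crev_le.
- by move=> i j k hi hj hk; apply: h4; exact: crev_le.
- move=> i j k m ij jk km hm.
  have [hi hj hk] : [/\ (i <= n)%N, (j <= n)%N & (k <= n)%N] by split; lia.
  move: hm; rewrite leq_eqVlt => /orP[/eqP mn|mn] s t s01 t01.
  + rewrite /crev hi hj hk mn ltnn.
    have s01' : 0 <= 1 - s <= 1 by lra.
    have := h5 (n - k)%N (n - j)%N (n - i)%N n.+1 _ _ _ _ (1 - s) t s01' t01.
    have [e1 e2 e3] : [/\ (n - k < n - j)%N, (n - j < n - i)%N & (n - i < n.+1)%N].
      by split; lia.
    move=> /(_ e1 e2 e3 (leqnn _)); rewrite (h3 (n - k)%N (n - i)%N); [|lia..].
    by lra.
  + have hm : (m <= n)%N by lia.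
    rewrite /crev hi hj hk hm.
    have s01' : 0 <= 1 - s <= 1 by lra.
    have t01' : 0 <= 1 - t <= 1 by lra.
    have [e1 e2 e3 e4] : [/\ (n - m < n - k)%N, (n - k < n - j)%N, (n - j < n - i)%N & (n - i <= n.+1)%N].
      by split; lia.
    have := h5 (n - m)%N (n - k)%N (n - j)%N (n - i)%N e1 e2 e3 e4 (1 - t) (1 - s) t01' s01'.
    rewrite (h3 (n - m)%N (n - j)%N) ?(h3 (n - k)%N (n - i)%N) ?(h3 (n - m)%N (n - k)%N)
      ?(h3 (n - m)%N (n - i)%N) ?(h3 (n - j)%N (n - k)%N) ?(h3 (n - j)%N (n - i)%N); try lia.
    by lra.
Qed.

End CyclicMetric.

Section Polygons.
Variable R : realType.
Implicit Types (x y z w q : euclid2 R) (s t u v : R) (i j k m n : nat)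
  (d : nat -> nat -> R) (g h : nat -> euclid2 R).

Lemma cross4ll x y z : cross4 x x y z.
Proof. by exists x; exact: segl. Qed.
Lemma cross4rr x y z : cross4 x y z z.
Proof. by exists z; exact: segr. Qed.

Lemma cross4C x y z w : cross4 x y z w -> cross4 y z w x.
Proof. by move=> [a h1 h2]; exists a => //; exact: segC. Qed.

Record polygon_above n d g : Prop := PolygonAbove {
  pa_edge : forall i, (i < n)%N -> edist (g i) (g i.+1) = d i i.+1;
  pa_close : edist (g 0%N) (g n) = d 0%N n;
  pa_dom : forall i j, (i <= n)%N -> (j <= n)%N -> d i j <= edist (g i) (g j);
  pa_chords : chords_meet n g }.

Record in_position n d g : Prop := InPosition {
  ip_0 : g 0%N = 0;
  ip_n : g n = (d 0%N n, 0);
  ip_side : forall i, (i <= n)%N -> 0 <= d 0%N n * (g i).2 }.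

Lemma polygon_above_isometry n d g (f : euclid2 R -> euclid2 R) :
  (forall x y, edist (f x) (f y) = edist x y) ->
  (forall t x y, f (lerp t x y) = lerp t (f x) (f y)) ->
  polygon_above n d g -> polygon_above n d (f \o g).
Proof.
move=> f1 f2 [h1 h2 h3 h4]; split.
- by move=> i hi /=; rewrite f1; exact: h1.
- by rewrite /= f1.
- by move=> i j hi hj /=; rewrite f1; exact: h3.
- move=> i j k m ij jk km mn; have [w [s s01 ->] [t t01 e]] := h4 _ _ _ _ ij jk km mn.
  exists (f (lerp s (g i) (g k))); first by exists s => //; rewrite f2.
  by exists t => //; rewrite e f2.
Qed.

Lemma put_in_position n d g : polygon_above n d g ->
  exists2 g', polygon_above n d g' & in_position n d g'.
Proof.
move=> gP; have [_ gc _ _] := gP.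
have [d0|dN] := eqVneq (d 0%N n) 0.
  pose f x : euclid2 R := (x.1 - (g 0%N).1, x.2 - (g 0%N).2).
  exists (f \o g).
    apply: polygon_above_isometry gP.
      by move=> x y; rewrite !edist_sqrt /esq /=; congr Num.sqrt; ring.
    by move=> t x y; rewrite /f /lerp /=; congr pair; ring.
  have g0n : g 0%N = g n by apply: ed0_eq; rewrite gc.
  split; rewrite /= /f ?d0 -?g0n ?subrr // => i _; by rewrite mul0r.
have l0 : 0 < d 0%N n by rewrite lt_def dN -gc edist_ge0.
set l := d 0%N n in gc dN l0 *.
pose c := ((g n).1 - (g 0%N).1) / l; pose s := ((g n).2 - (g 0%N).2) / l.
have cs : c ^+ 2 + s ^+ 2 = 1.
  have e : ((g n).1 - (g 0%N).1) ^+ 2 + ((g n).2 - (g 0%N).2) ^+ 2 = l ^+ 2.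
    by rewrite -gc edistE /esq; ring.
  have -> : c ^+ 2 + s ^+ 2 =
    (((g n).1 - (g 0%N).1) ^+ 2 + ((g n).2 - (g 0%N).2) ^+ 2) / l ^+ 2.
    by rewrite /c /s; field.
  by rewrite e divff // expf_neq0.
pose f x : euclid2 R := (c * (x.1 - (g 0%N).1) + s * (x.2 - (g 0%N).2),
   c * (x.2 - (g 0%N).2) - s * (x.1 - (g 0%N).1)).
have fi x y : edist (f x) (f y) = edist x y.
  rewrite !edist_sqrt; congr Num.sqrt.
  have -> : esq (f x) (f y) = (c ^+ 2 + s ^+ 2) * esq x y by rewrite /esq /f /=; ring.
  by rewrite cs mul1r.
have fl t x y : f (lerp t x y) = lerp t (f x) (f y).
  by rewrite /f /lerp /=; congr pair; ring.
have f0 : f (g 0%N) = 0 by rewrite /f !subrr !mulr0 addr0 subr0.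
have fn : f (g n) = (l, 0).
  rewrite /f; have -> : (g n).1 - (g 0%N).1 = c * l by rewrite /c; field.
  have -> : (g n).2 - (g 0%N).2 = s * l by rewrite /s; field.
  congr pair; last by ring.
  have -> : c * (c * l) + s * (s * l) = (c ^+ 2 + s ^+ 2) * l by ring.
  by rewrite cs mul1r.
have fP := polygon_above_isometry fi fl gP.
(* The chord from 0 to the later vertex meets the chord from the earlier vertex to [(l, 0)]; with
   the vertices strictly on opposite sides of the axis, the meeting point would have to be both 0
   and [(l, 0)]. *)
have side i j : (i <= n)%N -> (j <= n)%N -> (f (g i)).2 < 0 -> 0 < (f (g j)).2 -> False.
  move=> hi hj yi yj; have [_ _ _ ch] := fP.
  have cN (a b : R) (a' b' : R) : a * b < 0 -> 0 <= a' <= 1 -> 0 <= b' <= 1 ->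
     a' * a = (1 - b') * b -> a' = 0 /\ b' = 1.
    move=> ab /andP[a0 a1] /andP[b0 b1] e.
    have aN : a ^+ 2 > 0 by rewrite exprn_even_gt0 //=; apply: contraTneq ab => ->; rewrite mul0r ltxx.
    have h1 : a' * a ^+ 2 <= 0.
      have -> : a' * a ^+ 2 = (1 - b') * (a * b) by rewrite expr2 mulrA e; ring.
      by rewrite mulr_ge0_le0 ?subr_ge0 // ltW.
    have a'0 : a' = 0.
      apply/eqP; rewrite eq_le a0 andbT leNgt; apply/negP => h.
      have : 0 < a' * a ^+ 2 by rewrite mulr_gt0.
      lra.
    have bN : b != 0 by apply: contraTneq ab => ->; rewrite mulr0 ltxx.
    split=> //; move: e; rewrite a'0 mul0r => /esym/eqP.
    by rewrite mulf_eq0 (negPf bN) orbF subr_eq0 => /eqP.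
  have key a b : (a <= n)%N -> (b <= n)%N -> (a <= b)%N -> (f (g a)).2 * (f (g b)).2 < 0 -> False.
    move=> ha hb ab neg.
    have [w [t t01 e1] [u u01 e2]] := ch 0%N a b n (leq0n _) ab hb (leqnn _).
    move: e1 e2; rewrite /= f0 fn => -> e.
    have := congr1 snd e; rewrite /= !mulr0 add0r addr0 => e'.
    have [t0 u1] : t = 0 /\ u = 1 by apply: cN t01 u01 e'; rewrite mulrC.
    have := congr1 fst e; rewrite /= t0 u1.
    rewrite subrr !mul0r mulr0 addr0 add0r mul1r => /esym /eqP.
    by apply/negP.
  case: (leqP i j) => [ij|/ltnW ji].
    by apply: key hi hj ij _; rewrite pmulr_llt0.
  by apply: key hj hi ji _; rewrite pmulr_rlt0.
have [[i hi yi]|no] := pselect (exists2 i, (i <= n)%N & (f (g i)).2 < 0).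
  exists (@flipy R \o (f \o g)).
    apply: polygon_above_isometry fP; first exact: edist_flipy.
    exact: flipy_lerp.
  split; rewrite /= ?f0 ?fn /flipy /= ?oppr0 // => j hj.
  rewrite mulr_ge0 ?(ltW l0) // oppr_ge0 leNgt; apply/negP.
  exact: side yi.
exists (f \o g) => //; split; rewrite //= => i hi.
rewrite mulr_ge0 ?(ltW l0) // leNgt; apply/negP => yi; apply: no; by exists i.
Qed.

Lemma le_of_scaled (a b : R) : (forall s, 0 < s < 1 -> (1 - s) * a <= b) -> a <= b.
Proof.
move=> H; rewrite leNgt; apply/negP => ba.
have h0 : 0 < 1 / 2 :> R by rewrite divr_gt0.
have h1 : 1 / 2 < 1 :> R by rewrite ltr_pdivrMr // mul1r ltr1n.
have h : 0 < (1 / 2 : R) < 1 by rewrite h0.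
have [a0|a0] := leP a 0; first by have := H _ h; lra.
have bp : 0 <= b by apply: le_trans (H _ h); rewrite mulr_ge0 //; lra.
have := H ((a - b) / (2 * a)).
have -> : (1 - (a - b) / (2 * a)) * a = (a + b) / 2 by field; lra.
have h' : 0 < (a - b) / (2 * a) < 1.
  by apply/andP; split; [rewrite divr_gt0 //; lra|rewrite ltr_pdivrMr; lra].
by move=> /(_ h'); lra.
Qed.

(** By hypothesis vertex 0 lies on a shortest path between its neighbours 1 and [n.+1], so it may be
    left out and put back on the closing side of the smaller polygon. *)
Lemma insert_straight_vertex n d h : cycmet n.+1 d ->
  d 1%N n.+1 = d 0%N 1%N + d 0%N n.+1 ->
  polygon_above n (fun i j => d i.+1 j.+1) h ->
  exists g, polygon_above n.+1 d g.
Proof.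
move=> dC; set D := d 1%N n.+1 => dD [h1 h2 h3 h4].
have [d0 _ dS _ dQ] := dC.
have d01 : 0 <= d 0%N 1%N by exact: d0.
have d0n : 0 <= d 0%N n.+1 by exact: d0.
have D0 : 0 <= D by exact: d0.
pose t := if D == 0 then 0 else d 0%N 1%N / D.
have [t01 [e1 e2]] : 0 <= t <= 1 /\ d 0%N 1%N = t * D /\ d 0%N n.+1 = (1 - t) * D.
  rewrite /t; case: eqVneq => [D00|DN]; first by rewrite lexx ler01; split => //; lra.
  have Dp : 0 < D by rewrite lt_def DN.
  split.
    by apply/andP; split; [rewrite divr_ge0|rewrite ler_pdivrMr // mul1r; lra].
  by split; [field|rewrite dD; field; rewrite -dD].
have /andP[t0 t1] := t01.
pose g i := if i is i'.+1 then h i' else lerp t (h 0%N) (h n).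
exists g.
have hD : edist (h 0%N) (h n) = D by rewrite h2.
have g01 : edist (g 0%N) (h 0%N) = d 0%N 1%N.
  by rewrite e1 edC /= edist_lerpl // hD.
have g0n : edist (g 0%N) (h n) = d 0%N n.+1.
  by rewrite e2 /= edist_lerpr // hD.
have dom0 j : (j <= n)%N -> d 0%N j.+1 <= edist (g 0%N) (h j).
  move=> jn; have [->|j0] := eqVneq j 0%N; first by rewrite g01.
  have [->|jN] := eqVneq j n; first by rewrite g0n.
  have dj : 0 <= d 0%N j.+1 by apply: d0; lia.
  apply: edist_ge => //; rewrite esq_sym esq_lerp.
  apply: (@le_trans _ _ ((1 - t) * d j.+1 1%N ^+ 2 + t * d j.+1 n.+1 ^+ 2 - t * (1 - t) * D ^+ 2)).
    (* Vertex 0 divides [D] in the ratio given by [t], so the terms of [cm_quad] that are free of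
       [s] cancel; dividing by [s] and letting [s] tend to 0 leaves Stewart's inequality. *)
    apply: le_of_scaled => s /andP[s0 s1].
    have [q1 q2 q3 q4] : [/\ (0 < 1)%N, (1 < j.+1)%N, (j.+1 < n.+1)%N & (n.+1 <= n.+1)%N].
      by split; lia.
    have s01 : 0 <= s <= 1 by lra.
    have := dQ _ _ _ _ q1 q2 q3 q4 s t s01 t01; rewrite -/D e1 e2 => H.
    rewrite -(ler_pM2l s0).
    have : s * (1 - s) * d 0%N j.+1 ^+ 2 <= s * (1 - t) * d j.+1 1%N ^+ 2 + s * t * d j.+1 n.+1 ^+ 2 - s * t * (1 - t) * D ^+ 2.
      by lra.
    by lra.
  rewrite -hD -!edistE lerD2r lerD // ler_wpM2l ?subr_ge0 //;
    rewrite ler_sqr ?nnegrE ?edist_ge0 ?d0 //; first by apply: (h3 j 0%N).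
  by apply: (h3 j n).
split.
- case=> [|i] hi /=; first by rewrite g01.
  by rewrite h1.
- by rewrite g0n.
- case=> [|i] [|j] hi hj.
  + by rewrite (cm_refl dC) // edxx.
  + exact: dom0.
  + by rewrite dS // edC; exact: dom0.
  + exact: h3.
- case=> [|i] [|j] [|k] [|m] // ij jk km mn; try exact: cross4ll; last exact: h4.
  (* Pasch's axiom in the triangle [h 0], [h k], [h n]: the chord from [h j] to [h m] has points on
     the two sides at [h k]. *)
  have [p p1 p2] := h4 0%N j k m (leq0n _) jk km mn.
  have [q q1 q2] := h4 j k m n jk km mn (leqnn _).
  have [r r1 r2] := pasch (segC p1) q2 (seg_lerp (h 0%N) (h n) t01).
  by exists r; [exact: segC|exact: seg_sub p2 q1 r1].
Qed.

Lemma polygon_above_crev n d g :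
  (forall i j, (i <= n.+1)%N -> (j <= n.+1)%N -> d i j = d j i) ->
  polygon_above n.+1 (fun i j => d (crev n i) (crev n j)) g ->
  polygon_above n.+1 d (g \o crev n).
Proof.
move=> dS [h1 h2 h3 h4]; split.
- move=> i; rewrite ltnS leq_eqVlt => /orP[/eqP ->|hi] /=.
    by rewrite /crev leqnn ltnn subnn h2 /crev /= ltnn subn0.
  rewrite /crev (ltnW hi) hi edC.
  have e : (n - i = (n - i.+1).+1)%N by lia.
  rewrite e h1; last by lia.
  rewrite -e /crev !leq_subr !subKn ?(ltnW hi) // dS //; lia.
- rewrite /= /crev /= ltnn subn0 h1 // /crev leqnn ltnn subnn //.
- by move=> i j hi hj /=; rewrite -{1}(crevK n i) -{1}(crevK n j); apply: h3; exact: crev_le.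
- move=> i j k m ij jk km mn /=; have [mE|mn'] : m = n.+1 \/ (m <= n)%N by lia.
    subst m.
    have [kn|kn] := leqP k n; last first.
      have -> : k = n.+1 by lia.
      by rewrite /crev ltnn; exact: cross4rr.
    have [jn iN] : (j <= n)%N /\ (i <= n)%N by lia.
    rewrite /crev ltnn kn jn iN.
    have [||||w w1 w2] := h4 (n - k)%N (n - j)%N (n - i)%N n.+1; try lia.
    by exists w => //; exact: segC.
  have [kn [jn iN]] : (k <= n)%N /\ (j <= n)%N /\ (i <= n)%N by lia.
  rewrite /crev mn' kn jn iN.
  have [||||w w1 w2] := h4 (n - m)%N (n - k)%N (n - j)%N (n - i)%N; try lia.
  by exists w; exact: segC.
Qed.

End Polygons.

(** * Existence of dominating convex polygons *)

Section PolygonExistence.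
Variable R : realType.
Implicit Types (x y z w q : euclid2 R) (s t u v : R) (i j k m n : nat)
  (d : nat -> nat -> R) (g h : nat -> euclid2 R).

Lemma planar_triangle (a b c : R) : 0 <= a -> 0 <= b -> 0 <= c ->
  a <= b + c -> b <= a + c -> c <= a + b ->
  exists q : euclid2 R, [/\ q.2 <= 0, edist 0 q = a & edist (c, 0) q = b].
Proof.
move=> a0 b0 c0 abc bac cab; have [cE|cN] := eqVneq c 0.
  exists (0, - a); split; rewrite ?oppr_le0 //=; apply: edist_eqP => //; rewrite /esq /= ?cE.
    by ring.
  have -> : b = a by lra.
  by ring.
have cp : 0 < c by rewrite lt_def cN.
pose x := (a ^+ 2 + c ^+ 2 - b ^+ 2) / (2 * c).
have xc : 2 * (x * c) = a ^+ 2 + c ^+ 2 - b ^+ 2 by rewrite /x; field.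
have b2 : b ^+ 2 <= (a + c) ^+ 2 by rewrite ler_sqr ?nnegrE ?addr_ge0.
have b2' : (a - c) ^+ 2 <= b ^+ 2.
  rewrite -[leLHS]real_normK ?num_real // ler_sqr ?nnegrE //.
  by rewrite ler_norml; apply/andP; split; lra.
have h1 : x <= a by rewrite -(ler_pM2r cp); lra.
have h2 : - a <= x by rewrite -(ler_pM2r cp); lra.
have xa : x ^+ 2 <= a ^+ 2.
  rewrite -[leLHS]real_normK ?num_real // ler_sqr ?nnegrE //.
  by rewrite ler_norml h2 h1.
have y2 : Num.sqrt (a ^+ 2 - x ^+ 2) ^+ 2 = a ^+ 2 - x ^+ 2.
  by rewrite sqr_sqrtr // subr_ge0.
exists (x, - Num.sqrt (a ^+ 2 - x ^+ 2)); split.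
- by rewrite /= oppr_le0 sqrtr_ge0.
- apply: edist_eqP => //; rewrite /esq /= !sub0r opprK sqrrN y2; ring.
- apply: edist_eqP => //; rewrite /esq /= !sub0r opprK y2; lra.
Qed.

Lemma polygon_above_le n d d' g :
  (forall i, (i < n)%N -> d' i i.+1 = d i i.+1) -> d' 0%N n = d 0%N n ->
  (forall i j, (i <= n)%N -> (j <= n)%N -> d i j <= d' i j) ->
  polygon_above n d' g -> polygon_above n d g.
Proof.
move=> e1 e2 e3 [h1 h2 h3 h4]; split => //.
- by move=> i hi; rewrite h1 // e1.
- by rewrite h2 e2.
- by move=> i j hi hj; apply: le_trans (h3 _ _ hi hj); exact: e3.
Qed.

Section AttachAbove.
Variables (n : nat) (d : nat -> nat -> R) (g : nat -> euclid2 R) (q : euclid2 R).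
Hypotheses (dC : cycmet n.+1 d) (gP : polygon_above n d g) (gN : in_position n d g).
Let l := d 0%N n.
Hypotheses (q2 : q.2 <= 0) (q0 : edist 0 q = d 0%N n.+1)
  (ql : edist (l, 0) q = d n n.+1).

Lemma attach_l0 : 0 <= l. Proof. by rewrite /l -(pa_close gP) edist_ge0. Qed.

Lemma attach_ql : l * q.2 <= 0.
Proof. by rewrite mulr_ge0_le0 // attach_l0. Qed.

Lemma attach_cycmet_above : cycmet n.+1 (attach n g l q).
Proof.
apply: attach_cycmet; [exact: attach_l0|exact: ip_side gN|exact: attach_ql].
Qed.

(** For a way from [q] to [g k] through the door point at [s], [cm_quad] with the diagonals from 0
    to [n] and from [k] to [n.+1] gives the hypothesis of [le_sum_of_weighted] for all weights: the
    polygon dominates [d] above the door, and the triangle below it has the exact sides. *)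
Lemma attach_dom i j : (i <= n.+1)%N -> (j <= n.+1)%N -> d i j <= attach n g l q i j.
Proof.
have key k : (k <= n)%N -> d k n.+1 <= rho 0 (l, 0) q (g k).
  move=> kn; have [w we ->] := rhoP 0 (l, 0) q (g k).
  have [d0 _ dS dT dQ] := dC.
  have [k0|k0] := eqVneq k 0%N.
    by rewrite k0 (ip_0 gN) -q0 addrC -(edC 0); have := edtri w 0 q; rewrite (edC w q).
  have [kE|kN] := eqVneq k n.
    by rewrite kE (ip_n gN) -ql; have := edtri w (l, 0) q; rewrite (edC w q) (edC w) addrC.
  have kn' : (k <= n.+1)%N by lia.
  apply: le_sum_of_weighted; rewrite ?edist_ge0 ?d0 // => t /andP[t0 t1].
  have [s s01 wE] := we.
  have t01 : 0 <= t <= 1 by lra.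
  have t01' : 0 <= 1 - t <= 1 by lra.
  have e1 : (0 < k)%N by rewrite lt0n.
  have e2 : (k < n)%N by rewrite ltn_neqAle kN.
  have e3 := ltnSn n.
  have := dQ _ _ _ _ e1 e2 e3 (leqnn _) s (1 - t) s01 t01'.
  have /andP[s0 s1] := s01.
  have hk : esq w (g k) >= (1 - s) * d 0%N k ^+ 2 + s * d n k ^+ 2 - s * (1 - s) * l ^+ 2.
    rewrite wE esq_sym esq_lerp -[esq 0 _]edistE -(ip_0 gN) -(ip_n gN) (pa_close gP).
    have nn := leqnSn n.
    rewrite lerD2r lerD // ler_wpM2l ?subr_ge0 // -edistE ler_sqr ?nnegrE ?edist_ge0 ?d0 //.
      by rewrite edC; apply: (pa_dom gP).
    by rewrite edC; apply: (pa_dom gP).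
  have hq : esq q w = (1 - s) * d 0%N n.+1 ^+ 2 + s * d n n.+1 ^+ 2 - s * (1 - s) * l ^+ 2.
    rewrite wE esq_lerp -!edistE (edC q 0) (edC q) q0 ql; congr (_ - _ * _ ^+ 2).
    by rewrite -(ip_0 gN) -(ip_n gN) (pa_close gP).
  rewrite !edistE hq => H.
  have h2 := ler_wpM2l (ltW t0) hk.
  rewrite -/l in H; lra.
have [dS d00] : (forall i j, (i <= n.+1)%N -> (j <= n.+1)%N -> d i j = d j i) /\ d n.+1 n.+1 = 0.
  by split; [exact: cm_sym dC|exact: (cm_refl dC)].
move=> hi hj; rewrite /attach; case: ifP => h1; case: ifP => h2.
- exact: (pa_dom gP).
- by have -> : j = n.+1; [lia|exact: key].
- by have -> : i = n.+1; [lia|rewrite dS //; exact: key].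
- by have [-> ->] : i = n.+1 /\ j = n.+1; [lia|rewrite d00].
Qed.

Lemma attach_edge i : (i < n.+1)%N -> attach n g l q i i.+1 = d i i.+1.
Proof.
rewrite ltnS leq_eqVlt => /orP[/eqP ->|hi]; rewrite /attach.
  by rewrite leqnn ltnn rhoC (ip_n gN) rho_end1.
by rewrite hi (ltnW hi) (pa_edge gP).
Qed.

Lemma attach_close : attach n g l q 0 n.+1 = d 0%N n.+1.
Proof. by rewrite /attach leq0n ltnn rhoC (ip_0 gN) rho_end0. Qed.

(** When all ways through the door are straight, the glued metric is the planar one and [q] can be
    appended to the polygon. *)
Lemma attach_convex : (forall i, (0 < i)%N -> (i < n)%N -> sees 0 (l, 0) q (g i)) ->
  polygon_above n.+1 d (fun i => if (i <= n)%N then g i else q).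
Proof.
move=> H; have l0 := attach_l0.
have H' i : (i <= n)%N -> sees 0 (l, 0) q (g i).
  move=> hi; have [->|i0] := eqVneq i 0%N.
    by rewrite (ip_0 gN); exists 0; [exact: segl|exact: segr].
  have [->|iN] := eqVneq i n.
    by rewrite (ip_n gN); exists (l, 0); exact: segr.
  by apply: H; lia.
apply: (@polygon_above_le _ _ (attach n g l q)).
- exact: attach_edge.
- exact: attach_close.
- exact: attach_dom.
have e i j : (i <= n.+1)%N -> (j <= n.+1)%N -> edist (if (i <= n)%N then g i else q)
  (if (j <= n)%N then g j else q) = attach n g l q i j.
  move=> hi hj; rewrite /attach; case: ifP => h1; case: ifP => h2 //.
  - by have [w w1 w2] := H' _ h1; rewrite (rho_seg w1 w2) edC.
  - by have [w w1 w2] := H' _ h2; rewrite (rho_seg w1 w2).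
  - exact: edxx.
split.
- by move=> i hi; rewrite e // ltnW.
- exact: (e _ _ (leq0n _) (leqnn _)).
- by move=> i j hi hj; rewrite e.
move=> i j k m ij jk km mn.
have [mE|mn'] : m = n.+1 \/ (m <= n)%N by lia.
  subst m; have [kn|kn] := leqP k n; last first.
    by rewrite ltnn; exact: cross4rr.
  have [jn iN] : (j <= n)%N /\ (i <= n)%N by lia.
  rewrite ltnn jn iN.
  have [w w1 w2] := H' _ jn.
  have [a a1 a2] := pa_chords gP ij jk kn (leqnn n).
  have [b b1 b2] := pa_chords gP (leq0n i) ij jk kn.
  move: a1 a2 b1 b2; rewrite (ip_0 gN) (ip_n gN) -/l => a1 a2 b1 b2.
  have [r r1 r2] := pasch (segC b1) a2 w1.
  exists r; first exact: seg_sub b2 a1 r1.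
  exact: seg_sub (segl _ _) (segC w2) r2.
have [kn [jn iN]] : (k <= n)%N /\ (j <= n)%N /\ (i <= n)%N by lia.
rewrite mn' kn jn iN; exact: (pa_chords gP).
Qed.

End AttachAbove.

Theorem polygon_above_exists n d : cycmet n d -> exists g, polygon_above n d g.
Proof.
elim: n d => [|n IH] d dC.
  exists (fun=> 0); split => //.
  - by rewrite edxx (cm_refl dC).
  - move=> i j; rewrite !leqn0 => /eqP -> /eqP ->; by rewrite edxx (cm_refl dC).
  - by move=> i j k m _ _ _ _; exact: cross4ll.
have [g0 g0P] := IH _ (cycmet_le dC).
have [g gP gN] := put_in_position g0P.
have [d0 dR dS dT dQ] := dC.
have [||||||q [q2 q0 ql]] := @planar_triangle (d 0%N n.+1) (d n n.+1) (d 0%N n).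
- exact: d0.
- by apply: d0; lia.
- by apply: d0; lia.
- by rewrite addrC; apply: dT; lia.
- by rewrite addrC (dS 0%N n) //; apply: dT; lia.
- by rewrite (dS n n.+1) //; apply: dT; lia.
set l := d 0%N n in ql.
have AC := attach_cycmet_above gP gN q2.
have AD := attach_dom dC gP gN q2 q0 ql.
have AE := attach_edge gP gN ql.
have AL := attach_close gN q0.
have [H|] := pselect (forall i, (0 < i)%N -> (i < n)%N -> sees 0 (l, 0) q (g i)).
  exists (fun i => if (i <= n)%N then g i else q); exact: attach_convex.
move=> /existsNP[i /not_implyP[i0 /not_implyP[iN ns]]].
have l0 := attach_l0 gP.
have [?|u0|u1] := sees_or_unfolds l0 (attach_ql gP q2) (ip_side gN (ltnW iN)) => //.
(* The way from [q] to [g i] bends at 0, hence by [unfolds_next] so does the way to [g 1], since the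
   chord from 0 to [g i] meets the one from [g 1] to [g n]. So 0 is a straight vertex of the glued
   metric, and without it there are [n.+1] vertices, as the induction hypothesis requires. *)
- have [h hP] := IH _ (cycmet_shift AC).
  have [a a1 a2] := pa_chords gP (leq0n 1) i0 (ltnW iN) (leqnn n).
  have [|g' g'P] := insert_straight_vertex AC _ hP; last first.
    exists g'; exact: polygon_above_le AE AL AD g'P.
  have n0 : (0 < n)%N by lia.
  rewrite /attach n0 ltnn leq0n (ip_0 gN) addrC.
  apply/eqP; rewrite eq_le; apply/andP; split.
    apply: le_trans (rho_le _ _ (segl 0 _)) _.
    by rewrite [rho _ _ _ 0]rhoC rho_end0 (edC q 0).
  rewrite [rho _ _ _ 0]rhoC rho_end0 (edC 0 q).
  have [w we ->] := rhoP 0 (l, 0) q (g 1%N).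
  move: a1 a2; rewrite (ip_0 gN) (ip_n gN) => a1 a2.
  exact: unfolds_next u0 a1 a2 _ we.
(* The same at the other end of the door, which the reflection [crev] brings to index 0. *)
- have AC' := cycmet_crev AC.
  have [h hP] := IH _ (cycmet_shift AC').
  have i1 : (i <= n.-1)%N by lia.
  have [a a1 a2] := pa_chords gP (leq0n i) i1 (leq_pred n) (leqnn n).
  have [|g' g'P] := insert_straight_vertex AC' _ hP; last first.
    exists (g' \o crev n); apply: polygon_above_le AE AL AD _.
    apply: polygon_above_crev g'P; exact: cm_sym AC.
  have n0 : (0 < n)%N by lia.
  rewrite /crev n0 ltnn leq0n subn0 subn1 /attach ltnn leqnn leq_pred (ip_n gN) -/l addrC.
  apply/eqP; rewrite eq_le; apply/andP; split.
    apply: le_trans (rho_le _ _ (segr 0 _)) _.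
    by rewrite [rho _ _ _ (l, 0)]rhoC rho_end1 (edC q (l, 0)).
  rewrite [rho _ _ _ (l, 0)]rhoC rho_end1 (edC (l, 0) q).
  have [w we ->] := rhoP 0 (l, 0) q (g n.-1).
  move: a1 a2; rewrite (ip_0 gN) (ip_n gN) -/l => a1 a2.
  apply: unfolds_next u1 (segC a2) (segC a1) _ (segC we).
Qed.

Corollary polygon_in_position_exists n d : cycmet n d ->
  exists2 g, polygon_above n d g & in_position n d g.
Proof. by move=> /polygon_above_exists[g /put_in_position]. Qed.

End PolygonExistence.

(** * Kirszbraun extension *)

(** Ultrafilters replace subsequences: a single one makes bounded functions converge for uncountably
    many parameters at once. *)
Lemma ultra_cvg_bounded (R : realType) (I : Type) (U : set_system I) (f : I -> R) (a b : R) :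
  UltraFilter U -> U [set i | a <= f i <= b] -> exists l : R, f @ U --> l.
Proof.
move=> UU Uf; have := @segment_compact R a b (f @ U) _.
case.
  suff : U (f @^-1` `[a, b]) by [].
  by apply: filterS Uf => i; rewrite /= in_itv.
move=> l [_ cl]; exists l => A Al.
have [//|UA] := in_ultra_setVsetC (f @^-1` A) UU.
have [|x [nAx Ax]] := cl (~` A) A _ Al; first exact: UA.
by [].
Qed.

Lemma ultra_le (R : realType) (I : Type) (U : set_system I) (f g : I -> R) (a b : R) :
  UltraFilter U -> f @ U --> a -> g @ U --> b -> U [set i | f i <= g i] -> a <= b.
Proof.
move=> UU fa gb h; rewrite -subr_ge0; apply: (cvgr_to_ge (cvgB gb fa)).
by apply: filterS h => i; rewrite /= subr_ge0.
Qed.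

Lemma ultra_eq (R : realType) (I : Type) (U : set_system I) (f : I -> R) (a b : R) :
  UltraFilter U -> f @ U --> a -> f @ U --> b -> a = b.
Proof.
move=> UU fa fb; apply/eqP; rewrite eq_le.
by rewrite (ultra_le UU fa fb) ?(ultra_le UU fb fa) //; apply: filterE => i /=.
Qed.

Lemma cvg_sumr (R : realType) (I : Type) (U : set_system I) n
    (f : 'I_n -> I -> R) (a : 'I_n -> R) : Filter U ->
  (forall k, f k @ U --> a k) -> (fun i => \sum_(k < n) f k i) @ U --> \sum_(k < n) a k.
Proof.
move=> UU; elim: n f a => [|n IH] f a H.
  under eq_fun do rewrite big_ord0.
  by rewrite big_ord0; exact: cvg_cst.
under eq_fun do rewrite big_ord_recl.
rewrite big_ord_recl; apply: cvgD; first exact: H.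
exact: IH.
Qed.

Section Kirszbraun.
Variables (R : realType) (Y : Type) (delta : Y -> Y -> R) (P : Y -> Prop).

Hypothesis delta_ge0 : forall x y, P x -> P y -> 0 <= delta x y.
Hypothesis delta_refl : forall x, P x -> delta x x = 0.
Hypothesis delta_sym : forall x y, P x -> P y -> delta x y = delta y x.
Hypothesis delta_tri : forall x y z, P x -> P y -> P z ->
  delta x z <= delta x y + delta y z.
Hypothesis delta_convex : forall x y, P x -> P y -> forall t : R, 0 <= t <= 1 ->
  exists2 m, P m & forall z, P z ->
  delta z m ^+ 2 <= (1 - t) * delta z x ^+ 2 + t * delta z y ^+ 2
                    - t * (1 - t) * delta x y ^+ 2.
Hypothesis delta_compact : forall (I : Type) (U : set_system I), UltraFilter U ->
  forall f : I -> Y, U [set i | P (f i)] ->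
  exists2 y, P y & forall z, P z -> (fun i => delta (f i) z) @ U --> delta y z.

(** An ultrafilter finer than the filter of sublevel sets of [phi] converges by compactness. *)
Lemma attains_min (phi : Y -> R) (c : R) : (exists y, P y) ->
  (forall y, P y -> c <= phi y) ->
  (forall (U : set_system Y), UltraFilter U -> U P -> forall y, P y ->
     (forall z, P z -> (fun x => delta x z) @ U --> delta y z) ->
     phi @ U --> phi y) ->
  exists2 y, P y & forall x, P x -> phi y <= phi x.
Proof.
move=> [y0 Py0] lb cont.
pose S := [set phi y | y in P].
have Sinf : has_inf S.
  by split; [exists (phi y0), y0|exists c => _ [y Py <-]; exact: lb].
pose F : set_system Y := filter_from [set e : R | 0 < e] (fun e => [set y | P y /\ phi y < inf S + e]).
have FF : ProperFilter F.
  apply: filter_from_proper; last first.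
    move=> e /= e0; have [_ [y Py <-] h] := inf_adherent e0 Sinf.
    by exists y.
  apply: filter_from_filter; first by exists 1 => /=.
  move=> e e' /= e0 e'0; exists (Num.min e e'); first by rewrite /= lt_min e0 e'0.
  move=> y /= [Py h]; split; split => //; apply: lt_le_trans h _;
    by rewrite lerD2l ge_min lexx ?orbT.
have [U [UU FU]] := ultraFilterLemma FF.
have UP : U P by apply: FU; exists 1 => //= y [].
have [y Py hy] := delta_compact UU UP (f := id).
exists y => // x Px.
have phiy := cont U UU UP y Py hy.
apply: (@le_trans _ _ (inf S)); last first.
  by apply: ge_inf; [case: Sinf|exists x].
rewrite leNgt; apply/negP => h.
pose e := phi y - inf S; have e0 : 0 < e by rewrite subr_gt0.
have e20 : 0 < e / 2 by rewrite divr_gt0.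
have : phi y <= inf S + e / 2.
  apply: (ultra_le UU phiy (cvg_cst (inf S + e / 2))).
  by apply: FU; exists (e / 2) => //= z [_ /ltW].
by rewrite /e; lra.
Qed.

(** Positive part of [v]. *)
Let pos (v : R) := (v + `|v|) / 2.

Let pos_ge0 v : 0 <= pos v.
Proof. by rewrite divr_ge0 // -lerBlDl sub0r -normrN ler_norm. Qed.

Let pos_sq v : pos v * v = pos v ^+ 2.
Proof.
rewrite /pos; have [v0|v0] := leP 0 v; first by rewrite ger0_norm //; field.
by rewrite ltr0_norm // subrr !mul0r expr0n.
Qed.

Let le_pos v : v <= pos v.
Proof. by rewrite /pos; have := ler_norm v; lra. Qed.

Let pos_le (v f h : R) : v <= f + h -> pos v ^+ 2 <= (pos f + h) ^+ 2.
Proof.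
move=> vfh; rewrite {1}/pos; have [v0|v0] := leP 0 v; last first.
  by rewrite ltr0_norm // subrr mul0r expr0n sqr_ge0.
rewrite ger0_norm //; have -> : (v + v) / 2 = v by field.
have := le_pos f => hf.
rewrite ler_sqr ?nnegrE //; lra.
Qed.

Lemma ge0_of_perturbed (S K : R) : 0 <= K ->
  (forall t, 0 < t <= 1 -> 0 <= S + t * K) -> 0 <= S.
Proof.
move=> K0 H; rewrite leNgt; apply/negP => S0.
have KS : 0 < K - S by lra.
have := H (- S / (K - S)).
have -> : 0 < - S / (K - S) <= 1.
  by rewrite divr_gt0 ?oppr_gt0 //= ler_pdivrMr // mul1r; lra.
have -> : S + - S / (K - S) * K = - (S ^+ 2) / (K - S) by field; rewrite gt_eqF.
move=> /(_ isT); rewrite ler_pdivlMr // mul0r oppr_ge0 leNgt exprn_even_gt0 //=.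
by rewrite lt_eqF.
Qed.

Lemma sum_pair_identity n (w A x y : 'I_n -> R) :
  \sum_j \sum_i w j * (w i * (A i + A j - 2 * (x i * x j + y i * y j))) =
  2 * (\sum_i w i) * (\sum_i w i * A i)
    - 2 * ((\sum_i w i * x i) ^+ 2 + (\sum_i w i * y i) ^+ 2).
Proof.
have e j : \sum_i w j * (w i * (A i + A j - 2 * (x i * x j + y i * y j))) =
  w j * (\sum_i w i * A i) + (w j * A j) * (\sum_i w i)
  - 2 * ((w j * x j) * (\sum_i w i * x i) + (w j * y j) * (\sum_i w i * y i)).
  rewrite mulrDr opprD addrA -!mulrA !mulr_sumr -big_split -!sumrB /=.
  by apply: eq_bigr => i _; ring.
under eq_bigr do rewrite e.
rewrite sumrB big_split /= -!mulr_suml -mulr_sumr big_split /= -!mulr_suml.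
ring.
Qed.

(** The point [y] minimizes the sum of the squared positive parts of the excesses [f y i]. Moving it
    towards any [ys j] cannot lower this sum, which gives [grad]; summed over [j] with the weights
    [w] and compared with the planar points [zs], this forces the product of [\sum_i w i] and
    [\sum_i w i ^+ 2] to be at most 0, so no excess is positive. *)
Lemma kirszbraun_point n (zs : 'I_n -> euclid2 R) (ys : 'I_n -> Y) (z : euclid2 R) :
  (exists y, P y) -> (forall i, P (ys i)) ->
  (forall i j, delta (ys i) (ys j) <= edist (zs i) (zs j)) ->
  exists2 y, P y & forall i, delta y (ys i) <= edist z (zs i).
Proof.
move=> P0 Pys lip.
pose c i := esq z (zs i).
pose f y i := delta y (ys i) ^+ 2 - c i.
pose G y := \sum_i pos (f y i) ^+ 2.
have [|U UU UP y Py hy|y Py miny] := @attains_min G 0 P0.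
- by move=> y _; apply: sumr_ge0 => i _; exact: sqr_ge0.
- apply: cvg_sumr => i; apply: cvgM; rewrite /pos; apply: cvgM; try exact: cvg_cst;
    have hf : (fun y' => f y' i) @ U --> f y i
      by apply: cvgB; [apply: cvgM; exact: hy|exact: cvg_cst].
  + by apply: cvgD => //; exact: cvg_norm.
  + by apply: cvgD => //; exact: cvg_norm.
exists y => //.
pose w i := pos (f y i).
pose a i := delta y (ys i) ^+ 2.
have w0 i : 0 <= w i by exact: pos_ge0.
pose D i j := delta (ys i) (ys j) ^+ 2 - a i - a j.
(* Up to a factor 2 the sum bounds the derivative of [G] at [y] in the direction of [ys j]; [K]
   bounds the terms of second order. *)
have grad j : 0 <= \sum_i w i * D i j.
  pose W := \sum_i w i.
  pose K := 2 * a j * W + \sum_i (`|D i j| + a j) ^+ 2.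
  have a0 : 0 <= a j by exact: sqr_ge0.
  have W0 : 0 <= W by apply: sumr_ge0.
  suff : 0 <= 2 * \sum_i w i * D i j by lra.
  apply: (@ge0_of_perturbed _ K).
    apply: addr_ge0; first by apply: mulr_ge0 => //; apply: mulr_ge0.
    by apply: sumr_ge0 => i _; exact: sqr_ge0.
  move=> t /andP[t0 t1].
  have t01 : 0 <= t <= 1 by rewrite t1 ltW.
  have [m Pm hm] := delta_convex Py (Pys j) t01.
  pose h i := D i j + t * a j.
  have fm i : f m i <= f y i + t * h i.
    have := hm _ (Pys i); rewrite /f /h /D /a.
    rewrite (delta_sym Pm (Pys i)) (delta_sym (Pys i) Py); lra.
  have : \sum_i w i ^+ 2 <= \sum_i (w i + t * h i) ^+ 2.
    apply: le_trans (miny _ Pm) _; apply: ler_sum => i _; exact: pos_le.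
  have -> : \sum_i (w i + t * h i) ^+ 2 = \sum_i w i ^+ 2 + (2 * t * (\sum_i w i * D i j)
      + 2 * t ^+ 2 * a j * W + t ^+ 2 * \sum_i h i ^+ 2).
    rewrite !mulr_sumr -!big_split /=; apply: eq_bigr => i _; rewrite /h; ring.
  rewrite -subr_ge0 [X in X - _]addrC addrK => H.
  have H2 : \sum_i h i ^+ 2 <= \sum_i (`|D i j| + a j) ^+ 2.
    apply: ler_sum => i _; rewrite -[leLHS]real_normK ?num_real //.
    have K0 : 0 <= `|D i j| + a j by apply: addr_ge0.
    rewrite ler_sqr ?nnegrE //.
    apply: le_trans (ler_normD _ _) _; rewrite lerD2l (ger0_norm (mulr_ge0 (ltW t0) a0)).
    by apply: ler_piMl.
  have H3 : t ^+ 2 * \sum_i h i ^+ 2 <= t ^+ 2 * \sum_i (`|D i j| + a j) ^+ 2.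
    by apply: ler_wpM2l H2; exact: sqr_ge0.
  rewrite -(ler_pM2l t0) mulr0 /K; lra.
have S0 : 0 <= \sum_j \sum_i w j * (w i * D i j).
  by apply: sumr_ge0 => j _; rewrite -mulr_sumr mulr_ge0.
pose x i := (zs i).1 - z.1; pose x' i := (zs i).2 - z.2.
have : 0 <= \sum_j \sum_i w j * (w i * (- f y i + - f y j - 2 * (x i * x j + x' i * x' j))).
  apply: le_trans S0 _; apply: ler_sum => j _; apply: ler_sum => i _.
  rewrite !ler_wpM2l //.
  have : delta (ys i) (ys j) ^+ 2 <= esq (zs i) (zs j).
    by rewrite -edistE ler_sqr ?nnegrE ?edist_ge0 ?delta_ge0.
  by rewrite /D /f /a /c /x /x' /esq; lra.
rewrite sum_pair_identity => H.
have fw : \sum_i w i * - f y i = - \sum_i w i ^+ 2.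
  by rewrite -sumrN; apply: eq_bigr => i _; rewrite mulrN pos_sq.
rewrite fw in H.
have W3 : (\sum_i w i) * (\sum_i w i ^+ 2) <= 0.
  have := sqr_ge0 (\sum_i w i * x i); have := sqr_ge0 (\sum_i w i * x' i); lra.
move=> k; apply: edist_ge; first exact: delta_ge0.
suff wk : w k = 0.
  by have := le_pos (f y k); rewrite -/(w k) wk /f /c subr_le0.
have k1 : w k <= \sum_i w i.
  by rewrite (bigD1 k) //= lerDl sumr_ge0.
have k2 : w k ^+ 2 <= \sum_i w i ^+ 2.
  by rewrite (bigD1 k) //= lerDl sumr_ge0 // => i _; exact: sqr_ge0.
have : w k * w k ^+ 2 <= 0.
  by apply: le_trans W3; rewrite ler_pM ?sqr_ge0.
move=> h; apply/eqP; rewrite eq_le w0 andbT leNgt; apply/negP => wp.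
by move: h; rewrite leNgt mulr_gt0 // exprn_gt0.
Qed.

Variable rel : euclid2 R -> Y -> Prop.
Hypothesis P0 : exists y, P y.
Hypothesis relP : forall z y, rel z y -> P y.
Hypothesis rel_lip : forall z y z' y', rel z y -> rel z' y' -> delta y y' <= edist z z'.

Let f0 z : Y := match pselect (exists y, rel z y) with
  | left h => projT1 (cid h) | right _ => projT1 (cid P0) end.

Let f0P z : (exists y, rel z y) -> rel z (f0 z).
Proof. by rewrite /f0; case: pselect => // h _; case: (cid h). Qed.

Let good (l : seq (euclid2 R)) (f : euclid2 R -> Y) :=
  {in l, forall z, P (f z)} /\ {in l &, forall z z', delta (f z) (f z') <= edist z z'}.

Lemma kirszbraun_finite (l0 l : seq (euclid2 R)) :
  {in l0, forall z, exists y, rel z y} ->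
  exists2 f, good (l0 ++ l) f & {in l0, f =1 f0}.
Proof.
move=> hl0; elim: l => [|z l [f [f1 f2] f3]].
  exists f0 => //; rewrite cats0; split.
    by move=> z /hl0 /f0P /relP.
  by move=> z z' /hl0 /f0P h /hl0 /f0P h'; exact: rel_lip h h'.
have [zin|zN] := boolP (z \in l0 ++ l).
  have sub z' : z' \in l0 ++ z :: l -> z' \in l0 ++ l.
    by rewrite !mem_cat inE => /or3P[->|/eqP ->|->]; rewrite ?orbT // -mem_cat.
  exists f => //; split; first by move=> x /sub /f1.
  by move=> x x' /sub hx /sub; exact: f2.
pose s := l0 ++ l.
have [||y Py hy] := @kirszbraun_point (size s) (fun i => nth z s i) (fun i => f (nth z s i)) z P0.
- by move=> i; apply/f1/mem_nth.
- by move=> i j; apply: f2; exact: mem_nth.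
have hy' x : x \in s -> delta y (f x) <= edist z x.
  by move=> /(nthP z)[i ilt <-]; exact: (hy (Ordinal ilt)).
pose f' x := if x == z then y else f x.
have f'z : f' z = y by rewrite /f' eqxx.
have f's x : x \in s -> f' x = f x.
  by rewrite /f'; case: eqP => // -> zs; rewrite zs in zN.
have mem x : x \in l0 ++ z :: l -> x = z \/ x \in s.
  by rewrite /s !mem_cat inE => /or3P[->|/eqP ->|->]; rewrite ?orbT; auto.
exists f'; last first.
  by move=> x xl; rewrite f's ?f3 // mem_cat xl.
split; first by move=> x /mem[->|xs]; rewrite ?f'z ?f's //; exact: f1.
move=> x x' /mem[->|xs] /mem[->|xs']; rewrite ?f'z ?f's //.
- by rewrite delta_refl // edxx.
- exact: hy'.
- by rewrite delta_sym ?(edC x z) ?hy' //; exact: f1.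
- exact: f2.
Qed.

(** The prescribed values form a relation since a point of the plane may carry several of them, as
    when vertices of a polygon coincide; [rel_lip] puts these at distance 0. The extensions over
    finite sets of points are combined by an ultrafilter that contains, for every finite set, the
    family of its supersets. *)
Lemma kirszbraun : exists f : euclid2 R -> Y,
  [/\ forall z, P (f z),
      forall z z', delta (f z) (f z') <= edist z z' &
      forall z, (exists y, rel z y) -> rel z (f z)].
Proof.
have step (l : seq (euclid2 R)) : exists f : euclid2 R -> Y,
    good l f /\ {in l, forall z, (exists y, rel z y) -> f z = f0 z}.
  pose l0 := [seq z <- l | `[< exists y, rel z y >]].
  have [|f [f1 f2] f3] := @kirszbraun_finite l0 l.
    by move=> z; rewrite mem_filter => /andP[/asboolP].
  have sub z : z \in l -> z \in l0 ++ l by rewrite mem_cat => ->; rewrite orbT.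
  exists f; split; first split.
  - by move=> z /sub /f1.
  - by move=> z z' /sub h /sub; exact: f2.
  - by move=> z zl hz; apply: f3; rewrite mem_filter zl andbT; apply/asboolP.
have [F HF] := choice step.
pose B : set_system (seq (euclid2 R)) :=
  filter_from (setT : set (seq (euclid2 R)))
    (fun l : seq (euclid2 R) => [set l' : seq (euclid2 R) | {subset l <= l'}]).
have BF : ProperFilter B.
  apply: filter_from_proper; last by move=> l _; exists l => x.
  apply: filter_from_filter; first by exists [::].
  move=> l l' _ _; exists (l ++ l') => // l2 /= h; split=> x xl; apply: h;
    by rewrite mem_cat xl ?orbT.
have [U [UU BU]] := ultraFilterLemma BF.
have Umem (z : euclid2 R) : U [set l : seq (euclid2 R) | z \in l].
  by apply: BU; exists [:: z] => // l /=; apply; rewrite inE.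
have lim (z : euclid2 R) : exists y, P y /\ forall x, P x -> (fun l => delta (F l z) x) @ U --> delta y x.
  have [|y Py hy] := delta_compact UU (f := fun l => F l z).
    by apply: filterS (Umem z) => l zl /=; have [[h _] _] := HF l; exact: h.
  by exists y.
have [f fP] := choice lim.
(* The limit is determined only up to distance 0, so the prescribed values have to be restored. *)
pose g z := if `[< exists y, rel z y >] then f0 z else f z.
have gP z : P (g z).
  rewrite /g; case: asboolP => [/f0P /relP //|_]; by have [] := fP z.
have gl z x : P x -> (fun l => delta (F l z) x) @ U --> delta (g z) x.
  move=> Px; rewrite /g; case: asboolP => [hz|_]; last by have [_] := fP z; exact.
  move=> A Al; suff : U [set l | A (delta (F l z) x)] by [].
  apply: filterS (Umem z) => l zl.
  by have [_ h] := HF l; rewrite /= h //; exact: nbhs_singleton.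
exists g; split => //; last first.
  by move=> z hz; rewrite /g; case: asboolP => // _; exact: f0P.
move=> z z'.
have h1 := gl z (g z') (gP z').
have h2 := gl z' (g z') (gP z').
rewrite delta_refl // in h2.
have h3 : (fun l => edist z z' + delta (F l z') (g z')) @ U --> edist z z' + 0.
  by apply: cvgD h2; exact: cvg_cst.
rewrite addr0 in h3.
apply: (ultra_le UU h1 h3).
apply: filterS (filterI (Umem z) (Umem z')) => l [zl zl'] /=.
have [[p1 p2] _] := HF l.
apply: le_trans (delta_tri (p1 _ zl) (p1 _ zl') (gP z')) _.
by rewrite lerD2r p2.
Qed.

End Kirszbraun.

(** * Two half planes glued along a door *)

Section CoordinateBounds.
Variable R : realType.
Implicit Types x y : euclid2 R.

Lemma edist_le_abs x y : edist x y <= `|x.1 - y.1| + `|x.2 - y.2|.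
Proof.
apply: edist_le; first by rewrite addr_ge0.
have h1 : `|x.1 - y.1| ^+ 2 = (x.1 - y.1) ^+ 2 by rewrite real_normK ?num_real.
have h2 : `|x.2 - y.2| ^+ 2 = (x.2 - y.2) ^+ 2 by rewrite real_normK ?num_real.
rewrite sqrrD h1 h2 /esq; have := mulr_ge0 (normr_ge0 (x.1 - y.1)) (normr_ge0 (x.2 - y.2)).
lra.
Qed.

Lemma abs_le_edist x y : `|x.1 - y.1| <= edist x y /\ `|x.2 - y.2| <= edist x y.
Proof.
split; apply: edist_ge => //; rewrite real_normK ?num_real // /esq.
  by rewrite lerDl sqr_ge0.
by rewrite lerDr sqr_ge0.
Qed.

End CoordinateBounds.

Lemma cvg_dist_le (R : realType) (I : Type) (U : set_system I) (u v : I -> R) (l : R) :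
  Filter U -> U [set i | `|u i - l| <= v i] -> v @ U --> 0 -> u @ U --> l.
Proof.
move=> UU Uuv v0; apply/cvgrPdist_le => e e0.
move/cvgrPdist_le: v0 => /(_ e e0) h.
apply: filterS (filterI Uuv h) => i [/= h1]; rewrite sub0r normrN => h2.
by rewrite distrC (le_trans h1) // (le_trans (ler_norm _)).
Qed.

Lemma cvg_edist (R : realType) (I : Type) (U : set_system I) (z : I -> euclid2 R) (a : euclid2 R) :
  Filter U -> (fun i => (z i).1) @ U --> a.1 -> (fun i => (z i).2) @ U --> a.2 ->
  (fun i => edist (z i) a) @ U --> 0.
Proof.
move=> UU h1 h2.
apply: (@cvg_dist_le _ _ _ _ (fun i => `|(z i).1 - a.1| + `|(z i).2 - a.2|)).
  apply: filterE => i /=; rewrite subr0 ger0_norm ?edist_ge0 //; exact: edist_le_abs.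
have hn (f : I -> R) (c : R) : f @ U --> c -> (fun i => `|f i - c|) @ U --> 0.
  move=> fc; have : (fun i => `|f i - c|) @ U --> `|c - c|.
    by apply: cvg_norm; apply: cvgB => //; exact: cvg_cst.
  by rewrite subrr normr0.
rewrite -[X in _ --> X](addr0 0); apply: cvgD; exact: hn.
Qed.

Section Glue.
Variables (R : realType) (l r1 r2 : R).
Hypotheses (l0 : 0 <= l) (r10 : 0 <= r1) (r20 : 0 <= r2).
Implicit Types (x y w : euclid2 R) (t s : R) (b : bool).

Let e1 : euclid2 R := (l, 0).

(* The two half planes, cut down to neighbourhoods of the door [0, e1] (by [r1]
   above and [r2] below) and glued along the door only. *)
Definition half b (z : euclid2 R) :=
  (if b then 0 <= l * z.2 else l * z.2 <= 0) /\
  exists2 w, seg 0 e1 w & edist z w <= if b then r1 else r2.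

Definition glue (p : bool * euclid2 R) := half p.1 p.2.

Definition glue_dist (p q : bool * euclid2 R) : R :=
  if p.1 == q.1 then edist p.2 q.2 else rho 0 e1 p.2 q.2.

Lemma door_y w : seg 0 e1 w -> w.2 = 0.
Proof. by move=> [t _ ->]; rewrite /lerp /= !mulr0 addr0. Qed.

Lemma door_half b w : seg 0 e1 w -> half b w.
Proof.
move=> we; split; first by rewrite (door_y we) mulr0; case: b.
by exists w => //; rewrite edxx; case: b.
Qed.

Lemma half_lerp b x y t : half b x -> half b y -> 0 <= t <= 1 -> half b (lerp t x y).
Proof.
move=> [hx [w we dx]] [hy [w' we' dy]] t01; have /andP[t0 t1] := t01.
split.
  have -> : l * (lerp t x y).2 = (1 - t) * (l * x.2) + t * (l * y.2).
    by rewrite /lerp /=; ring.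
  case: b hx hy {dx dy} => hx hy.
    by rewrite addr_ge0 // mulr_ge0 // subr_ge0.
  have a1 : (1 - t) * (l * x.2) <= 0 by rewrite mulr_ge0_le0 ?subr_ge0.
  have a2 : t * (l * y.2) <= 0 by rewrite mulr_ge0_le0.
  lra.
exists (lerp t w w'); first exact: seg_sub we we' (seg_lerp _ _ t01).
apply: le_trans (edist_lerp_le _ _ _ _ t01) _.
set r := if b then r1 else r2 in dx dy *.
apply: (@le_trans _ _ ((1 - t) * r + t * r)); last by lra.
by rewrite lerD // ler_wpM2l // subr_ge0.
Qed.

Lemma half_opposite b x y : half b x -> half (~~ b) y -> opposite l x y.
Proof. by move=> [hx _] [hy _]; case: b hx hy => hx hy; [right|left]. Qed.

Lemma glue_dist_ge0 p q : 0 <= glue_dist p q.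
Proof. by rewrite /glue_dist; case: ifP => _; rewrite ?edist_ge0 ?rho_ge0. Qed.

Lemma glue_dist_refl p : glue_dist p p = 0.
Proof. by rewrite /glue_dist eqxx edxx. Qed.

Lemma glue_dist_sym p q : glue_dist p q = glue_dist q p.
Proof. by rewrite /glue_dist eq_sym; case: ifP => _; [exact: edC|exact: rhoC]. Qed.

Lemma glue_dist_tri p q p' : glue_dist p p' <= glue_dist p q + glue_dist q p'.
Proof.
have h1 x y (z : euclid2 R) : rho 0 e1 x z <= edist x y + rho 0 e1 y z.
  by rewrite addrC (edC x y) (rhoC 0 e1 x z) (rhoC 0 e1 y z); exact: rho_tri.
have h2 x y (z : euclid2 R) : edist x z <= rho 0 e1 x y + rho 0 e1 y z.
  by rewrite (rhoC 0 e1 x y); exact: rho_tri2.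
by case: p q p' => [[] x] [[] y] [[] z]; rewrite /glue_dist /=;
  [exact: edtri|exact: h1|exact: h2|exact: rho_tri|exact: rho_tri|exact: h2|exact: h1|exact: edtri].
Qed.

Lemma glue_dist_door b z w : seg 0 e1 w -> glue_dist z (b, w) = edist z.2 w.
Proof.
move=> we; rewrite /glue_dist; case: ifP => // _.
by apply: (rho_seg we); exact: segr.
Qed.

Lemma glue_convex_half b x y t z : half b x -> half b y -> 0 <= t <= 1 -> glue z ->
  glue_dist z (b, lerp t x y) ^+ 2 <= (1 - t) * glue_dist z (b, x) ^+ 2
    + t * glue_dist z (b, y) ^+ 2 - t * (1 - t) * esq x y.
Proof.
move=> hx hy t01; case: z => b' z /= hz; rewrite /glue_dist /=.
have [bb|bb] := eqVneq b' b.
  by rewrite !edistE esq_lerp.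
apply: rho_convex => //.
have bE : ~~ b' = b by case: b' b bb {hx hy hz} => [] [].
apply: half_opposite hz _; rewrite bE; exact: half_lerp.
Qed.

(* If [w] lies on a shortest path from [x] to [y], then a short step from [w]
   towards [z] cannot shorten the way from [x] to [y]; to first order this is the
   comparison inequality at [w] for the triangle [z x y]. *)
Lemma glue_inherit b x y z w : half b x -> half (~~ b) y -> half b z -> seg 0 e1 w ->
  rho 0 e1 x y = edist x w + edist w y ->
  edist z w ^+ 2 * (edist x w + edist w y) <=
  edist w y * edist z x ^+ 2 + edist x w * rho 0 e1 z y ^+ 2
    - edist x w * edist w y * (edist x w + edist w y).
Proof.
move=> hx hy hz we hr.
have yw : rho 0 e1 y w = edist w y by rewrite rhoC (rho_seg we (segl _ _)).
have zwr : rho 0 e1 z w = edist z w by rewrite (rho_seg we (segr _ _)).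
have [A0|AN] := eqVneq (edist x w) 0.
  by rewrite (ed0_eq A0) edxx !add0r !mul0r addr0 subr0 mulrC.
have [B0|BN] := eqVneq (edist w y) 0.
  by rewrite -(ed0_eq B0) edxx zwr !addr0 mul0r add0r mulr0 !mul0r subr0 mulrC.
set A := edist x w in hr AN *; set B := edist w y in hr yw BN *.
have Ap : 0 < A by rewrite lt_def AN edist_ge0.
have Bp : 0 < B by rewrite lt_def BN edist_ge0.
pose h := edist z w ^+ 2; rewrite -/h.
set Y := rho 0 e1 z y ^+ 2; set X := edist z x ^+ 2.
suff : 0 <= B * X + A * Y - A * B * (A + B) - h * (A + B) by lra.
apply: (@ge0_of_perturbed _ _ (h * (A + B))).
  by rewrite mulr_ge0 ?sqr_ge0 // addr_ge0 // ltW.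
move=> e /andP[ep e1'].
have e01 : 0 <= e <= 1 by rewrite e1' ltW.
pose m := lerp e w z.
have hm : half b m by apply: half_lerp => //; exact: door_half.
have h1 : edist x m ^+ 2 = (1 - e) * A ^+ 2 + e * X - e * (1 - e) * h.
  by rewrite edistE esq_lerp -!edistE (edC w z) (edC x z).
have h2 : rho 0 e1 y m ^+ 2 <= (1 - e) * B ^+ 2 + e * Y - e * (1 - e) * h.
  have := @rho_convex R l y w z e l0 e01.
  rewrite -[lerp e w z]/m -/e1 yw [rho _ _ y z]rhoC -edistE (edC w z) -/h -/Y; apply.
  by case: b hm hy {hx hz} => [[? _] [? _]|[? _] [? _]]; [left|right].
have h3 : A + B <= edist x m + rho 0 e1 y m.
  by rewrite -hr [rho _ _ x y]rhoC addrC (edC x m) rho_tri.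
set a := edist x m in h1 h3; set c := rho 0 e1 y m in h2 h3.
have h4 : A * B * (A + B) <= B * a ^+ 2 + A * c ^+ 2.
  have AB : 0 < A + B by lra.
  have c1 : A * B * (A + B) ^+ 2 <= A * B * (a + c) ^+ 2.
    by rewrite ler_wpM2l ?mulr_ge0 ?(ltW Ap) ?(ltW Bp) // ler_sqr ?nnegrE; lra.
  have c2 : A * B * (a + c) ^+ 2 <= (A + B) * (B * a ^+ 2 + A * c ^+ 2).
    have := sqr_ge0 (B * a - A * c); lra.
  rewrite -(ler_pM2l AB); lra.
rewrite -(ler_pM2l ep) mulr0.
have h5 := ler_wpM2l (ltW Ap) h2.
rewrite h1 in h4; lra.
Qed.

(** The bound on [t] says that the point at [t] on the path from [x] over [w] to [y] lies on the
    first leg. There [glue_convex_half] compares it with [x] and [w], and [glue_inherit] trades [w]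
    for [x] and [y]. *)
Lemma glue_convex_cross b x y w t : half b x -> half (~~ b) y -> seg 0 e1 w ->
  rho 0 e1 x y = edist x w + edist w y -> 0 <= t <= 1 -> 0 < edist x w ->
  t * (edist x w + edist w y) <= edist x w ->
  exists2 m, glue m & forall z, glue z ->
  glue_dist z m ^+ 2 <= (1 - t) * glue_dist z (b, x) ^+ 2 + t * glue_dist z (~~ b, y) ^+ 2
                    - t * (1 - t) * glue_dist (b, x) (~~ b, y) ^+ 2.
Proof.
move=> hx hy we hr /andP[t0 t1] Ap tS.
have hw : half b w by exact: door_half.
set A := edist x w in hr Ap tS *; set B := edist w y in hr tS *.
have B0 : 0 <= B by exact: edist_ge0.
have Sp : 0 < A + B by lra.
pose s := t * (A + B) / A.
have s01 : 0 <= s <= 1.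
  by rewrite divr_ge0 ?mulr_ge0 ?(ltW Ap) ?(ltW Sp) //= ler_pdivrMr // mul1r.
have dxy : glue_dist (b, x) (~~ b, y) = A + B.
  by rewrite /glue_dist /=; case: (b); rewrite /= hr.
exists (b, lerp s x w); first exact: half_lerp.
move=> z gz; rewrite dxy.
apply: le_trans (glue_convex_half hx hw s01 gz) _.
set X := glue_dist z (b, x) ^+ 2; set Y := glue_dist z (~~ b, y) ^+ 2.
have H : glue_dist z (b, w) ^+ 2 * (A + B) <= B * X + A * Y - A * B * (A + B).
  rewrite glue_dist_door // /X /Y; case: z gz {X Y} => b' z /= hz.
  have [bb|bb] := eqVneq b' b.
    subst b'; rewrite /glue_dist /= eqxx; have -> : (b == ~~ b) = false by case: (b).
    exact: glue_inherit hx hy hz we hr.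
  have b'E : b' = ~~ b by case: b' b bb {hx hy hz dxy hw} => [] [].
  subst b'; rewrite /glue_dist /= eqxx; have -> : (~~ b == b) = false by case: (b).
  have hx' : half (~~ ~~ b) x by rewrite negbK.
  have hr' : rho 0 e1 y x = edist y w + edist w x.
    by rewrite rhoC hr addrC (edC y w) (edC w x).
  have := glue_inherit hy hx' hz we hr'.
  by rewrite (edC y w) (edC w x) -/A -/B; lra.
have sA : s * A = t * (A + B) by rewrite /s; field; rewrite gt_eqF.
have sq : esq x w = A ^+ 2 by rewrite -edistE.
rewrite sq -(ler_pM2r Sp).
have s0 : 0 <= s by case/andP: s01.
have H' := ler_wpM2l s0 H.
have e1' : s * (1 - s) * A ^+ 2 = t * (A + B) * (A - t * (A + B)).
  by rewrite -sA; ring.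
have e2 : s * (B * X + A * Y - A * B * (A + B)) =
   s * (A + B) * X + t * (A + B) * (Y - X) - t * (A + B) * B * (A + B).
  by rewrite -sA; ring.
have -> : ((1 - s) * X + s * glue_dist z (b, w) ^+ 2 - s * (1 - s) * A ^+ 2) * (A + B) =
  (1 - s) * X * (A + B) + s * (glue_dist z (b, w) ^+ 2 * (A + B)) - t * (A + B) * (A - t * (A + B)) * (A + B).
  by rewrite -e1'; ring.
rewrite e2 in H'; lra.
Qed.

Lemma glue_convex p q : glue p -> glue q -> forall t, 0 <= t <= 1 ->
  exists2 m, glue m & forall z, glue z ->
  glue_dist z m ^+ 2 <= (1 - t) * glue_dist z p ^+ 2 + t * glue_dist z q ^+ 2
                    - t * (1 - t) * glue_dist p q ^+ 2.
Proof.
case: p q => b x [b' y] /= hx hy t t01; have /andP[t0 t1] := t01.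
have [bb|bb] := eqVneq b b'.
  subst b'; exists (b, lerp t x y); first exact: half_lerp.
  move=> z gz; rewrite [glue_dist (b, x) _]/glue_dist eqxx edistE.
  exact: glue_convex_half.
have b'E : b' = ~~ b by case: b' b bb {hx hy} => [] [].
subst b'.
have [w we hr] := rhoP 0 e1 x y.
have dxy : glue_dist (b, x) (~~ b, y) = edist x w + edist w y.
  by rewrite /glue_dist /=; case: (b); rewrite /= hr.
have A0 := edist_ge0 x w; have B0 := edist_ge0 w y.
have [S0|SN] := eqVneq (edist x w + edist w y) 0.
  exists (b, x) => // z gz; rewrite dxy S0 expr0n /= mulr0 subr0.
  suff -> : glue_dist z (~~ b, y) = glue_dist z (b, x) by lra.
  apply/eqP; rewrite eq_le.
  have h1 := glue_dist_tri z (b, x) (~~ b, y).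
  have h2 := glue_dist_tri z (~~ b, y) (b, x).
  rewrite [glue_dist (~~ b, y) _]glue_dist_sym dxy S0 addr0 in h2.
  by rewrite dxy S0 addr0 in h1; rewrite h1 h2.
have [c1|c1] := boolP ((0 < edist x w) && (t * (edist x w + edist w y) <= edist x w)).
  by case/andP: c1 => c1 c2; exact: glue_convex_cross we hr t01 c1 c2.
have Bp : 0 < edist w y.
  move: c1; rewrite negb_and -leNgt -ltNge => /orP[h|h].
    rewrite lt_neqAle B0 andbT eq_sym; apply: contra SN => /eqP e; rewrite e addr0.
    by rewrite eq_le h A0.
  have : t * (edist x w + edist w y) <= 1 * (edist x w + edist w y).
    by rewrite ler_wpM2r // addr_ge0.
  lra.
(* The point at [t] lies on the second leg, so the two ends are exchanged. *)
have t01' : 0 <= 1 - t <= 1 by lra.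
have hx' : half (~~ ~~ b) x by rewrite negbK.
have hr' : rho 0 e1 y x = edist y w + edist w x.
  by rewrite rhoC hr addrC (edC x w) (edC w y).
have Bp' : 0 < edist y w by rewrite edC.
have c3 : (1 - t) * (edist y w + edist w x) <= edist y w.
  rewrite (edC y w) (edC w x); move: c1; rewrite negb_and -leNgt -ltNge => /orP[h|h]; last lra.
  have -> : edist x w = 0 by apply/eqP; rewrite eq_le h A0.
  by rewrite addr0 ler_piMl //; lra.
have [m gm hm] := glue_convex_cross hy hx' we hr' t01' Bp' c3.
exists m => // z gz; have := hm z gz; rewrite negbK [glue_dist (~~ b, y) (b, x)]glue_dist_sym.
by lra.
Qed.

Lemma glue_compact (I : Type) (U : set_system I) : UltraFilter U ->
  forall f : I -> bool * euclid2 R, U [set i | glue (f i)] ->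
  exists2 p, glue p & forall q, glue q -> (fun i => glue_dist (f i) q) @ U --> glue_dist p q.
Proof.
move=> UU f Uf.
have [b Ub] : exists b, U [set i | (f i).1 = b].
  have [h|h] := in_ultra_setVsetC [set i | (f i).1 = true] UU; first by exists true.
  exists false; apply: filterS h => i /=; by case: (f i).1.
pose r := if b then r1 else r2.
have r0 : 0 <= r by rewrite /r; case: (b).
have Uh : U [set i | half b (f i).2].
  by apply: filterS (filterI Ub Uf) => i [/= <-].
(* [T i] is the parameter of a door point within [r] of [f i]. It bounds the coordinates of [f i],
   and its limit witnesses that the limit point is still within [r] of the door. *)
have hT i : exists T : R, half b (f i).2 ->
    0 <= T <= 1 /\ edist (f i).2 (lerp T 0 e1) <= r.
  have [[h [w [t t01 ->] d]]|] := pselect (half b (f i).2); first by exists t.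
  by exists 0.
have [T HT] := choice hT.
have [T0 HT0] : exists T0 : R, T @ U --> T0.
  by apply: (@ultra_cvg_bounded _ _ _ _ 0 1); apply: filterS Uh => i /HT[].
have [X HX] : exists X : R, (fun i => (f i).2.1) @ U --> X.
  apply: (@ultra_cvg_bounded _ _ _ _ (- r) (l + r)); apply: filterS Uh => i /HT[/andP[t0 t1] d] /=.
  have [h _] := abs_le_edist (f i).2 (lerp (T i) 0 e1).
  have := le_trans h d; rewrite [(lerp _ _ _).1]/= mulr0 add0r ler_norml => /andP[h1 h2].
  have h3 : 0 <= T i * l by rewrite mulr_ge0.
  have h4 : T i * l <= l by rewrite ler_piMl.
  by apply/andP; split; lra.
have [Z HZ] : exists Z : R, (fun i => (f i).2.2) @ U --> Z.
  apply: (@ultra_cvg_bounded _ _ _ _ (- r) r); apply: filterS Uh => i /HT[_ d] /=.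
  have [_ h] := abs_le_edist (f i).2 (lerp (T i) 0 e1).
  by have := le_trans h d; rewrite [(lerp _ _ _).2]/= !mulr0 addr0 subr0 ler_norml.
have hd : (fun i => edist (f i).2 (X, Z)) @ U --> 0 by exact: cvg_edist.
exists (b, (X, Z)).
  split.
    have lZ : (fun i => l * (f i).2.2) @ U --> l * Z by apply: cvgM => //; exact: cvg_cst.
    rewrite /=; case: (b) Uh => Uh.
      by apply: (ultra_le UU (cvg_cst 0) lZ); apply: filterS Uh => i [].
    by apply: (ultra_le UU lZ (cvg_cst 0)); apply: filterS Uh => i [].
  exists (lerp T0 0 e1).
    exists T0 => //; apply/andP; split.
      by apply: (ultra_le UU (cvg_cst 0) HT0); apply: filterS Uh => i /HT[/andP[]].
    by apply: (ultra_le UU HT0 (cvg_cst (1 : R))); apply: filterS Uh => i /HT[/andP[]].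
  rewrite -/r /=.
  have hT' : (fun i => edist (lerp (T i) 0 e1) (lerp T0 0 e1)) @ U --> 0.
    apply: cvg_edist => //; rewrite /lerp /=.
      under eq_fun do rewrite mulr0 add0r.
      by rewrite mulr0 add0r; apply: cvgM => //; exact: cvg_cst.
    under eq_fun do rewrite !mulr0 addr0.
    by rewrite !mulr0 addr0; exact: cvg_cst.
  have hs : (fun i => edist (f i).2 (X, Z) + (r + edist (lerp (T i) 0 e1) (lerp T0 0 e1))) @ U
      --> 0 + (r + 0).
    by apply: cvgD => //; apply: cvgD => //; exact: cvg_cst.
  rewrite addr0 add0r in hs.
  apply: (ultra_le UU (cvg_cst (edist (X, Z) (lerp T0 0 e1))) hs).
  apply: filterS Uh => i /HT[_ d] /=.
  apply: le_trans (edtri (f i).2 _ _) _; rewrite (edC (X, Z)) lerD2l.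
  by apply: le_trans (edtri (lerp (T i) 0 e1) _ _) _; rewrite lerD2r.
move=> q gq; apply: cvg_dist_le hd; apply: filterS Ub => i /= fb.
have e : glue_dist (f i) (b, (X, Z)) = edist (f i).2 (X, Z).
  by rewrite /glue_dist fb eqxx.
have h1 := glue_dist_tri (f i) (b, (X, Z)) q.
have h2 := glue_dist_tri (b, (X, Z)) (f i) q.
rewrite [glue_dist _ (f i)]glue_dist_sym in h2; rewrite e in h1 h2.
by rewrite ler_norml; apply/andP; split; lra.
Qed.

Lemma glue_kirszbraun (rel : euclid2 R -> bool * euclid2 R -> Prop) :
  (forall z p, rel z p -> glue p) ->
  (forall z p z' p', rel z p -> rel z' p' -> glue_dist p p' <= edist z z') ->
  exists f : euclid2 R -> bool * euclid2 R,
  [/\ forall z, glue (f z),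
      forall z z', glue_dist (f z) (f z') <= edist z z' &
      forall z, (exists p, rel z p) -> rel z (f z)].
Proof.
move=> relP rel_lip.
apply: (@kirszbraun R _ glue_dist glue) => //.
- by move=> *; exact: glue_dist_ge0.
- by move=> *; exact: glue_dist_refl.
- by move=> *; exact: glue_dist_sym.
- by move=> *; exact: glue_dist_tri.
- exact: glue_convex.
- exact: glue_compact.
- by exists (true, 0); apply: door_half; exact: segl.
Qed.

End Glue.

(** * Geodesics in CAT(0) spaces *)

Section CAT0Geometry.
Variables (R : realType) (X : metricType R).
Hypotheses (geoX : geodesic_space X) (catX : CAT0 X).
Implicit Types (x y z p q m : X) (s t u v : R).

Lemma geo_exists x y : exists c : R -> X,
  [/\ c 0 = x, c 1 = y & forall u v, 0 <= u <= 1 -> 0 <= v <= 1 ->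
    mdist (c u) (c v) = `|u - v| * mdist x y].
Proof.
have [g [a [b [[ab gP] ga gb]]]] := geoX x y.
have dxy : mdist x y = b - a.
  by rewrite -ga -gb gP ?in_itv /= ?lexx ?ab // distrC ger0_norm // subr_ge0.
exists (fun u => g (a + u * (b - a))); split.
- by rewrite mul0r addr0.
- by rewrite mul1r addrC subrK.
move=> u v u01 v01.
have h w : 0 <= w <= 1 -> a + w * (b - a) \in `[a, b].
  move=> /andP[w0 w1]; have ab' : 0 <= b - a by rewrite subr_ge0.
  have h1 : 0 <= w * (b - a) by rewrite mulr_ge0.
  have h2 : w * (b - a) <= b - a by rewrite ler_piMl.
  by rewrite in_itv /=; apply/andP; split; lra.
rewrite gP ?h // dxy.
have -> : a + u * (b - a) - (a + v * (b - a)) = (u - v) * (b - a) by ring.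
by rewrite normrM [X in _ * X]ger0_norm // subr_ge0.
Qed.

Definition geo x y : R -> X := projT1 (cid (geo_exists x y)).

Lemma geo0 x y : geo x y 0 = x.
Proof. by rewrite /geo; case: (cid _) => c []. Qed.

Lemma geo1 x y : geo x y 1 = y.
Proof. by rewrite /geo; case: (cid _) => c []. Qed.

Lemma mdist_geo x y u v : 0 <= u <= 1 -> 0 <= v <= 1 ->
  mdist (geo x y u) (geo x y v) = `|u - v| * mdist x y.
Proof. by rewrite /geo; case: (cid _) => c /= [_ _ h]; exact: h. Qed.

Lemma mdist_geol x y u : 0 <= u <= 1 -> mdist x (geo x y u) = u * mdist x y.
Proof.
move=> u01; have /andP[u0 u1] := u01.
have h0 : 0 <= (0 : R) <= 1 by rewrite ler01 lexx.
have := mdist_geo x y h0 u01; rewrite geo0 => ->.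
by rewrite sub0r normrN ger0_norm.
Qed.

Lemma mdist_geor x y u : 0 <= u <= 1 -> mdist (geo x y u) y = (1 - u) * mdist x y.
Proof.
move=> u01; have /andP[u0 u1] := u01.
have h1 : 0 <= (1 : R) <= 1 by rewrite ler01 lexx.
have := mdist_geo x y u01 h1; rewrite geo1 => ->.
by rewrite distrC ger0_norm // subr_ge0.
Qed.

Lemma mdistE2 (a b : euclid2 R) : mdist a b = edist a b.
Proof. by []. Qed.

(** The CAT(0) inequality for [z] and the point [geo x y u] itself: the comparison triangle of the
    latter is degenerate, so its comparison point may serve as the point of the common side, and
    Stewart's theorem computes the distance. *)
Lemma geo_convex z x y u : 0 <= u <= 1 ->
  mdist z (geo x y u) ^+ 2 <=
  (1 - u) * mdist z x ^+ 2 + u * mdist z y ^+ 2 - u * (1 - u) * mdist x y ^+ 2.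
Proof.
move=> u01; have /andP[u0 u1] := u01.
have [||||||q [_ q0 q1]] := @planar_triangle R (mdist x z) (mdist y z) (mdist x y);
  rewrite ?mdist_ge0 //.
- by rewrite addrC metric_triangle.
- by rewrite addrC (metric_sym x y) metric_triangle.
- by rewrite (metric_sym y z) metric_triangle.
pose e1 : euclid2 R := (mdist x y, 0); pose w := lerp u 0 e1.
have e01 : edist 0 e1 = mdist x y.
  by apply: edist_eqP; rewrite ?mdist_ge0 // /esq /=; ring.
have := catX (p := z) (q := geo x y u) (x := x) (y := y) (p' := q) (q' := w) (x' := 0) (y' := e1).
rewrite !mdistE2 (edC q 0) (edC q e1) q0 q1 (metric_sym x z) (metric_sym y z).
rewrite (edC w 0) edist_lerpl // edist_lerpr // e01.
rewrite mdist_geor // (metric_sym (geo x y u) x) mdist_geol // => /(_ erefl erefl erefl erefl erefl w) H.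
have {}H : mdist z (geo x y u) <= edist q w.
  have := H; rewrite !mdistE2 edxx addr0; apply.
  exists u => //; rewrite /w /lerp /=; congr pair.
have : mdist z (geo x y u) ^+ 2 <= edist q w ^+ 2.
  by rewrite ler_sqr ?nnegrE ?mdist_ge0 ?edist_ge0.
by rewrite edistE esq_lerp -!edistE (edC q 0) (edC q e1) q0 q1 e01 (metric_sym z x) (metric_sym z y).
Qed.

Lemma mdist_quad4 p q x y : quad4 (@mdist R X) p q x y.
Proof.
apply: quad4_mid => t t01; exists (mdist p (geo x y t)), (mdist (geo x y t) q); split.
- by rewrite mdist_ge0 metric_triangle.
- exact: geo_convex.
- by rewrite metric_sym; exact: geo_convex.
Qed.

(** The law of cosines with [<=]: in the plane [esq_lerp2] gives equality. *)
Lemma geo_cone p x y u v : 0 <= u <= 1 -> 0 <= v <= 1 ->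
  mdist (geo p x u) (geo p y v) ^+ 2 <=
  u * (u - v) * mdist p x ^+ 2 + v * (v - u) * mdist p y ^+ 2 + u * v * mdist x y ^+ 2.
Proof.
move=> u01 v01; have /andP[u0 u1] := u01; have /andP[v0 v1] := v01.
have h1 := geo_convex (geo p y v) p x u01.
have h2 := geo_convex x p y v01.
rewrite (metric_sym _ p) (mdist_geol _ _ v01) in h1.
rewrite metric_sym; rewrite (metric_sym _ x) in h1; rewrite (metric_sym x p) in h2.
have h3 := ler_wpM2l u0 h2.
lra.
Qed.

Lemma geo_unique x y m u : 0 <= u <= 1 ->
  mdist x m = u * mdist x y -> mdist m y = (1 - u) * mdist x y -> m = geo x y u.
Proof.
move=> u01 h1 h2; apply: mdist_positivity.
apply/eqP; rewrite -sqrf_eq0 eq_le sqr_ge0 andbT.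
apply: le_trans (geo_convex m x y u01) _.
rewrite (metric_sym m x) h1 h2; lra.
Qed.

Lemma mdist_le_lerp p x y (x' y' : euclid2 R) u v : 0 <= u <= 1 -> 0 <= v <= 1 ->
  edist 0 x' = mdist p x -> edist 0 y' = mdist p y -> edist x' y' = mdist x y ->
  mdist (geo p x u) (geo p y v) <= edist (lerp u 0 x') (lerp v 0 y').
Proof.
move=> u01 v01 e1 e2 e3; apply: edist_ge; first exact: mdist_ge0.
apply: le_trans (geo_cone _ _ _ u01 v01) _.
by rewrite esq_lerp2 -!edistE e1 e2 e3.
Qed.

End CAT0Geometry.

(** * Fans of geodesics *)

Section Fan.
Variables (R : realType) (X : metricType R).
Hypotheses (geoX : geodesic_space X) (catX : CAT0 X).
Variables (p : nat -> X) (eps : R).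
Hypotheses (eps0 : 0 <= eps) (p_eps : forall i, mdist (p i) (p i.+1) <= eps).
Implicit Types (z w : euclid2 R) (s t u : R) (i j k m n : nat).

Let d i j := mdist (p i) (p j).
Let ray i u := geo geoX (p 0%N) (p i) u.

Lemma cycmet_mdist n : cycmet n d.
Proof.
split=> *; rewrite /d.
- exact: mdist_ge0.
- exact: mdistxx.
- exact: metric_sym.
- exact: metric_triangle.
- move=> s t s01 t01; exact: (mdist_quad4 geoX catX).
Qed.

(* [Phi] maps the plane to the fan of geodesics from [p 0] to [p 0], ..., [p k]
   and is 1-Lipschitz up to the error [err], which vanishes on the vertices of
   the polygon and on its closing side: an additive error per pair of points,
   rather than per step, is what keeps the errors from accumulating with [k]. *)
Record fan_stage k (g : nat -> euclid2 R) (Phi : euclid2 R -> X) (err : euclid2 R -> R) : Prop :=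
  FanStage {
  fs_above : polygon_above k d g;
  fs_pos : in_position k d g;
  fs_err : forall z, 0 <= err z <= eps;
  fs_lip : forall z z', mdist (Phi z) (Phi z') <= edist z z' + (err z + err z');
  fs_vertex : forall i, (i <= k)%N -> Phi (g i) = p i /\ err (g i) = 0;
  fs_side : forall t, 0 <= t <= 1 ->
    Phi (lerp t 0 (g k)) = ray k t /\ err (lerp t 0 (g k)) = 0;
  fs_ray : forall z, exists i u, [/\ (i <= k)%N, 0 <= u <= 1 & Phi z = ray i u];
  fs_cross_side : forall i j t, (i < j)%N -> (j <= k)%N -> 0 <= t <= 1 ->
    exists2 u, 0 <= u <= 1 &
    mdist (p i) (ray j u) + mdist (ray j u) (ray k t) <= edist (lerp t 0 (g k)) (g i);
  fs_cross : forall i j m, (i < j)%N -> (j < m)%N -> (m <= k)%N ->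
    exists2 u, 0 <= u <= 1 &
    mdist (p i) (ray j u) + mdist (ray j u) (p m) <= edist (g i) (g m) }.

Section Step.
Variables (k : nat) (g : nat -> euclid2 R) (Phi : euclid2 R -> X) (err : euclid2 R -> R).
Hypothesis FS : fan_stage k g Phi err.
Let l := d 0 k.
Let e1 : euclid2 R := (l, 0).
Variable q : euclid2 R.
Hypotheses (q2 : q.2 <= 0) (q0 : edist 0 q = d 0 k.+1) (q1 : edist e1 q = d k k.+1).
Variable g' : nat -> euclid2 R.
Hypotheses (g'P : polygon_above k.+1 (attach k g l q) g')
  (g'N : in_position k.+1 (attach k g l q) g').

Let gk : g k = e1. Proof. exact: ip_n (fs_pos FS). Qed.
Let g0 : g 0%N = 0. Proof. exact: ip_0 (fs_pos FS). Qed.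
Let l0 : 0 <= l. Proof. exact: mdist_ge0. Qed.

Let close' : attach k g l q 0%N k.+1 = d 0 k.+1.
Proof. exact: attach_close (fs_pos FS) q0. Qed.

Lemma fan_above' : polygon_above k.+1 d g'.
Proof.
apply: polygon_above_le g'P.
- exact: attach_edge (fs_above FS) (fs_pos FS) q1.
- exact: close'.
- exact: attach_dom (cycmet_mdist k.+1) (fs_above FS) (fs_pos FS) q2 q0 q1.
Qed.

Lemma fan_pos' : in_position k.+1 d g'.
Proof. by case: g'N => h1 h2 h3; split; rewrite -?close'. Qed.

(** Large enough for the upper [half] to contain all vertices; below the door the radius [eps]
    suffices for [q]. *)
Let r1 := \sum_(i < k.+1) edist (g i) 0.
Let r10 : 0 <= r1. Proof. by apply: sumr_ge0 => i _; exact: edist_ge0. Qed.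

Local Notation halfP := (half l r1 eps).
Local Notation gdist := (glue_dist l).

Lemma vertex_half i : (i <= k)%N -> halfP true (g i).
Proof.
move=> ik; split; first exact: (ip_side (fs_pos FS) ik).
exists 0; first exact: segl.
have ik' : (i < k.+1)%N by [].
rewrite /r1 (bigD1 (Ordinal ik')) //= lerDl sumr_ge0 // => j _; exact: edist_ge0.
Qed.

Lemma q_half : halfP false q.
Proof.
split; first by rewrite mulr_ge0_le0.
by exists e1; [exact: segr|rewrite edC q1 p_eps].
Qed.

Lemma ray_half t : 0 <= t <= 1 -> halfP false (lerp t 0 q).
Proof.
move=> t01; apply: half_lerp => //; last exact: q_half.
by apply: door_half => //; exact: segl.
Qed.

(** Only the two sides of the comparison triangle that start at 0 correspond to geodesics of the
    fan. *)
Definition on_triangle z (x : X) :=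
  (exists t, [/\ 0 <= t <= 1, z = lerp t 0 q & x = ray k.+1 t]) \/
  (exists t, [/\ 0 <= t <= 1, z = lerp t 0 e1 & x = ray k t]).

Let e1_dist : edist 0 e1 = l.
Proof. by apply: edist_eqP; rewrite // /esq /=; ring. Qed.

Lemma on_triangle_lip z x z' x' : on_triangle z x -> on_triangle z' x' ->
  mdist x x' <= edist z z'.
Proof.
move=> [|] [t [t01 -> ->]] [|] [s [s01 -> ->]].
- by rewrite mdist_geo // edist_lerp q0.
- by apply: mdist_le_lerp => //; rewrite edC q1 metric_sym.
- exact: mdist_le_lerp.
- by rewrite mdist_geo // edist_lerp e1_dist.
Qed.

(** Points of the side to [q] have exact images; every other point of the lower half borrows the
    image of a door point within [eps], with [eps] as its error. The jump between the two rules is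
    absorbed by this error. *)
Lemma lower_map : exists (Psi : euclid2 R -> X) (err' : euclid2 R -> R),
  [/\ forall z, 0 <= err' z <= eps,
      forall t, 0 <= t <= 1 -> Psi (lerp t 0 q) = ray k.+1 t /\ err' (lerp t 0 q) = 0 &
      forall z, halfP false z -> exists2 z', edist z z' <= err' z & on_triangle z' (Psi z)].
Proof.
have H z : exists xe : X * R, 0 <= xe.2 <= eps /\
   ((exists t, [/\ 0 <= t <= 1, z = lerp t 0 q & xe = (ray k.+1 t, 0)]) \/
    ((forall t, 0 <= t <= 1 -> z <> lerp t 0 q) /\ (halfP false z ->
     exists2 z', edist z z' <= xe.2 & on_triangle z' xe.1))).
  have [[t [t01 zE]]|no] := pselect (exists t, 0 <= t <= 1 /\ z = lerp t 0 q).
    exists (ray k.+1 t, 0); split; first by rewrite lexx.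
    by left; exists t.
  have no' t : 0 <= t <= 1 -> z <> lerp t 0 q by move=> t01 zE; apply: no; exists t.
  have [[_ [w [t t01 wE] zw]]|nh] := pselect (halfP false z).
    exists (ray k t, eps); split; first by rewrite /= lexx eps0.
    right; split => // _; exists w => //.
    by right; exists t; split.
  exists (p 0%N, eps); split; first by rewrite /= lexx eps0.
  by right; split.
have [f fP] := choice H.
exists (fun z => (f z).1), (fun z => (f z).2); split.
- by move=> z; have [] := fP z.
- move=> t t01; have [_ [[s [s01 e ->]]|[no _]]] := fP (lerp t 0 q); last first.
    by have := no t t01.
  split=> //=; apply: mdist_positivity; rewrite mdist_geo //.
  by rewrite -/(d 0 k.+1) -q0 -edist_lerp e edxx.
- move=> z hz; have [_ [[s [s01 e ->]]|[_ h]]] := fP z; last exact: h.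
  by exists z; [rewrite edxx|left; exists s; split].
Qed.

Lemma fan_step : exists Phi' err', fan_stage k.+1 g' Phi' err'.
Proof.
have [Psi [erm [em0 em1 em2]]] := lower_map.
pose Xi (y : bool * euclid2 R) := if y.1 then Phi y.2 else Psi y.2.
pose er (y : bool * euclid2 R) := if y.1 then err y.2 else erm y.2.
have er0 y : 0 <= er y <= eps by rewrite /er; case: (y.1); [exact: fs_err FS _|].
(* The way passes a point of the door, where [err] vanishes, so only the errors of the two ends
   remain. *)
have mixed z z' : halfP false z' -> mdist (Phi z) (Psi z') <= rho 0 e1 z z' + (err z + erm z').
  move=> /em2 [a za aP]; have [w [t t01 wE] ->] := rhoP 0 e1 z z'.
  have [Pw ew] := fs_side FS t01; rewrite gk -wE in Pw ew.
  have h1 := fs_lip FS z w; rewrite ew Pw in h1.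
  have h2 : mdist (ray k t) (Psi z') <= edist w a.
    by apply: on_triangle_lip aP; right; exists t; split.
  have h3 := metric_triangle (Phi z) (ray k t) (Psi z').
  have h4 := edtri z' w a; rewrite addr0 in h1.
  lra.
have Xi_lip y y' : glue l r1 eps y -> glue l r1 eps y' ->
    mdist (Xi y) (Xi y') <= gdist y y' + (er y + er y').
  case: y y' => [[] z] [[] z'] /= hz hz'; rewrite /Xi /er /glue_dist /=.
  - exact: fs_lip FS _ _.
  - exact: mixed.
  - by rewrite metric_sym rhoC (addrC (erm z)); exact: mixed.
  - have [a za aP] := em2 _ hz; have [a' za' aP'] := em2 _ hz'.
    have h1 := on_triangle_lip aP aP'.
    have h2 := edtri z a a'; have h3 := edtri z' z a'.
    rewrite (edC a z) in h2; lra.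
pose rel z y := (exists2 i, (i <= k)%N & z = g' i /\ y = (true, g i)) \/
  (exists2 t, 0 <= t <= 1 & z = lerp t 0 (g' k.+1) /\ y = (false, lerp t 0 q)).
have relP z y : rel z y -> glue l r1 eps y.
  by move=> [[i ik [_ ->]]|[t t01 [_ ->]]]; [exact: vertex_half|exact: ray_half].
have rel_er z y : rel z y -> er y = 0.
  move=> [[i ik [_ ->]]|[t t01 [_ ->]]]; rewrite /er /=.
    by have [] := fs_vertex FS ik.
  by have [] := em1 _ t01.
have g'0 : g' 0%N = 0 by exact: ip_0 g'N.
have g'k : edist 0 (g' k.+1) = edist 0 q.
  by have := pa_close g'P; rewrite g'0 close' q0.
(* The new closing side is as long as the side to [q], and its ends are at least as far from [g' i].
   Convexity of the glued distance along the side to [q] extends this domination from the ends to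
   the whole side. *)
have side_vertex i t : (i <= k)%N -> 0 <= t <= 1 ->
    gdist (true, g i) (false, lerp t 0 q) <= edist (g' i) (lerp t 0 (g' k.+1)).
  move=> ik t01; have /andP[t0 t1] := t01.
  have ik1 : (i <= k.+1)%N by exact: leqW.
  have h := @glue_convex_half R l r1 eps l0 false 0 q t (true, g i) _ q_half t01 (vertex_half ik).
  apply: edist_ge; first exact: glue_dist_ge0.
  apply: le_trans (h _) _.
    by apply: door_half => //; exact: segl.
  have n1 : edist (g i) 0 <= edist (g' i) 0.
    have := pa_dom g'P ik1 (leq0n _); by rewrite /attach ik leq0n g0 g'0.
  have n2 : rho 0 e1 (g i) q <= edist (g' i) (g' k.+1).
    have := pa_dom g'P ik1 (leqnn _); by rewrite /attach ik ltnn rhoC.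
  rewrite esq_lerp -[esq 0 q]edistE -[esq 0 (g' _)]edistE g'k lerD2r.
  rewrite glue_dist_door ?(segl) // /glue_dist /= lerD // ler_wpM2l ?subr_ge0 // -edistE;
    by rewrite ler_sqr ?nnegrE ?edist_ge0 ?rho_ge0.
have rel_lip z y z' y' : rel z y -> rel z' y' -> gdist y y' <= edist z z'.
  move=> [[i ik [-> ->]]|[t t01 [-> ->]]] [[j jk [-> ->]]|[s s01 [-> ->]]].
  - have := pa_dom g'P (leqW ik) (leqW jk); by rewrite /attach ik jk.
  - exact: side_vertex.
  - by rewrite glue_dist_sym edC; exact: side_vertex.
  - by rewrite /glue_dist /= !edist_lerp g'k.
have [f [f1 f2 f3]] := glue_kirszbraun l0 r10 eps0 relP rel_lip.
have fE z y : rel z y -> Xi (f z) = Xi y /\ er (f z) = 0.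
  move=> zy; have zf : rel z (f z) by apply: f3; exists y.
  have e0 := rel_er _ _ zf; split => //.
  apply: mdist_positivity; apply/eqP; rewrite eq_le mdist_ge0 andbT.
  apply: le_trans (Xi_lip _ _ (relP _ _ zf) (relP _ _ zy)) _.
  rewrite e0 (rel_er _ _ zy) !addr0.
  by apply: le_trans (rel_lip _ _ _ _ zf zy) _; rewrite edxx.
have side' t : 0 <= t <= 1 -> Xi (f (lerp t 0 (g' k.+1))) = ray k.+1 t /\ er (f (lerp t 0 (g' k.+1))) = 0.
  move=> t01; have [|-> ->] := @fE (lerp t 0 (g' k.+1)) (false, lerp t 0 q).
    by right; exists t.
  by split => //; have [] := em1 _ t01.
have vertex' i : (i <= k.+1)%N -> Xi (f (g' i)) = p i /\ er (f (g' i)) = 0.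
  rewrite leq_eqVlt => /orP[/eqP ->|ik].
    have h1 : 0 <= (1 : R) <= 1 by rewrite ler01 lexx.
    by have := side' _ h1; rewrite lerp1 /ray geo1.
  have [|-> ->] := @fE (g' i) (true, g i); first by left; exists i.
  by split => //; have [] := fs_vertex FS (i := i) ik.
have lip' z z' : mdist (Xi (f z)) (Xi (f z')) <= edist z z' + (er (f z) + er (f z')).
  by apply: le_trans (Xi_lip _ _ (f1 z) (f1 z')) _; rewrite lerD2r.
(* For [j <= k] the glued way crosses the door, and stage [k] already separates [g i] from that door
   point by [ray j]; for [j = k.+1] the end point itself lies on [ray j]. *)
have cross_side' i j t : (i < j)%N -> (j <= k.+1)%N -> 0 <= t <= 1 ->
    exists2 u, 0 <= u <= 1 &
    mdist (p i) (ray j u) + mdist (ray j u) (ray k.+1 t) <= edist (lerp t 0 (g' k.+1)) (g' i).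
  move=> ij; rewrite leq_eqVlt => /orP[/eqP jk t01|jk t01].
    exists t => //; rewrite jk mdistxx addr0.
    have [e e'] := side' _ t01; have [v v'] := vertex' i (ltnW (leq_trans ij (eq_leq jk))).
    by have := lip' (g' i) (lerp t 0 (g' k.+1)); rewrite e e' v v' !addr0 edC.
  have ik : (i <= k)%N by exact: ltnW (leq_trans ij jk).
  have := side_vertex _ _ ik t01; rewrite /glue_dist /=.
  have [w [s s01 wE] ->] := rhoP 0 e1 (g i) (lerp t 0 q) => H.
  have [u u01 hu] := fs_cross_side FS ij jk s01.
  rewrite gk -wE in hu.
  exists u => //.
  have h1 : mdist (ray k s) (ray k.+1 t) <= edist w (lerp t 0 q).
    by apply: on_triangle_lip; [right; exists s|left; exists t]; split.
  have h2 := metric_triangle (ray j u) (ray k s) (ray k.+1 t).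
  rewrite (edC w (g i)) in hu; rewrite edC; lra.
exists (Xi \o f), (er \o f); split => //.
- exact: fan_above'.
- exact: fan_pos'.
- by move=> z; exact: er0.
- move=> z /=; have := f1 z; case: (f z) => [[] a] /= ha; rewrite /Xi /=.
    by have [i [u [ik u01 e]]] := fs_ray FS a; exists i, u; split => //; exact: leqW.
  have [a' _ [[t [t01 _ e]]|[t [t01 _ e]]]] := em2 _ ha.
    by exists k.+1, t; split.
  by exists k, t; split.
- move=> i j m ij jm; rewrite leq_eqVlt => /orP[/eqP mE|mk].
    rewrite mE in jm *; have h1 : 0 <= (1 : R) <= 1 by rewrite ler01 lexx.
    have [u u01] := cross_side' i j 1 ij (ltnW jm) h1.
    by rewrite lerp1 {3}/ray geo1 edC => h; exists u.
  have [u u01 h] := fs_cross FS ij jm mk.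
  exists u => //; apply: le_trans h _.
  have ik : (i <= k)%N by lia.
  have mk' : (m <= k)%N by [].
  by have := pa_dom g'P (leqW ik) (leqW mk'); rewrite /attach ik mk'.
Qed.

End Step.

Lemma fan_stage_exists k : exists g Phi err, fan_stage k g Phi err.
Proof.
elim: k => [|k [g [Phi [err FS]]]].
  exists (fun=> 0), (fun=> p 0%N), (fun=> 0); split => //.
  - split => //.
    + by rewrite edxx /d mdistxx.
    + by move=> i j; rewrite !leqn0 => /eqP -> /eqP ->; rewrite edxx /d mdistxx.
    + by move=> i j m n _ _ _ _; exact: cross4ll.
  - by split => // [|i _]; rewrite /d mdistxx ?mul0r.
  - by move=> z; rewrite lexx eps0.
  - by move=> z z'; rewrite mdistxx !addr0 edist_ge0.
  - by move=> i; rewrite leqn0 => /eqP ->.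
  - move=> t t01; split=> //; apply: mdist_positivity.
    by rewrite /ray mdist_geol // mdistxx mulr0.
  - by move=> z; exists 0%N, 0; rewrite lexx ler01 /ray geo0.
  - by move=> i j t ij; rewrite leqn0 => /eqP j0; rewrite j0 in ij.
  - by move=> i j m ij jm; rewrite leqn0 => /eqP j0; rewrite j0 in jm.
have [||||||q [q2 q0 ql]] := @planar_triangle R (d 0 k.+1) (d k k.+1) (d 0 k);
  rewrite /d ?mdist_ge0 //.
- by rewrite addrC metric_triangle.
- by rewrite addrC (metric_sym (p 0%N) (p k)) metric_triangle.
- by rewrite (metric_sym (p k)) metric_triangle.
have AC := attach_cycmet_above (fs_above FS) (fs_pos FS) q2.
have [g' g'P g'N] := polygon_in_position_exists AC.
have [Phi' [err' FS']] := fan_step FS q2 q0 ql g'P g'N.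
by exists g', Phi', err'.
Qed.

End Fan.

(** * Polygonal approximations of a closed curve *)

Section Approximation.
Variables (R : realType) (X : metricType R).
Hypotheses (geoX : geodesic_space X) (catX : CAT0 X).
Variables (beta : R -> X) (L : R).
Hypotheses (L0 : 0 < L) (beta_closed : beta 0 = beta L)
  (beta_lip : forall s t, 0 <= s <= L -> 0 <= t <= L -> mdist (beta s) (beta t) <= `|s - t|).
Implicit Types (z w : euclid2 R) (s t u v : R) (i j k m n : nat).

Let ray t u := geo geoX (beta 0) (beta t) u.

(** In [approx_exists] the curve [g] is the step function through the vertices, not the polygon
    itself, [h] is the mesh, and [tau t] is the last node up to [t]. The jumps of [g] are at most
    [h] and vanish in the limit. *)
Record approx (h : R) (g : R -> euclid2 R) (Phi : euclid2 R -> X) (tau : R -> R) : Prop :=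
  Approx {
  ap_tau : forall t, 0 <= t <= L -> 0 <= tau t <= L /\ `|t - tau t| <= h;
  ap_0 : g 0 = 0;
  ap_L : g L = 0;
  ap_lip : forall s t, 0 <= s <= L -> 0 <= t <= L -> edist (g s) (g t) <= `|s - t| + h;
  ap_chords : forall s t u v, 0 <= s -> s <= t -> t <= u -> u <= v -> v <= L ->
    cross4 (g s) (g t) (g u) (g v);
  ap_map : forall z z', mdist (Phi z) (Phi z') <= edist z z' + (h + h);
  ap_bd : forall t, 0 <= t <= L -> Phi (g t) = beta (tau t);
  ap_ray : forall z, exists t u, [/\ 0 <= t <= L, 0 <= u <= 1 & Phi z = ray t u];
  ap_cross : forall s u t, 0 <= s -> s + h < u -> u + h < t -> t <= L ->
    exists2 v, 0 <= v <= 1 & mdist (beta (tau s)) (ray (tau u) v) +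
      mdist (ray (tau u) v) (beta (tau t)) <= edist (g s) (g t) }.

Lemma approx_exists n : exists g Phi tau, approx (L / n.+1%:R) g Phi tau.
Proof.
set N := n.+1%:R; have N0 : 0 < N :> R by rewrite ltr0n.
set h := L / N; have h0 : 0 < h by rewrite divr_gt0.
have hN : h * N = L by rewrite /h divfK // gt_eqF.
have node i : (i <= n.+1)%N -> 0 <= i%:R * h <= L.
  move=> iN; rewrite mulr_ge0 ?(ltW h0) //= -hN mulrC ler_pM2l // ler_nat //.
(* Capping at [L] keeps consecutive points [h]-close for all indices, those beyond the last node
   included. *)
pose p i := beta (Num.min (i%:R * h) L).
have min_in i : 0 <= Num.min (i%:R * h) L <= L.
  by rewrite le_min mulr_ge0 ?(ltW h0) ?(ltW L0) //= ge_min lexx orbT.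
have p_eps i : mdist (p i) (p i.+1) <= h.
  apply: le_trans (beta_lip (min_in i) (min_in i.+1)) _.
  have e : i.+1%:R * h = i%:R * h + h by rewrite -natr1 mulrDl mul1r.
  rewrite e ler_norml; case: (leP (i%:R * h) L) => h1; case: (leP (i%:R * h + h) L) => h2;
    by apply/andP; split; lra.
have pE i : (i <= n.+1)%N -> p i = beta (i%:R * h).
  by move=> /node/andP[_ iL]; rewrite /p min_l.
have [g [Phi [err FS]]] := fan_stage_exists geoX catX (ltW h0) p_eps n.+1.
have p0 : p 0%N = beta 0 by rewrite pE // mul0r.
have pN : p n.+1 = beta 0 by rewrite pE // -/N mulrC hN beta_closed.
pose idx t := Num.truncn (t / h).
have idxP t : 0 <= t <= L -> (idx t <= n.+1)%N /\ (idx t)%:R * h <= t < (idx t)%:R * h + h.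
  move=> /andP[t0 tL].
  have th0 : 0 <= t / h by rewrite divr_ge0 // ltW.
  have /andP[h1 h2] := truncn_itv th0.
  have h3 : (idx t)%:R * h <= t by rewrite -ler_pdivlMr.
  split; last first.
    by rewrite h3 /=; move: h2; rewrite ltr_pdivrMr // -natr1 mulrDl mul1r.
  have : (idx t)%:R * h <= N * h by rewrite [N * h]mulrC hN; exact: le_trans tL.
  by rewrite ler_pM2r // /N ler_nat.
have idx_le s t : s <= t -> (idx s <= idx t)%N.
  by move=> st; apply: le_truncn; rewrite ler_pM2r ?invr_gt0.
have edge i : (i < n.+1)%N -> edist (g i) (g i.+1) <= h.
  by move=> iN; rewrite (pa_edge (fs_above FS) iN).
have path_le i m : (i + m <= n.+1)%N -> edist (g i) (g (i + m)%N) <= m%:R * h.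
  elim: m => [|m IH] im; first by rewrite addn0 edxx mul0r.
  apply: le_trans (edtri (g (i + m)%N) _ _) _.
  rewrite -natr1 mulrDl mul1r lerD //; first by apply: IH; lia.
  by rewrite addnS; apply: edge; lia.
have lip s t : 0 <= s -> s <= t -> t <= L -> edist (g (idx s)) (g (idx t)) <= `|s - t| + h.
  move=> s0 st tL; have [|is1 /andP[is2 is3]] := idxP s; first by rewrite s0 (le_trans st).
  have [|it1 /andP[it2 it3]] := idxP t; first by rewrite (le_trans s0 st).
  have := idx_le _ _ st => ist.
  have := @path_le (idx s) (idx t - idx s)%N; rewrite subnKC // => /(_ it1) H.
  apply: le_trans H _; rewrite natrB // mulrBl distrC ger0_norm ?subr_ge0 //; lra.
pose tau t := (idx t)%:R * h.
exists (fun t => g (idx t)), Phi, tau; split.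
- move=> t tL; have [i1 /andP[i2 i3]] := idxP _ tL; split; first exact: node.
  by rewrite /tau ger0_norm ?subr_ge0 //; lra.
- by rewrite /idx mul0r truncn0 (ip_0 (fs_pos FS)).
- have -> : idx L = n.+1.
    have LhN : L / h = N by rewrite -hN mulrC mulKf // gt_eqF.
    by rewrite /idx LhN natrK.
  by rewrite (ip_n (fs_pos FS)) p0 pN mdistxx.
- move=> s t /andP[s0 sL] /andP[t0 tL]; have [st|/ltW ts] := leP s t; first exact: lip.
  by rewrite edC distrC; exact: lip.
- move=> s t u v s0 st tu uv vL; apply: (pa_chords (fs_above FS)); try exact: idx_le.
  by have [] := idxP v; first by rewrite vL (le_trans _ uv) // (le_trans _ tu) // (le_trans s0).
- move=> z z'; apply: le_trans (fs_lip FS z z') _; rewrite lerD2l.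
  by have /andP[_ ?] := fs_err FS z; have /andP[_ ?] := fs_err FS z'; rewrite lerD.
- move=> t tL; have [i1 _] := idxP _ tL; have [-> _] := fs_vertex FS i1; exact: pE.
- move=> z; have [i [u [ik u01 ->]]] := fs_ray FS z.
  by exists (i%:R * h), u; split => //; [exact: node|rewrite p0 pE].
- move=> s u t s0 su ut tL.
  have su' : s <= u by lra.
  have ut' : u <= t by lra.
  have [|i1 /andP[i2 i3]] := idxP s; first by rewrite s0; lra.
  have [|j1 /andP[j2 j3]] := idxP u; first by apply/andP; split; lra.
  have [|m1 /andP[m2 m3]] := idxP t; first by apply/andP; split; lra.
  have lt_idx a b : a%:R * h < b%:R * h -> (a < b)%N.
    by rewrite ltr_pM2r // ltr_nat.
  have ij : (idx s < idx u)%N by apply: lt_idx; lra.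
  have jm : (idx u < idx t)%N by apply: lt_idx; lra.
  have [v v01 H] := fs_cross FS ij jm m1.
  by exists v => //; move: H; rewrite p0 !pE.
Qed.

End Approximation.

(** * Limits of polygonal approximations *)

Section Limit.
Variables (R : realType) (X : metricType R).
Hypotheses (geoX : geodesic_space X) (catX : CAT0 X).
Variables (beta : R -> X) (L : R).
Hypotheses (L0 : 0 < L) (beta_closed : beta 0 = beta L)
  (beta_lip : forall s t, 0 <= s <= L -> 0 <= t <= L -> mdist (beta s) (beta t) <= `|s - t|).
Implicit Types (z w : euclid2 R) (s t u v : R) (n : nat).

Let ray t u := geo geoX (beta 0) (beta t) u.

Record majorant (g : R -> euclid2 R) (F : euclid2 R -> X) : Prop := Majorant {
  mj_closed : g 0 = g L;
  mj_lip : forall s t, 0 <= s <= L -> 0 <= t <= L -> edist (g s) (g t) <= `|s - t|;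
  mj_chords : forall s t u v, 0 <= s -> s <= t -> t <= u -> u <= v -> v <= L ->
    cross4 (g s) (g t) (g u) (g v);
  mj_map : forall z z', mdist (F z) (F z') <= edist z z';
  mj_bd : forall t, 0 <= t <= L -> F (g t) = beta t }.

(** Limit of [fs_cross]. If [g s = g t], domination alone yields [beta s = beta t], but not that
    this point lies on the geodesic from [beta 0] to [beta u]. *)
Definition separated (g : R -> euclid2 R) := forall s u t,
  0 <= s -> s < u -> u < t -> t <= L ->
  exists2 v, 0 <= v <= 1 &
  mdist (beta s) (ray u v) + mdist (ray u v) (beta t) <= edist (g s) (g t).

Lemma ray_lip s t u v : 0 <= s <= L -> 0 <= t <= L -> 0 <= u <= 1 -> 0 <= v <= 1 ->
  mdist (ray s u) (ray t v) <= `|s - t| + L * `|u - v|.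
Proof.
move=> s0L t0L u01 v01.
apply: le_trans (metric_triangle _ (ray t u) _) _; apply: lerD.
  apply: le_trans (beta_lip s0L t0L).
  have /andP[u0 u1] := u01.
  have := geo_cone geoX catX (beta 0) (beta s) (beta t) u01 u01.
  rewrite subrr mulr0 !mul0r !add0r => H.
  rewrite -ler_sqr ?nnegrE ?mdist_ge0 //; apply: le_trans H _.
  by rewrite -expr2 ler_piMl ?sqr_ge0 // expr_le1.
rewrite mdist_geo // mulrC ler_wpM2r //.
have z0L : 0 <= (0 : R) <= L by rewrite lexx ltW.
apply: le_trans (beta_lip z0L t0L) _.
by case/andP: t0L => t0 tL; rewrite sub0r normrN ger0_norm.
Qed.

Lemma ultra_nat : exists2 U : set_system nat, UltraFilter U & \oo `<=` U.
Proof. by have [U [UU h]] := ultraFilterLemma (eventually_filter); exists U. Qed.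

Lemma ultra_le_err (U : set_system nat) (a b : R) (v : nat -> R) : UltraFilter U ->
  v @ U --> 0 -> (forall n, a <= b + v n) -> a <= b.
Proof.
move=> UU v0 H; have h : (fun n => b + v n) @ U --> b + 0.
  by apply: cvgD => //; exact: cvg_cst.
rewrite addr0 in h; apply: (ultra_le UU (cvg_cst a) h).
by apply: filterE => n; exact: H.
Qed.

Theorem majorant_exists : exists g F, majorant g F /\ separated g.
Proof.
have [U UU Uoo] := ultra_nat.
pose h n : R := L / n.+1%:R.
have h0 n : 0 < h n by rewrite divr_gt0 // ltr0n.
have hU : h @ U --> 0.
  have : h @ \oo --> L * 0 by apply: cvgM; [exact: cvg_cst|exact: cvg_harmonic].
  by rewrite mulr0 => H A /H; exact: Uoo.
have H n : exists gpt : (R -> euclid2 R) * (euclid2 R -> X) * (R -> R),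
    approx geoX beta L (h n) gpt.1.1 gpt.1.2 gpt.2.
  by have [g [Phi [tau A]]] := approx_exists geoX catX L0 beta_closed beta_lip n;
    exists (g, Phi, tau).
have [gpt A] := choice H.
pose gn n := (gpt n).1.1; pose Phi n := (gpt n).1.2; pose tau n := (gpt n).2.
have {}A n : approx geoX beta L (h n) (gn n) (Phi n) (tau n) by exact: A.
have z0L : 0 <= (0 : R) <= L by rewrite lexx ltW.
have glim t : exists a : euclid2 R, 0 <= t <= L ->
    (fun n => (gn n t).1) @ U --> a.1 /\ (fun n => (gn n t).2) @ U --> a.2.
  have [tL|] := pselect (0 <= t <= L); last by exists 0.
  have bnd n : `|(gn n t).1| <= 2 * L /\ `|(gn n t).2| <= 2 * L.
    have [h1 h2] := abs_le_edist (gn n t) 0.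
    have h3 := ap_lip (A n) tL z0L; rewrite (ap_0 (A n)) subr0 in h3.
    rewrite /= !subr0 in h1 h2.
    have hL : h n <= L by rewrite /h ler_pdivrMr ?ltr0n // ler_peMr ?(ltW L0) // ler1n.
    have h4 : `|t| <= L by case/andP: tL => t0 ?; rewrite ger0_norm.
    by split; lra.
  have [x hx] : exists x : R, (fun n => (gn n t).1) @ U --> x.
    apply: (@ultra_cvg_bounded _ _ _ _ (- (2 * L)) (2 * L)); apply: filterE => n /=.
    by have [+ _] := bnd n; rewrite ler_norml.
  have [y hy] : exists x : R, (fun n => (gn n t).2) @ U --> x.
    apply: (@ultra_cvg_bounded _ _ _ _ (- (2 * L)) (2 * L)); apply: filterE => n /=.
    by have [_] := bnd n; rewrite ler_norml.
  by exists (x, y).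
have [g gP] := choice glim.
have ge t : 0 <= t <= L -> (fun n => edist (gn n t) (g t)) @ U --> 0.
  by move=> /gP[? ?]; exact: cvg_edist.
have Flim z : exists x : X, (fun n => mdist (Phi n z) x) @ U --> 0.
  have K n : exists tu : R * R, [/\ 0 <= tu.1 <= L, 0 <= tu.2 <= 1 & Phi n z = ray tu.1 tu.2].
    by have [t [u [? ? ?]]] := ap_ray (A n) z; exists (t, u).
  have [tu tuP] := choice K.
  have [t ht] : exists t : R, (fun n => (tu n).1) @ U --> t.
    by apply: (@ultra_cvg_bounded _ _ _ _ 0 L); apply: filterE => n /=; have [] := tuP n.
  have [u hu] : exists u : R, (fun n => (tu n).2) @ U --> u.
    by apply: (@ultra_cvg_bounded _ _ _ _ 0 1); apply: filterE => n /=; have [] := tuP n.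
  have tL : 0 <= t <= L.
    apply/andP; split; [apply: (ultra_le UU (cvg_cst 0) ht)|apply: (ultra_le UU ht (cvg_cst L))];
    by apply: filterE => n /=; have [/andP[]] := tuP n.
  have u1 : 0 <= u <= 1.
    apply/andP; split; [apply: (ultra_le UU (cvg_cst 0) hu)|apply: (ultra_le UU hu (cvg_cst (1 : R)))];
    by apply: filterE => n /=; have [_ /andP[]] := tuP n.
  exists (ray t u).
  apply: (@cvg_dist_le _ _ _ _ (fun n => `|(tu n).1 - t| + L * `|(tu n).2 - u|)).
    apply: filterE => n /=; rewrite subr0 ger0_norm ?mdist_ge0 //.
    by have [? ? ->] := tuP n; exact: ray_lip.
  have e (f : nat -> R) c : f @ U --> c -> (fun n => `|f n - c|) @ U --> 0.
    move=> fc; have : (fun n => `|f n - c|) @ U --> `|c - c|.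
      by apply: cvg_norm; apply: cvgB => //; exact: cvg_cst.
    by rewrite subrr normr0.
  have : (fun n => `|(tu n).1 - t| + L * `|(tu n).2 - u|) @ U --> 0 + L * 0.
    by apply: cvgD; [exact: e|apply: cvgM; [exact: cvg_cst|exact: e]].
  by rewrite mulr0 addr0.
have [F FP] := choice Flim.
have tauU t : 0 <= t <= L -> forall n, mdist (beta t) (beta (tau n t)) <= h n.
  by move=> tL n; have [h1 h2] := ap_tau (A n) tL; apply: le_trans h2; exact: beta_lip.
have lip s t : 0 <= s <= L -> 0 <= t <= L -> forall n,
    edist (gn n s) (gn n t) <= edist (g s) (g t) + (edist (gn n s) (g s) + edist (gn n t) (g t)).
  move=> sL tL n.
  have := edtri (g s) (gn n s) (gn n t); have := edtri (g t) (g s) (gn n t).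
  rewrite (edC (g t) (gn n t)); lra.
have lip' s t : 0 <= s <= L -> 0 <= t <= L -> forall n,
    edist (g s) (g t) <= edist (gn n s) (gn n t) + (edist (gn n s) (g s) + edist (gn n t) (g t)).
  move=> sL tL n.
  have := edtri (gn n s) (g s) (g t); have := edtri (gn n t) (gn n s) (g t).
  rewrite (edC (g s) (gn n s)); lra.
have err2 s t : 0 <= s <= L -> 0 <= t <= L ->
    (fun n => edist (gn n s) (g s) + edist (gn n t) (g t)) @ U --> 0.
  by move=> sL tL; rewrite -[X in _ --> X](addr0 0); apply: cvgD; exact: ge.
have LL : 0 <= L <= L by rewrite ltW // lexx.
exists g, F; split; first split.
- apply: ed0_eq; apply/eqP; rewrite eq_le edist_ge0 andbT.
  apply: (ultra_le_err UU (err2 _ _ z0L LL)) => n.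
  by apply: le_trans (lip' _ _ z0L LL n) _; rewrite (ap_0 (A n)) (ap_L (A n)) edxx.
- move=> s t sL tL.
  have e3 : (fun n => h n + (edist (gn n s) (g s) + edist (gn n t) (g t))) @ U --> 0.
    by rewrite -[X in _ --> X](addr0 0); apply: cvgD => //; exact: err2.
  apply: (ultra_le_err UU e3) => n; rewrite addrA.
  by apply: le_trans (lip' _ _ sL tL n) _; rewrite lerD2r; exact: (ap_lip (A n)).
- move=> s t u v s0 st tu uv vL.
  have sL : 0 <= s <= L by lra.
  have tL : 0 <= t <= L by lra.
  have uL : 0 <= u <= L by lra.
  have vL' : 0 <= v <= L by lra.
  have K n : exists ab : R * R, [/\ 0 <= ab.1 <= 1, 0 <= ab.2 <= 1 &
      lerp ab.1 (gn n s) (gn n u) = lerp ab.2 (gn n t) (gn n v)].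
    have [w [a a01 ->] [b b01 e]] := ap_chords (A n) s0 st tu uv vL.
    by exists (a, b).
  have [ab abP] := choice K.
  have [a ha] : exists a : R, (fun n => (ab n).1) @ U --> a.
    by apply: (@ultra_cvg_bounded _ _ _ _ 0 1); apply: filterE => n /=; have [] := abP n.
  have [b hb] : exists b : R, (fun n => (ab n).2) @ U --> b.
    by apply: (@ultra_cvg_bounded _ _ _ _ 0 1); apply: filterE => n /=; have [] := abP n.
  have a1 : 0 <= a <= 1.
    apply/andP; split; [apply: (ultra_le UU (cvg_cst 0) ha)|apply: (ultra_le UU ha (cvg_cst (1 : R)))];
    by apply: filterE => n /=; have [/andP[]] := abP n.
  have b1 : 0 <= b <= 1.
    apply/andP; split; [apply: (ultra_le UU (cvg_cst 0) hb)|apply: (ultra_le UU hb (cvg_cst (1 : R)))];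
    by apply: filterE => n /=; have [_ /andP[]] := abP n.
  have lerp_cvg (c : nat -> R) (x y : nat -> R) c0 x0 y0 : c @ U --> c0 -> x @ U --> x0 ->
      y @ U --> y0 -> (fun n => (1 - c n) * x n + c n * y n) @ U --> (1 - c0) * x0 + c0 * y0.
    move=> hc hx hy; apply: cvgD; apply: cvgM => //.
    by apply: cvgB => //; exact: cvg_cst.
  have [gs1 gs2] := gP s sL; have [gt1 gt2] := gP t tL.
  have [gu1 gu2] := gP u uL; have [gv1 gv2] := gP v vL'.
  exists (lerp a (g s) (g u)); first by exists a.
  exists b => //; rewrite /lerp; congr pair.
    have l1 := lerp_cvg _ _ _ _ _ _ ha gs1 gu1.
    have l2 := lerp_cvg _ _ _ _ _ _ hb gt1 gv1.
    apply: (ultra_eq UU l1); suff -> : (fun n => (1 - (ab n).1) * (gn n s).1 + (ab n).1 * (gn n u).1) =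
      (fun n => (1 - (ab n).2) * (gn n t).1 + (ab n).2 * (gn n v).1) by [].
    by apply: funext => n; have [_ _ /(congr1 fst)] := abP n.
  have l1 := lerp_cvg _ _ _ _ _ _ ha gs2 gu2.
  have l2 := lerp_cvg _ _ _ _ _ _ hb gt2 gv2.
  apply: (ultra_eq UU l1); suff -> : (fun n => (1 - (ab n).1) * (gn n s).2 + (ab n).1 * (gn n u).2) =
    (fun n => (1 - (ab n).2) * (gn n t).2 + (ab n).2 * (gn n v).2) by [].
  by apply: funext => n; have [_ _ /(congr1 snd)] := abP n.
- move=> z z'.
  have e3 : (fun n => (h n + h n) + (mdist (Phi n z) (F z) + mdist (Phi n z') (F z'))) @ U --> 0.
    rewrite -[X in _ --> X](addr0 0); apply: cvgD; rewrite -[X in _ --> X](addr0 0); exact: cvgD.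
  apply: (ultra_le_err UU e3) => n.
  have h1 := ap_map (A n) z z'.
  have h2 := metric_triangle (F z) (Phi n z) (F z').
  have h3 := metric_triangle (Phi n z) (Phi n z') (F z').
  rewrite (metric_sym (F z) (Phi n z)) in h2; lra.
- move=> t tL; apply: mdist_positivity; apply/eqP; rewrite eq_le mdist_ge0 andbT.
  have e3 : (fun n => (h n + h n + h n) + (mdist (Phi n (g t)) (F (g t)) + edist (gn n t) (g t))) @ U --> 0.
    rewrite -[X in _ --> X](addr0 0); apply: cvgD; rewrite -[X in _ --> X](addr0 0); apply: cvgD => //.
      by rewrite -[X in _ --> X](addr0 0); exact: cvgD.
    exact: ge.
  apply: (ultra_le_err UU e3) => n; rewrite add0r.
  have h1 := ap_map (A n) (g t) (gn n t); rewrite (ap_bd (A n) tL) in h1.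
  have h2 := metric_triangle (F (g t)) (Phi n (g t)) (beta t).
  have h3 := metric_triangle (Phi n (g t)) (beta (tau n t)) (beta t).
  have h4 := tauU _ tL n.
  rewrite (metric_sym (F (g t)) (Phi n (g t))) in h2; rewrite (metric_sym (beta (tau n t))) in h3.
  rewrite (edC (g t)) in h1; lra.
- move=> s u t s0 su ut tL.
  have sL : 0 <= s <= L by lra.
  have uL : 0 <= u <= L by lra.
  have tL' : 0 <= t <= L by lra.
  have Usmall : U [set n | s + h n < u /\ u + h n < t].
    have mp : 0 < Num.min (u - s) (t - u) by rewrite lt_min !subr_gt0 su ut.
    move/cvgrPdist_lt: hU => /(_ _ mp); apply: filterS => n /=.
    rewrite sub0r normrN ger0_norm ?(ltW (h0 n)) // lt_min => /andP[? ?].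
    by split; lra.
  have K n : exists v, 0 <= v <= 1 /\ (s + h n < u /\ u + h n < t ->
      mdist (beta (tau n s)) (ray (tau n u) v) + mdist (ray (tau n u) v) (beta (tau n t)) <= edist (gn n s) (gn n t)).
    have [[h1 h2]|no] := pselect (s + h n < u /\ u + h n < t).
      by have [v v01 hv] := ap_cross (A n) s0 h1 h2 tL; exists v.
    by exists 0; rewrite lexx ler01.
  have [vn vP] := choice K.
  have [v hv] : exists v : R, vn @ U --> v.
    by apply: (@ultra_cvg_bounded _ _ _ _ 0 1); apply: filterE => n /=; have [] := vP n.
  have v1 : 0 <= v <= 1.
    apply/andP; split; [apply: (ultra_le UU (cvg_cst 0) hv)|apply: (ultra_le UU hv (cvg_cst (1 : R)))];
    by apply: filterE => n /=; have [/andP[]] := vP n.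
  exists v => //.
  have e1 : (fun n => `|vn n - v|) @ U --> 0.
    have : (fun n => `|vn n - v|) @ U --> `|v - v|.
      by apply: cvg_norm; apply: cvgB => //; exact: cvg_cst.
    by rewrite subrr normr0.
  have e3 : (fun n => edist (g s) (g t) + ((edist (gn n s) (g s) + edist (gn n t) (g t)) +
      ((h n + h n + h n + h n) + 2 * (L * `|vn n - v|)))) @ U --> edist (g s) (g t) + 0.
    apply: cvgD; first exact: cvg_cst.
    rewrite -[X in _ --> X](addr0 0); apply: cvgD; first exact: err2.
    rewrite -[X in _ --> X](addr0 0); apply: cvgD.
      do 3 (rewrite -[X in _ --> X](addr0 0); apply: cvgD => //).
    have : (fun n => 2 * (L * `|vn n - v|)) @ U --> 2 * (L * 0).
      by apply: cvgM; [exact: cvg_cst|apply: cvgM => //; exact: cvg_cst].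
    by rewrite !mulr0.
  rewrite addr0 in e3.
  apply: (ultra_le UU (cvg_cst _) e3); apply: filterS Usmall => n small /=.
  have [vn01 /(_ small) Hn] := vP n.
  have l1 := lip _ _ sL tL' n.
  have hs := tauU _ sL n; have ht := tauU _ tL' n.
  have [tu1 tu2] := ap_tau (A n) uL.
  have hr := ray_lip tu1 uL vn01 v1; rewrite distrC in hr.
  have m1 := metric_triangle (beta s) (beta (tau n s)) (ray u v).
  have m2 := metric_triangle (beta (tau n s)) (ray (tau n u) (vn n)) (ray u v).
  have m3 := metric_triangle (ray u v) (ray (tau n u) (vn n)) (beta t).
  have m4 := metric_triangle (ray (tau n u) (vn n)) (beta (tau n t)) (beta t).
  rewrite (metric_sym (beta (tau n t))) in m4; rewrite (metric_sym (ray u v) (ray _ _)) in m3.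
  lra.
Qed.

End Limit.

(** * Collinear majorants *)

Lemma lipschitz_on_min (R : realType) (f : R -> R) (a b : R) : a <= b ->
  (forall x y, a <= x <= b -> a <= y <= b -> `|f x - f y| <= `|x - y|) ->
  exists2 c, a <= c <= b & forall t, a <= t <= b -> f c <= f t.
Proof.
move=> ab fK; pose c t := Num.max a (Num.min b t).
have cI t : a <= c t <= b by rewrite /c le_max lexx /= ge_max ab ge_min lexx.
have cE t : a <= t <= b -> c t = t by move=> /andP[a1 b1]; rewrite /c min_r // max_r.
have [|m mI hm] := @lipschitz_min R (f \o c) 1 a b ab.
  move=> x y; rewrite mul1r; apply: le_trans (fK _ _ (cI x) (cI y)) _.
  have h u v : u <= v -> `|c u - c v| <= `|u - v|.
    move=> uv; rewrite [X in X <= _]distrC [X in _ <= X]distrC.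
    rewrite [X in _ <= X]ger0_norm ?subr_ge0 //.
    rewrite ler_norml /c; case: (leP b u) => ?; case: (leP b v) => ?;
      case: (leP a b) => ?; case: (leP a u) => ?; case: (leP a v) => ?; by apply/andP; split; lra.
  by have [xy|/ltW yx] := leP x y; [exact: h|rewrite distrC [X in _ <= X]distrC; exact: h].
by exists (c m) => // t tI; have := hm t tI; rewrite /= (cE t tI).
Qed.

Section Folding.
Variables (R : realType) (X : metricType R).
Hypotheses (geoX : geodesic_space X) (catX : CAT0 X).
Variables (beta : R -> X) (L : R).
Hypotheses (L0 : 0 < L) (beta_closed : beta 0 = beta L)
  (beta_lip : forall s t, 0 <= s <= L -> 0 <= t <= L -> mdist (beta s) (beta t) <= `|s - t|).

(* This form of parametrization by arc length needs no mention of the length. *)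
Hypothesis beta_arclength : forall (s t : R) (f : R -> R), 0 <= s -> s <= t -> t <= L ->
  (forall u v, s <= u -> u <= v -> v <= t -> mdist (beta u) (beta v) <= f v - f u) ->
  t - s <= f t - f s.

Implicit Types (z w : euclid2 R) (s t u v : R).

Section FoldedLine.
Variables (g : R -> euclid2 R) (gam : R -> R).
Hypotheses (g_sep : separated geoX beta L g)
  (gam_dist : forall s t, 0 <= s <= L -> 0 <= t <= L -> edist (g s) (g t) = `|gam s - gam t|)
  (gam_closed : gam 0 = gam L)
  (gam_lip : forall s t, 0 <= s <= L -> 0 <= t <= L -> `|gam s - gam t| <= `|s - t|)
  (gam_dom : forall s t, 0 <= s <= L -> 0 <= t <= L -> mdist (beta s) (beta t) <= `|gam s - gam t|)
  (gam_chords : forall s t u v, 0 <= s -> s <= t -> t <= u -> u <= v -> v <= L ->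
    exists a b : R, [/\ 0 <= a <= 1, 0 <= b <= 1 &
      (1 - a) * gam s + a * gam u = (1 - b) * gam t + b * gam v]).

(** Equal values of [gam] make the bound in [separated] vanish, so [beta s], [beta t] and a point of
    the geodesic to [beta u] coincide. *)
Lemma fold_between s u t : 0 <= s -> s < u -> u < t -> t <= L -> gam s = gam t ->
  beta s = beta t /\
  mdist (beta 0) (beta u) = mdist (beta 0) (beta s) + mdist (beta s) (beta u).
Proof.
move=> s0 su ut tL e.
have [v v01 h] := g_sep s0 su ut tL.
move: h; rewrite gam_dist; [|lra..]; rewrite e subrr normr0 => h.
have h1 := mdist_ge0 (beta s) (geo geoX (beta 0) (beta u) v).
have h2 := mdist_ge0 (geo geoX (beta 0) (beta u) v) (beta t).
have e1 : beta s = geo geoX (beta 0) (beta u) v by apply: mdist_positivity; lra.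
have e2 : geo geoX (beta 0) (beta u) v = beta t by apply: mdist_positivity; lra.
split; first by rewrite e1.
by rewrite e1 mdist_geol // mdist_geor //; ring.
Qed.

Variables (m0 m1 : R).
Hypotheses (m00 : 0 <= m0) (m01 : m0 <= m1) (m1L : m1 <= L)
  (m0_min : forall t, 0 <= t <= L -> gam m0 <= gam t)
  (m1_max : forall t, 0 <= t <= L -> gam t <= gam m1).

(** The line is folded at [m0] and [m1]. Between the folds [gam] is monotone because chords
    interlace, and it has speed 1 because [beta] is parametrized by arc length; closedness then
    makes both arcs equally long, so [m1 = m0 + L / 2]. Points symmetric about a fold have equal
    [gam], and by [fold_between] the distance from [beta 0] grows exactly by distances along the
    curve on the way from [beta 0] to either fold. *)
Lemma folded_line : exists m : R, [/\ 0 <= m, m <= L / 2, m <= mdist (beta 0) (beta m) &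
  L / 2 - m <= mdist (beta 0) (beta (m + L / 2))].
Proof.
have [p1 p2 p3 p4] := And4 m00 m01 m1L L0; have p5 := gam_closed.
have conv (a x y c : R) : 0 <= a <= 1 -> x <= c -> y <= c -> (1 - a) * x + a * y <= c.
  move=> /andP[a0 a1] xc yc.
  have h1 : (1 - a) * x <= (1 - a) * c by rewrite ler_wpM2l ?subr_ge0.
  have h2 : a * y <= a * c by rewrite ler_wpM2l.
  lra.
have conv' (a x y c : R) : 0 <= a <= 1 -> c <= x -> c <= y -> c <= (1 - a) * x + a * y.
  move=> /andP[a0 a1] xc yc.
  have h1 : (1 - a) * c <= (1 - a) * x by rewrite ler_wpM2l ?subr_ge0.
  have h2 : a * c <= a * y by rewrite ler_wpM2l.
  lra.
(* The value common to the chords from [m0] to [v] and from [u] to [m1] is at most [gam v] and at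
   least [gam u]. *)
have mono1 u v : m0 <= u -> u <= v -> v <= m1 -> gam u <= gam v.
  move=> h1 h2 h3; have [a [b [a1 b1 e]]] := gam_chords m00 h1 h2 h3 m1L.
  have := conv a (gam m0) (gam v) (gam v) a1 (m0_min (t := v) _) (lexx _).
  have := conv' b (gam u) (gam m1) (gam u) b1 (lexx _) (m1_max (t := u) _).
  rewrite e => h4 h5; apply: le_trans (h4 _) (h5 _); lra.
have mono2 u v : m1 <= u -> u <= v -> v <= L -> gam v <= gam u.
  move=> h1 h2 h3; have [a [b [a1 b1 e]]] := gam_chords m00 m01 h1 h2 h3.
  have := conv a (gam m0) (gam u) (gam u) a1 (m0_min (t := u) _) (lexx _).
  have := conv' b (gam m1) (gam v) (gam v) b1 (m1_max (t := v) _) (lexx _).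
  rewrite e => h4 h5; apply: le_trans (h4 _) (h5 _); lra.
have mono3 u v : 0 <= u -> u <= v -> v <= m0 -> gam v <= gam u.
  move=> h1 h2 h3; have [a [b [a1 b1 e]]] := gam_chords h1 h2 h3 m01 m1L.
  have := conv a (gam u) (gam m0) (gam u) a1 (lexx _) (m0_min (t := u) _).
  have := conv' b (gam v) (gam m1) (gam v) b1 (lexx _) (m1_max (t := v) _).
  rewrite e => h4 h5; apply: le_trans (h4 _) (h5 _); lra.
have I0 : 0 <= (0 : R) <= L by rewrite lexx ltW.
have IL : 0 <= L <= L by rewrite lexx andbT ltW.
have Im0 : 0 <= m0 <= L by lra.
have Im1 : 0 <= m1 <= L by lra.
have al1 : m1 - m0 <= gam m1 - gam m0.
  apply: (@beta_arclength m0 m1 gam) => // u v h1 h2 h3.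
  apply: le_trans (gam_dom _ _) _; [lra|lra|].
  by rewrite distrC ger0_norm // subr_ge0; exact: mono1.
have al2 : L - m1 <= - gam L - - gam m1.
  apply: (@beta_arclength m1 L (fun t => - gam t)) => //; first by lra.
  move=> u v h1 h2 h3; apply: le_trans (gam_dom _ _) _; [lra|lra|].
  by rewrite /= opprK [leRHS]addrC ger0_norm // subr_ge0; exact: mono2.
have al3 : m0 - 0 <= - gam m0 - - gam 0.
  apply: (@beta_arclength 0 m0 (fun t => - gam t)) => //; first by lra.
  move=> u v h1 h2 h3; apply: le_trans (gam_dom _ _) _; [lra|lra|].
  by rewrite /= opprK [leRHS]addrC ger0_norm // subr_ge0; exact: mono3.
have lip s t : 0 <= s -> s <= t -> t <= L -> `|gam s - gam t| <= t - s.
  move=> s0 st tL; apply: le_trans (gam_lip _ _) _; [lra|lra|].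
  by rewrite distrC ger0_norm // subr_ge0.
have lip1 := lip _ _ m00 m01 m1L.
have lip2 := lip m1 L (le_trans m00 m01) m1L (lexx _).
have lip3 := lip 0 m0 (lexx _) m00 (le_trans m01 m1L).
move: lip1 lip2 lip3; rewrite !ler_norml => /andP[a1 a2] /andP[b1 b2] /andP[c1 c2].
have m1E : m1 = m0 + L / 2 by lra.
have m0L2 : m0 <= L / 2 by lra.
have L2 : 0 < L / 2 by lra.
have left0 s : 0 <= s <= m0 -> gam s = gam m0 + (m0 - s).
  move=> /andP[s0 s1].
  have := lip 0 s (lexx _) s0 _; have := lip s m0 s0 s1 _.
  rewrite !ler_norml => /(_ _)/andP[|d1 d2]; first lra.
  by move=> /(_ _)/andP[|d3 d4]; lra.
have right0 s : m0 <= s <= m1 -> gam s = gam m0 + (s - m0).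
  move=> /andP[s0 s1].
  have := lip m0 s m00 s0 _; have := lip s m1 _ s1 m1L.
  rewrite !ler_norml => /(_ _)/andP[|d1 d2]; first lra.
  by move=> /(_ _)/andP[|d3 d4]; lra.
have right1 s : m1 <= s <= L -> gam s = gam m1 - (s - m1).
  move=> /andP[s0 s1].
  have := lip m1 s _ s0 s1; have := lip s L _ s1 (lexx _).
  rewrite !ler_norml => /(_ _)/andP[|d1 d2]; first lra.
  by move=> /(_ _)/andP[|d3 d4]; lra.
pose f u := mdist (beta 0) (beta u).
have f0 : f 0 = 0 by exact: mdistxx.
have fL : f L = 0 by rewrite /f -beta_closed mdistxx.
exists m0; rewrite -m1E; split => //.
- have := @beta_arclength 0 m0 f (lexx _) m00 (le_trans m01 m1L).
  rewrite f0 !subr0; apply => u v u0 uv vm.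
  have [->|uNv] := eqVneq u v; first by rewrite mdistxx subrr.
  have uv' : u < v by rewrite lt_neqAle uNv.
  have h3 : v < m0 + (m0 - u) by lra.
  have h4 : m0 + (m0 - u) <= L by lra.
  have e : gam u = gam (m0 + (m0 - u)) by rewrite (left0 u) ?(right0 (m0 + (m0 - u))); lra.
  have [_ h] := fold_between u0 uv' h3 h4 e.
  by rewrite /f h [leRHS]addrC addKr.
- have -> : L / 2 - m0 = L - m1 by lra.
  have := @beta_arclength m1 L (fun t => - f t) (le_trans m00 m01) m1L (lexx _).
  rewrite opprK fL oppr0 add0r; apply => u v u0 uv vm.
  have [->|uNv] := eqVneq u v; first by rewrite mdistxx addrC opprK subrr.
  have uv' : u < v by rewrite lt_neqAle uNv.
  have h3 : 0 <= m1 + (m1 - v) by lra.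
  have h4 : m1 + (m1 - v) < u by lra.
  have e' : gam (m1 + (m1 - v)) = gam v
    by rewrite (right0 (m1 + (m1 - v))) ?(right1 v); lra.
  have [e h] := fold_between h3 h4 uv' vm e'.
  by rewrite opprK [leRHS]addrC /f h e (metric_sym (beta u)) [leRHS]addrC addKr.
Qed.

End FoldedLine.

Definition collinear (g : R -> euclid2 R) := forall s t u,
  0 <= s <= L -> 0 <= t <= L -> 0 <= u <= L ->
  ((g t).1 - (g s).1) * ((g u).2 - (g s).2) = ((g u).1 - (g s).1) * ((g t).2 - (g s).2).

Lemma collinear_fold g F : majorant beta L g F -> separated geoX beta L g -> collinear g ->
  exists m : R, [/\ 0 <= m, m <= L / 2, m <= mdist (beta 0) (beta m) &
  L / 2 - m <= mdist (beta 0) (beta (m + L / 2))].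
Proof.
move=> [gc gl gch Fm Fb] gs col; have p4 := L0.
have I0 : 0 <= (0 : R) <= L by rewrite lexx ltW.
have IL : 0 <= L <= L by rewrite lexx andbT ltW.
have dom s t : 0 <= s <= L -> 0 <= t <= L -> mdist (beta s) (beta t) <= edist (g s) (g t).
  by move=> sL tL; rewrite -(Fb _ sL) -(Fb _ tL).
have [t1 t1L gt1] : exists2 t, 0 <= t <= L & g t <> g 0.
  apply: contrapT => no.
  have cst t : 0 <= t <= L -> g t = g 0.
    by move=> tL; apply: contrapT => h; apply: no; exists t.
  have := @beta_arclength 0 L (fun=> 0) (lexx _) (ltW L0) (lexx _).
  rewrite !subr0 => H; suff : L <= 0 by lra.
  apply: H => u v u0 uv vL; apply: le_trans (dom _ _ _ _) _; [lra|lra|].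
  by rewrite (cst u) ?(cst v) ?edxx //; lra.
pose l := edist (g 0) (g t1).
have lp : 0 < l by rewrite lt_def edist_ge0 andbT; apply/eqP => /ed0_eq /esym.
pose a := ((g t1).1 - (g 0).1) / l; pose b := ((g t1).2 - (g 0).2) / l.
have ab1 : a ^+ 2 + b ^+ 2 = 1.
  have e : ((g t1).1 - (g 0).1) ^+ 2 + ((g t1).2 - (g 0).2) ^+ 2 = l ^+ 2.
    by rewrite edistE /esq; ring.
  have -> : a ^+ 2 + b ^+ 2 =
    (((g t1).1 - (g 0).1) ^+ 2 + ((g t1).2 - (g 0).2) ^+ 2) / l ^+ 2.
    by rewrite /a /b; field; rewrite gt_eqF.
  by rewrite e divff // expf_neq0 // gt_eqF.
pose P z := a * z.1 + b * z.2.
pose gam t := P (g t).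
have perp t : 0 <= t <= L -> a * ((g t).2 - (g 0).2) = b * ((g t).1 - (g 0).1).
  move=> tL; have := col _ _ _ I0 t1L tL => e.
  have -> : a * ((g t).2 - (g 0).2) = (((g t1).1 - (g 0).1) * ((g t).2 - (g 0).2)) / l.
    by rewrite /a; ring.
  by rewrite e /b; ring.
have perp2 s t : 0 <= s <= L -> 0 <= t <= L -> a * ((g s).2 - (g t).2) = b * ((g s).1 - (g t).1).
  by move=> /perp h1 /perp h2; lra.
have gam_dist s t : 0 <= s <= L -> 0 <= t <= L -> edist (g s) (g t) = `|gam s - gam t|.
  move=> sL tL; apply: edist_eqP; first exact: normr_ge0.
  rewrite real_normK ?num_real // /gam /P /esq.
  have := perp2 s t sL tL.
  set x := (g s).1 - (g t).1; set y := (g s).2 - (g t).2 => e.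
  have -> : a * (g s).1 + b * (g s).2 - (a * (g t).1 + b * (g t).2) = a * x + b * y.
    by rewrite /x /y; ring.
  have -> : (a * x + b * y) ^+ 2 = (a ^+ 2 + b ^+ 2) * (x ^+ 2 + y ^+ 2) - (a * y - b * x) ^+ 2.
    by ring.
  by rewrite ab1 e subrr expr0n /= subr0 mul1r.
have gam_lip s t : 0 <= s <= L -> 0 <= t <= L -> `|gam s - gam t| <= `|s - t|.
  by move=> sL tL; rewrite -gam_dist //; exact: gl.
have gam_dom s t : 0 <= s <= L -> 0 <= t <= L -> mdist (beta s) (beta t) <= `|gam s - gam t|.
  by move=> sL tL; rewrite -gam_dist //; exact: dom.
have gam_chords s t u v : 0 <= s -> s <= t -> t <= u -> u <= v -> v <= L ->
    exists a b : R, [/\ 0 <= a <= 1, 0 <= b <= 1 &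
      (1 - a) * gam s + a * gam u = (1 - b) * gam t + b * gam v].
  move=> h1 h2 h3 h4 h5; have [w [c c01 ->] [d d01 e]] := gch _ _ _ _ h1 h2 h3 h4 h5.
  exists c, d; split => //; have := congr1 P e; rewrite /gam /P /lerp /=; lra.
have gam_closed : gam 0 = gam L by rewrite /gam gc.
have absN (x y : R) : `|- x - - y| = `|x - y|.
  by rewrite (_ : - x - - y = y - x) 1?distrC //; ring.
have [m0 m0I m0min] := lipschitz_on_min (ltW L0) gam_lip.
have [|m1 m1I m1max] := @lipschitz_on_min R (fun t => - gam t) 0 L (ltW L0).
  by move=> x y xI yI; rewrite /= absN; exact: gam_lip.
have m1max' t : 0 <= t <= L -> gam t <= gam m1 by move=> /m1max; rewrite lerN2.
have /andP[m00 m0L] := m0I; have /andP[m10 m1L] := m1I.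
have [m01|/ltW m10'] := leP m0 m1.
  exact: (folded_line gs gam_dist gam_closed gam_lip gam_dom gam_chords m00 m01 m1L).
(* When the maximum comes before the minimum, the line is reversed. *)
apply: (@folded_line g (fun t => - gam t) gs _ _ _ _ _ m1 m0) => //.
- by move=> s t sL tL; rewrite gam_dist //= absN.
- by rewrite gam_closed.
- by move=> s t sL tL; rewrite /= absN; exact: gam_lip.
- by move=> s t sL tL; rewrite /= absN; exact: gam_dom.
- move=> s t u v h1 h2 h3 h4 h5; have [c [d [c1 d1 e]]] := gam_chords _ _ _ _ h1 h2 h3 h4 h5.
  by exists c, d; split => //; lra.
- by move=> t tL; rewrite lerN2; exact: m0min.
Qed.

End Folding.

(** * Convex curves *)

Section ContinuityCriteria.
Variables (R : realType) (X : metricType R).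
Implicit Types (a b : R) (f : R -> X).

Lemma within_continuousP f a b : {within `[a, b], continuous f} <->
  forall x, a <= x <= b -> forall e, 0 < e -> exists2 d : R, 0 < d &
    forall y, a <= y <= b -> `|x - y| < d -> mdist (f x) (f y) < e.
Proof.
split.
  move=> /subspace_continuousP fc x xab e e0.
  have /cvg_ballP/(_ e e0) : f @ within `[a, b] (nbhs x) --> f x.
    by apply: fc; rewrite /= in_itv.
  move=> /nbhs_ballP[d /= d0 h]; exists d => // y yab xy.
  by have := h y xy; rewrite /= in_itv /= yab ballEmdist; apply.
move=> H; apply/subspace_continuousP => x; rewrite /= in_itv /= => xab.
apply/cvg_ballP => e e0; have [d d0 h] := H x xab e e0.
apply/nbhs_ballP; exists d => //= y xy; rewrite in_itv /= => yab.
by rewrite ballEmdist; exact: h.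
Qed.

Lemma lipschitz_within_continuous f a b (K : R) :
  (forall s t, a <= s <= b -> a <= t <= b -> mdist (f s) (f t) <= K * `|s - t|) ->
  {within `[a, b], continuous f}.
Proof.
move=> fK; apply/within_continuousP => x xab e e0.
pose K' := `|K| + 1; have K'0 : 0 < K' by rewrite /K' ltr_wpDl.
exists (e / K'); first by rewrite divr_gt0.
move=> y yab; rewrite ltr_pdivlMr // => h.
apply: le_lt_trans (fK _ _ xab yab) _; apply: le_lt_trans h.
rewrite mulrC ler_wpM2l // /K'; apply: le_trans (ler_norm K) _; by rewrite lerDl.
Qed.

End ContinuityCriteria.

Lemma within_continuous_realP (R : realType) (f : R -> R) (a b : R) :
  {within `[a, b], continuous f} <->
  forall x, a <= x <= b -> forall e, 0 < e -> exists2 d : R, 0 < d &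
    forall y, a <= y <= b -> `|x - y| < d -> `|f x - f y| < e.
Proof.
split.
  move=> /subspace_continuousP fc x xab e e0.
  have /cvg_ballP/(_ e e0) : f @ within `[a, b] (nbhs x) --> f x.
    by apply: fc; rewrite /= in_itv.
  move=> /nbhs_ballP[d /= d0 h]; exists d => // y yab xy.
  by have := h y xy; rewrite /= in_itv /= yab; apply.
move=> H; apply/subspace_continuousP => x; rewrite /= in_itv /= => xab.
apply/cvg_ballP => e e0; have [d d0 h] := H x xab e e0.
apply/nbhs_ballP; exists d => //= y xy; rewrite in_itv /= => yab.
exact: h.
Qed.

Lemma lipschitz_IVT (R : realType) (f : R -> R) (a b K v : R) : a <= b ->
  (forall x y, a <= x <= b -> a <= y <= b -> `|f x - f y| <= K * `|x - y|) ->
  f a <= v <= f b \/ f b <= v <= f a ->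
  exists2 c, a <= c <= b & f c = v.
Proof.
move=> ab fK hv; have [||c] := @IVT R f a b v ab.
- apply/within_continuous_realP => x xab e e0.
  pose K' := `|K| + 1; have K'0 : 0 < K' by rewrite /K' ltr_wpDl.
  exists (e / K'); first by rewrite divr_gt0.
  move=> y yab; rewrite ltr_pdivlMr // => h.
  apply: le_lt_trans (fK _ _ xab yab) _; apply: le_lt_trans h.
  rewrite mulrC ler_wpM2l // /K'; apply: le_trans (ler_norm K) _; by rewrite lerDl.
- by case: hv => /andP[h1 h2]; rewrite ge_min le_max h1 h2 ?orbT.
- by rewrite in_itv /= => cab fc; exists c.
Qed.

Section ConvexCurve.
Variables (R : realType) (g : R -> euclid2 R) (L : R).
Hypotheses (L0 : 0 < L) (g_closed : g 0 = g L)
  (g_lip : forall s t, 0 <= s <= L -> 0 <= t <= L -> edist (g s) (g t) <= `|s - t|)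
  (g_chords : forall s t u v, 0 <= s -> s <= t -> t <= u -> u <= v -> v <= L ->
    cross4 (g s) (g t) (g u) (g v))
  (g_moves : forall s t, 0 <= s -> s < t -> t <= L -> exists2 u, s <= u <= t & g u <> g s)
  (g_noncollinear : ~ collinear L g).
Implicit Types (x y z w e : euclid2 R) (s t u v : R).

(** Twice the signed area of the triangle [o], [x], [y]. *)
Definition det3 o x y := (x.1 - o.1) * (y.2 - o.2) - (y.1 - o.1) * (x.2 - o.2).

Lemma det3_lerp o e x y t : det3 o e (lerp t x y) = (1 - t) * det3 o e x + t * det3 o e y.
Proof. by rewrite /det3 /lerp /=; ring. Qed.

Lemma det3_lip o e x y : `|det3 o e x - det3 o e y| <=
  (`|e.1 - o.1| + `|e.2 - o.2|) * edist x y.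
Proof.
have -> : det3 o e x - det3 o e y = (e.1 - o.1) * (x.2 - y.2) - (e.2 - o.2) * (x.1 - y.1).
  by rewrite /det3; ring.
apply: le_trans (ler_normB _ _) _; rewrite !normrM mulrDl.
by have [h1 h2] := abs_le_edist x y; rewrite lerD // ler_wpM2l.
Qed.

Lemma g_det_lip o e s t : 0 <= s <= L -> 0 <= t <= L ->
  `|det3 o e (g s) - det3 o e (g t)| <= (`|e.1 - o.1| + `|e.2 - o.2|) * `|s - t|.
Proof.
move=> sL tL; apply: le_trans (det3_lip _ _ _ _) _.
by rewrite ler_wpM2l ?addr_ge0 //; exact: g_lip.
Qed.

Definition star z := exists t s, [/\ 0 <= t <= 1, 0 <= s <= L & z = lerp t (g 0) (g s)].

Let I0 : 0 <= (0 : R) <= L. Proof. by rewrite lexx ltW. Qed.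

Lemma star_curve s : 0 <= s <= L -> star (g s).
Proof. by move=> sL; exists 1, s; rewrite lerp1 ler01 lexx. Qed.

Lemma star_origin z s : 0 <= s <= L -> seg (g 0) (g s) z -> star z.
Proof. by move=> sL [t t01 ->]; exists t, s. Qed.

Lemma collinear_triangle o x y z : det3 o x y = 0 -> seg x y z -> seg o x z \/ seg o y z.
Proof.
move=> d0 [k /andP[k0 k1] zE].
have [xo|xo] := pselect (x = o).
  right; exists k; first by rewrite k0.
  by rewrite zE xo.
have n0 : (x.1 - o.1) ^+ 2 + (x.2 - o.2) ^+ 2 != 0.
  apply/eqP => e; apply: xo; apply: ed0_eq; apply: edist_eqP => //.
  by rewrite /esq e expr0n.
pose S1 := x.1 - o.1; pose S2 := x.2 - o.2.
pose N := S1 ^+ 2 + S2 ^+ 2.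
(* In the coordinate of the line that is 0 at [o] and 1 at [x], the point [y] has [tau] and [z] has
   [v]. *)
pose tau := ((y.1 - o.1) * S1 + (y.2 - o.2) * S2) / N.
have y1 : y.1 - o.1 = tau * S1.
  have : (y.1 - o.1) * N = ((y.1 - o.1) * S1 + (y.2 - o.2) * S2) * S1 - S2 * det3 o x y.
    by rewrite /det3 /N /S1 /S2; ring.
  by rewrite d0 mulr0 subr0 /tau => h; rewrite mulrAC -h mulfK.
have y2 : y.2 - o.2 = tau * S2.
  have : (y.2 - o.2) * N = ((y.1 - o.1) * S1 + (y.2 - o.2) * S2) * S2 + S1 * det3 o x y.
    by rewrite /det3 /N /S1 /S2; ring.
  by rewrite d0 mulr0 addr0 /tau => h; rewrite mulrAC -h mulfK.
pose v := 1 - k + k * tau.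
have zx : z = lerp v o x.
  have e1 : y.1 = o.1 + tau * S1 by rewrite -y1; ring.
  have e2 : y.2 = o.2 + tau * S2 by rewrite -y2; ring.
  by rewrite zE /lerp e1 e2 /v /S1 /S2; congr pair; ring.
have zy c : v = c * tau -> z = lerp c o y.
  move=> vc; have e1 : y.1 = o.1 + tau * S1 by rewrite -y1; ring.
  have e2 : y.2 = o.2 + tau * S2 by rewrite -y2; ring.
  by rewrite zx /lerp e1 e2 vc /S1 /S2; congr pair; ring.
have [v0|v0] := ltP v 0.
  right; have t0 : tau < 0.
    rewrite ltNge; apply/negP => t0; have : 0 <= k * tau by rewrite mulr_ge0.
    by move: v0; rewrite /v; lra.
  exists (v / tau); last by apply: zy; rewrite divfK // lt_eqF.
  rewrite nmulr_lge0 ?invr_lt0 // (ltW v0) /= ler_ndivrMr // mul1r /v.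
  have : 0 <= (1 - k) * (1 - tau) by rewrite mulr_ge0; lra.
  lra.
have [v1|v1] := leP v 1; first by left; exists v; [rewrite v0|].
right; have t1 : 1 < tau.
  rewrite ltNge; apply/negP => t1; have : 0 <= k * (1 - tau) by rewrite mulr_ge0 // subr_ge0.
  by move: v1; rewrite /v; lra.
have t0 : 0 < tau by lra.
exists (v / tau); last by apply: zy; rewrite divfK // gt_eqF.
rewrite divr_ge0 ?(ltW t0) //= ler_pdivrMr // mul1r /v.
have : 0 <= (1 - k) * (tau - 1) by rewrite mulr_ge0; lra.
lra.
Qed.

(** By the intermediate value theorem some [g u] with [u] between [s] and [t] is in line with [g 0]
    and [z]; the chord from [g 0] to [g u] has to meet the one from [g s] to [g t], and unless [g 0]
    is in line with that chord it can do so only in [z]. *)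
Lemma chord_in_star s t z : 0 <= s -> s <= t -> t <= L -> seg (g s) (g t) z ->
  exists2 u, 0 <= u <= L & seg (g 0) (g u) z.
Proof.
move=> s0 st tL zst.
have sL : 0 <= s <= L by rewrite s0 (le_trans st).
have tL' : 0 <= t <= L by rewrite (le_trans s0).
have [d0|dN] := eqVneq (det3 (g 0) (g s) (g t)) 0.
  by have [h|h] := collinear_triangle d0 zst; [exists s|exists t].
have [k /andP[k0 k1] zE] := zst.
pose D := det3 (g 0) (g s) (g t).
pose h u := det3 (g 0) z (g u).
have hs : h s = - k * D by rewrite /h zE /D /det3 /lerp /=; ring.
have ht : h t = (1 - k) * D by rewrite /h zE /D /det3 /lerp /=; ring.
have [||u /andP[su ut] hu] := @lipschitz_IVT R h s t (`|z.1 - (g 0).1| + `|z.2 - (g 0).2|) 0 st.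
- move=> x y /andP[x1 x2] /andP[y1 y2]; apply: g_det_lip.
    by rewrite (le_trans s0 x1) (le_trans x2).
  by rewrite (le_trans s0 y1) (le_trans y2).
- rewrite hs ht; have [D0|D0] := leP 0 D; [left|right].
    by rewrite mulNr oppr_le0 !mulr_ge0 // subr_ge0.
  by rewrite mulNr oppr_ge0 mulr_ge0_le0 ?mulr_ge0_le0 ?subr_ge0 // ltW.
have [w [a a01 wE] [b b01 wE']] := g_chords (lexx 0) s0 su ut tL.
exists u; first by rewrite (le_trans s0 su) (le_trans ut).
have bk : b = k.
  have e1 : det3 (g 0) z w = 0.
    have hu' : det3 (g 0) z (g u) = 0 by exact: hu.
    have h0 : det3 (g 0) z (g 0) = 0 by rewrite /det3; ring.
    by rewrite wE det3_lerp hu' h0 !mulr0 addr0.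
  have : det3 (g 0) z w = (b - k) * det3 (g 0) (g s) (g t).
    by rewrite wE' zE /det3 /lerp /=; ring.
  rewrite e1 => /esym/eqP; rewrite mulf_eq0 (negPf dN) orbF subr_eq0.
  by move=> /eqP.
by exists a => //; rewrite -wE wE' bk.
Qed.

Lemma star_lerp x y c : star x -> star y -> 0 <= c <= 1 -> star (lerp c x y).
Proof.
move=> [a [s [a01 sL xE]]] [b [t [b01 tL yE]]] c01.
have /andP[s0 sL'] := sL; have /andP[t0 tL'] := tL.
(* The convex combination lies at [nu] on the segment from [g 0] to a point of the chord from [g s]
   to [g t]. *)
pose nu := (1 - c) * a + c * b.
have /andP[a0 a1] := a01; have /andP[b0 b1] := b01; have /andP[c0 c1] := c01.
have h1 : 0 <= (1 - c) * a by rewrite mulr_ge0 ?subr_ge0.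
have h2 : 0 <= c * b by rewrite mulr_ge0.
have nu01 : 0 <= nu <= 1 by exact: lerp_conv.
have [nu0|nuN] := eqVneq nu 0.
  exists 0, 0; split => //; first by rewrite lexx ler01.
  have -> : lerp c x y = lerp 0 (g 0) (g 0); last by [].
  have ca : (1 - c) * a = 0 by rewrite /nu in nu0; lra.
  have cb : c * b = 0 by rewrite /nu in nu0; lra.
  rewrite xE yE /lerp /=; congr pair.
    have -> : (1 - c) * ((1 - a) * (g 0).1 + a * (g s).1) + c * ((1 - b) * (g 0).1 + b * (g t).1)
      = (g 0).1 + ((1 - c) * a) * ((g s).1 - (g 0).1) + (c * b) * ((g t).1 - (g 0).1) by ring.
    by rewrite ca cb; ring.
  have -> : (1 - c) * ((1 - a) * (g 0).2 + a * (g s).2) + c * ((1 - b) * (g 0).2 + b * (g t).2)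
    = (g 0).2 + ((1 - c) * a) * ((g s).2 - (g 0).2) + (c * b) * ((g t).2 - (g 0).2) by ring.
  by rewrite ca cb; ring.
have nup : 0 < nu by rewrite lt_def nuN; case/andP: nu01.
pose m := lerp (c * b / nu) (g s) (g t).
have mE : lerp c x y = lerp nu (g 0) m.
  by rewrite xE yE /m /lerp /=; congr pair; rewrite /nu; field.
have mst : seg (g s) (g t) m.
  by exists (c * b / nu) => //; rewrite divr_ge0 ?(ltW nup) //= ler_pdivrMr // mul1r /nu lerDr.
have [u uL um] : exists2 u, 0 <= u <= L & seg (g 0) (g u) m.
  have [st|/ltW ts] := leP s t; first exact: (chord_in_star s0 st tL' mst).
  exact: (chord_in_star t0 ts sL' (segC mst)).
apply: (star_origin uL); rewrite mE.
by apply: seg_sub (segl _ _) um _; exists nu.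
Qed.

Lemma between_point o e z : det3 o e z = 0 -> e <> o ->
  (z.1 - o.1) * (e.1 - o.1) + (z.2 - o.2) * (e.2 - o.2) = 0 -> z = o.
Proof.
move=> h1 h2 h3.
have n0 : (e.1 - o.1) ^+ 2 + (e.2 - o.2) ^+ 2 != 0.
  apply/eqP => e0; apply: h2; apply: ed0_eq; apply: edist_eqP => //.
  by rewrite /esq e0 expr0n.
rewrite /det3 in h1.
have e1 : (z.1 - o.1) * ((e.1 - o.1) ^+ 2 + (e.2 - o.2) ^+ 2) = 0.
  have -> : (z.1 - o.1) * ((e.1 - o.1) ^+ 2 + (e.2 - o.2) ^+ 2) =
    ((z.1 - o.1) * (e.1 - o.1) + (z.2 - o.2) * (e.2 - o.2)) * (e.1 - o.1)
    - ((e.1 - o.1) * (z.2 - o.2) - (z.1 - o.1) * (e.2 - o.2)) * (e.2 - o.2) by ring.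
  by rewrite h1 h3 !mul0r subrr.
have e2 : (z.2 - o.2) * ((e.1 - o.1) ^+ 2 + (e.2 - o.2) ^+ 2) = 0.
  have -> : (z.2 - o.2) * ((e.1 - o.1) ^+ 2 + (e.2 - o.2) ^+ 2) =
    ((z.1 - o.1) * (e.1 - o.1) + (z.2 - o.2) * (e.2 - o.2)) * (e.2 - o.2)
    + ((e.1 - o.1) * (z.2 - o.2) - (z.1 - o.1) * (e.2 - o.2)) * (e.1 - o.1) by ring.
  by rewrite h1 h3 !mul0r addr0.
move/eqP: e1; rewrite mulf_eq0 (negPf n0) orbF subr_eq0 => /eqP e1.
move/eqP: e2; rewrite mulf_eq0 (negPf n0) orbF subr_eq0 => /eqP e2.
by case: z o e1 e2 {h1 h2 h3 n0} => [? ?] [? ?] /= -> ->.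
Qed.

(** Intermediate value theorem for the position along the line through [x] and [y]. *)
Lemma flat_arc s1 s2 x y z : 0 <= s1 -> s1 <= s2 -> s2 <= L -> x <> y ->
  g s1 = x /\ g s2 = y \/ g s1 = y /\ g s2 = x ->
  (forall u, s1 <= u <= s2 -> det3 x y (g u) = 0) -> seg x y z ->
  exists2 u, s1 <= u <= s2 & g u = z.
Proof.
move=> s10 s12 s2L xy ends flat [k /andP[k0 k1] zE].
pose f u := ((g u).1 - z.1) * (y.1 - x.1) + ((g u).2 - z.2) * (y.2 - x.2).
have fE u : f u - 0 = f u by rewrite subr0.
pose N := (y.1 - x.1) ^+ 2 + (y.2 - x.2) ^+ 2.
have N0 : 0 <= N by rewrite addr_ge0 ?sqr_ge0.
have fx : ((x.1 - z.1) * (y.1 - x.1) + (x.2 - z.2) * (y.2 - x.2)) = - k * N.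
  by rewrite zE /N /lerp /=; ring.
have fy : ((y.1 - z.1) * (y.1 - x.1) + (y.2 - z.2) * (y.2 - x.2)) = (1 - k) * N.
  by rewrite zE /N /lerp /=; ring.
have kN : - k * N <= 0 by rewrite mulNr oppr_le0 mulr_ge0.
have kN' : 0 <= (1 - k) * N by rewrite mulr_ge0 // subr_ge0.
have [||u us fu] := @lipschitz_IVT R f s1 s2 (`|y.1 - x.1| + `|y.2 - x.2|) 0 s12.
- move=> a b /andP[a1 a2] /andP[b1 b2].
  have aL : 0 <= a <= L by rewrite (le_trans s10 a1) (le_trans a2).
  have bL : 0 <= b <= L by rewrite (le_trans s10 b1) (le_trans b2).
  have -> : f a - f b = (y.1 - x.1) * ((g a).1 - (g b).1) + (y.2 - x.2) * ((g a).2 - (g b).2).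
    by rewrite /f; ring.
  apply: le_trans (ler_normD _ _) _; rewrite !normrM mulrDl.
  have [h1 h2] := abs_le_edist (g a) (g b); have h := g_lip aL bL.
  by rewrite lerD // ler_wpM2l // (le_trans _ h).
- by case: ends => [[e1 e2]|[e1 e2]]; [left|right]; rewrite /f e1 e2 fx fy kN kN'.
exists u => //.
have dz : det3 z y z = 0 by rewrite /det3 !subrr !mul0r mulr0 subrr.
have gu0 := flat _ us.
pose y' : euclid2 R := (z.1 + (y.1 - x.1), z.2 + (y.2 - x.2)).
apply: (@between_point z y').
- have -> : det3 z y' (g u) = det3 x y (g u) - det3 x y z.
    by rewrite /det3 /y' /=; ring.
  by rewrite gu0 zE /det3 /lerp /=; ring.
- move=> e; apply: xy; have := congr1 fst e; have := congr1 snd e; rewrite /y' /= => e2 e1.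
  have {}e1 : x.1 = y.1 by lra.
  have {}e2 : x.2 = y.2 by lra.
  by case: x y e1 e2 {ends flat zE f fE N N0 fx fy kN kN' fu gu0 y' e dz} => [? ?] [? ?] /= -> ->.
- have -> : y'.1 - z.1 = y.1 - x.1 by rewrite /y' /=; ring.
  by have -> : y'.2 - z.2 = y.2 - x.2 by rewrite /y' /=; ring.
Qed.

End ConvexCurve.

Lemma det3_parallel (R : realType) (o e x y : euclid2 R) : e <> o ->
  det3 o e x = 0 -> det3 o e y = 0 -> det3 o x y = 0.
Proof.
move=> eo h1 h2.
have n0 : (e.1 - o.1) ^+ 2 + (e.2 - o.2) ^+ 2 != 0.
  apply/eqP => e0; apply: eo; apply: ed0_eq; apply: edist_eqP => //.
  by rewrite /esq e0 expr0n.
apply: (mulfI n0); rewrite mulr0.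
have -> : ((e.1 - o.1) ^+ 2 + (e.2 - o.2) ^+ 2) * det3 o x y =
  det3 o e y * ((e.1 - o.1) * (x.1 - o.1) + (e.2 - o.2) * (x.2 - o.2))
  - det3 o e x * ((e.1 - o.1) * (y.1 - o.1) + (e.2 - o.2) * (y.2 - o.2)).
  by rewrite /det3; ring.
by rewrite h1 h2 !mul0r subrr.
Qed.

Lemma triangle_side_nbhs (R : realType) (o e f z : euclid2 R) (l : R) :
  det3 o e f != 0 -> 0 < l < 1 -> z = lerp l o e ->
  exists2 d : R, 0 < d & forall z', edist z z' < d -> 0 <= det3 o e z' / det3 o e f ->
  exists c k, [/\ 0 <= c <= 1, 0 <= k <= 1 & z' = lerp c o (lerp k e f)].
Proof.
move=> D0 /andP[l0 l1] zE.
pose D := det3 o e f.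
pose K := (`|e.1 - o.1| + `|e.2 - o.2| + (`|f.1 - o.1| + `|f.2 - o.2|)) / `|D| + 1.
have Dp : 0 < `|D| by rewrite normr_gt0.
have K0 : 0 < K by rewrite /K ltr_wpDl // divr_ge0 // !addr_ge0.
(* Below, [x] and [y] are the coordinates of [z'] with respect to [e - o] and [f - o]. They will be
   within [m] of [l] and 0, which keeps [x + y] between 0 and 1. *)
pose m := Num.min l ((1 - l) / 2).
have m0 : 0 < m by rewrite /m lt_min l0 divr_gt0 // subr_gt0.
have ml : m <= l by rewrite /m ge_min lexx.
have ml1 : m <= (1 - l) / 2 by rewrite /m ge_min lexx orbT.
exists (m / K); first by rewrite divr_gt0.
move=> z'; rewrite ltr_pdivlMr // mulrC => h y0.
pose x := - det3 o f z' / D; pose y := det3 o e z' / D.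
have bnd (w : euclid2 R) : `|w.1 - o.1| + `|w.2 - o.2| <=
    (`|e.1 - o.1| + `|e.2 - o.2| + (`|f.1 - o.1| + `|f.2 - o.2|)) ->
    `|(det3 o w z' - det3 o w z) / D| < m.
  move=> hw; apply: le_lt_trans h; rewrite normrM normfV ler_pdivrMr //.
  apply: le_trans (det3_lip _ _ _ _) _; rewrite edC mulrAC ler_wpM2r ?edist_ge0 //.
  rewrite /K mulrDl mul1r divfK ?gt_eqF //; apply: le_trans hw _; lra.
have hx : `|x - l| < m.
  rewrite -normrN.
  have -> : - (x - l) = (det3 o f z' - det3 o f z) / D.
    have -> : det3 o f z = - l * D by rewrite zE /D /det3 /lerp /=; ring.
    by rewrite /x; field.
  by apply: bnd; rewrite lerDr addr_ge0.
have hy : `|y| < m.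
  have -> : y = (det3 o e z' - det3 o e z) / D.
    have -> : det3 o e z = 0 by rewrite zE /det3 /lerp /=; ring.
    by rewrite subr0.
  by apply: bnd; rewrite lerDl addr_ge0.
have y0' : 0 <= y by exact: y0.
move: hx hy; rewrite !ltr_norml => /andP[x1 x2] /andP[y1 y2].
have xy0 : 0 < x + y by lra.
exists (x + y), (y / (x + y)); split.
- by apply/andP; split; lra.
- rewrite divr_ge0 ?(ltW xy0) //= ler_pdivrMr // mul1r; lra.
have -> : lerp (x + y) o (lerp (y / (x + y)) e f) =
  (o.1 + x * (e.1 - o.1) + y * (f.1 - o.1), o.2 + x * (e.2 - o.2) + y * (f.2 - o.2)).
  by rewrite /lerp /=; congr pair; field; rewrite gt_eqF.
rewrite [LHS]surjective_pairing; congr pair.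
  rewrite /x /y; have h1 : (z'.1 - o.1) * D = - det3 o f z' * (e.1 - o.1) + det3 o e z' * (f.1 - o.1).
    by rewrite /D /det3; ring.
  have -> : z'.1 = o.1 + (z'.1 - o.1) * D / D by rewrite mulfK //; ring.
  by rewrite h1; field.
rewrite /x /y; have h1 : (z'.2 - o.2) * D = - det3 o f z' * (e.2 - o.2) + det3 o e z' * (f.2 - o.2).
  by rewrite /D /det3; ring.
have -> : z'.2 = o.2 + (z'.2 - o.2) * D / D by rewrite mulfK //; ring.
by rewrite h1; field.
Qed.

(** * The region bounded by a convex curve *)

Section ConvexRegion.
Variables (R : realType) (g : R -> euclid2 R) (L : R).
Hypotheses (L0 : 0 < L) (g_closed : g 0 = g L)
  (g_lip : forall s t, 0 <= s <= L -> 0 <= t <= L -> edist (g s) (g t) <= `|s - t|)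
  (g_chords : forall s t u v, 0 <= s -> s <= t -> t <= u -> u <= v -> v <= L ->
    cross4 (g s) (g t) (g u) (g v)).
Implicit Types (x y z w e : euclid2 R) (s t u v : R).

Let I0 : 0 <= (0 : R) <= L. Proof. by rewrite lexx ltW. Qed.
Let IL : 0 <= L <= L. Proof. by rewrite lexx andbT ltW. Qed.

(** The point lies inside a chord from [g 0] to [g t]. On each of the two arcs some point is off the
    line of this chord, or else [flat_arc] would put [z] on the curve; since chords interlace, these
    two points are on opposite sides, and the triangles that they span with the chord cover a
    neighbourhood of [z]. *)
Lemma star_interior z : star g L z -> ~ (g @` `[0, L]) z ->
  exists2 d : R, 0 < d & forall z', edist z z' < d -> star g L z'.
Proof.
move=> [l [t [/andP[l0 l1] tL zE]]] zC.
have inC s : 0 <= s <= L -> g s <> z.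
  by move=> sL e; apply: zC; exists s => //=; rewrite in_itv.
have l0' : 0 < l.
  rewrite lt_def l0 andbT; apply/eqP => e; apply: (inC 0) => //.
  by rewrite zE e lerp0.
have l1' : l < 1.
  rewrite lt_def l1 andbT eq_sym; apply/eqP => e; apply: (inC t) => //.
  by rewrite zE e lerp1.
have xy : g 0 <> g t by move=> e; apply: (inC 0) => //; rewrite zE -e /lerp -mulrDl subrK mul1r
  -mulrDl subrK mul1r; case: (g 0).
have /andP[t0 tL'] := tL.
have zseg : seg (g 0) (g t) z by exists l; rewrite ?l0 ?l1.
pose sg u := det3 (g 0) (g t) (g u).
have [u /andP[u0 ut] su] : exists2 u, 0 <= u <= t & sg u != 0.
  apply: contrapT => no.
  have [|u /andP[u0 ut] gu] := @flat_arc R g L g_lip 0 t (g 0) (g t) z (lexx _) t0 tL' xy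
    (or_introl (conj erefl erefl)) _ zseg.
    move=> u uI; apply: contrapT => h; apply: no; exists u => //; exact/eqP.
  by apply: (inC u) => //; rewrite u0 (le_trans ut).
have [v /andP[tv vL] sv] : exists2 v, t <= v <= L & sg v != 0.
  apply: contrapT => no.
  have [|u0' /andP[tu uL] gu] := @flat_arc R g L g_lip t L (g 0) (g t) z t0 tL' (lexx _) xy
    (or_intror (conj erefl (esym g_closed))) _ zseg.
    move=> w wI; apply: contrapT => h; apply: no; exists w => //; exact/eqP.
  by apply: (inC u0') => //; rewrite (le_trans t0 tu).
have [w [a a01 wE] [b /andP[b0 b1] wE']] := g_chords (lexx 0) u0 ut tv vL.
have opp : (1 - b) * sg u + b * sg v = 0.
  rewrite -det3_lerp -wE' wE det3_lerp /det3; ring.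
have bN0 : b != 0 by apply/eqP => e; move: opp su; rewrite e subr0 mul1r mul0r addr0 => ->; rewrite eqxx.
have bN1 : b != 1 by apply/eqP => e; move: opp sv; rewrite e subrr mul1r mul0r add0r => ->; rewrite eqxx.
have b0' : 0 < b by rewrite lt_def bN0.
have b1' : b < 1 by rewrite lt_def eq_sym bN1.
have l01 : 0 < l < 1 by rewrite l0' l1'.
have uL : 0 <= u <= L by rewrite u0 (le_trans ut).
have vL' : 0 <= v <= L by rewrite vL andbT (le_trans t0).
have [d1 d10 h1] := triangle_side_nbhs su l01 zE.
have [d2 d20 h2] := triangle_side_nbhs sv l01 zE.
have tri s z' : 0 <= s <= L -> (exists c k, [/\ 0 <= c <= 1, 0 <= k <= 1 &
    z' = lerp c (g 0) (lerp k (g t) (g s))]) -> star g L z'.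
  move=> sL [c [k [c01 k01 ->]]].
  apply: (star_lerp L0 g_lip g_chords) => //; first exact: star_curve.
  by apply: (star_lerp L0 g_lip g_chords) => //; exact: star_curve.
exists (Num.min d1 d2); first by rewrite lt_min d10.
move=> z'; rewrite lt_min => /andP[zd1 zd2].
have [sz|/ltW sz] := leP 0 (det3 (g 0) (g t) z' / sg u).
  exact: (tri u) (h1 _ zd1 sz).
apply: (tri v) (h2 _ zd2 _) => //.
have -> : det3 (g 0) (g t) z' / sg v = - (det3 (g 0) (g t) z' / sg u) * (b / (1 - b)).
  have -> : sg u = - (b / (1 - b)) * sg v.
    have /(canRL (mulKf _)) -> : (1 - b) * sg u = - (b * sg v) by lra.
      by field; lra.
    by rewrite subr_eq0 eq_sym.
  by field; rewrite sv bN0 subr_eq0 eq_sym bN1.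
by rewrite mulr_ge0 ?oppr_ge0 // divr_ge0 // subr_ge0.
Qed.

Lemma star_closed z : (forall d, 0 < d -> exists2 w, star g L w & edist z w < d) -> star g L z.
Proof.
move=> H; have [U UU Uoo] := ultra_nat.
have n0 n : 0 < n.+1%:R^-1 :> R by rewrite invr_gt0 ltr0n.
have K n : exists ts : R * R, [/\ 0 <= ts.1 <= 1, 0 <= ts.2 <= L &
    edist z (lerp ts.1 (g 0) (g ts.2)) < n.+1%:R^-1].
  by have [w [t [s [h1 h2 ->]]] h3] := H _ (n0 n); exists (t, s).
have [ts tsP] := choice K.
have [t ht] : exists t : R, (fun n => (ts n).1) @ U --> t.
  by apply: (@ultra_cvg_bounded _ _ _ _ 0 1); apply: filterE => n /=; have [] := tsP n.
have [s hs] : exists s : R, (fun n => (ts n).2) @ U --> s.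
  by apply: (@ultra_cvg_bounded _ _ _ _ 0 L); apply: filterE => n /=; have [] := tsP n.
have t01 : 0 <= t <= 1.
  apply/andP; split; [apply: (ultra_le UU (cvg_cst 0) ht)|apply: (ultra_le UU ht (cvg_cst (1 : R)))];
  by apply: filterE => n /=; have [/andP[]] := tsP n.
have sL : 0 <= s <= L.
  apply/andP; split; [apply: (ultra_le UU (cvg_cst 0) hs)|apply: (ultra_le UU hs (cvg_cst L))];
  by apply: filterE => n /=; have [_ /andP[]] := tsP n.
exists t, s; split => //; apply: ed0_eq; apply/eqP; rewrite eq_le edist_ge0 andbT.
have ec (f : nat -> R) c : f @ U --> c -> (fun n => `|f n - c|) @ U --> 0.
  move=> fc; have : (fun n => `|f n - c|) @ U --> `|c - c|.
    by apply: cvg_norm; apply: cvgB => //; exact: cvg_cst.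
  by rewrite subrr normr0.
have err : (fun n => n.+1%:R^-1 + (L * `|(ts n).1 - t| + `|(ts n).2 - s|)) @ U --> 0.
  rewrite -[X in _ --> X](addr0 0); apply: cvgD.
    by move=> A /(@cvg_harmonic R); exact: Uoo.
  rewrite -[X in _ --> X](addr0 0); apply: cvgD; last exact: ec.
  by rewrite -(mulr0 L); apply: cvgM; [exact: cvg_cst|exact: ec].
apply: (ultra_le_err UU err) => n; rewrite add0r.
have [h1 h2 h3] := tsP n.
apply: le_trans (edtri (lerp (ts n).1 (g 0) (g (ts n).2)) _ _) _.
apply: lerD; first exact: ltW.
apply: le_trans (edtri (lerp t (g 0) (g (ts n).2)) _ _) _; apply: lerD.
  rewrite edist_lerp mulrC ler_wpM2r //.
  apply: le_trans (g_lip I0 h2) _; have /andP[q1 q2] := h2.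
  by rewrite sub0r normrN ger0_norm.
apply: le_trans (edist_lerp_le _ _ _ _ t01) _; rewrite edxx mulr0 add0r.
have /andP[q1 q2] := t01.
apply: le_trans (g_lip h2 sL); by rewrite ler_piMl ?edist_ge0.
Qed.

Lemma star_bounded z : star g L z -> edist (g 0) z <= L.
Proof.
move=> [t [s [/andP[t0 t1] sL ->]]]; rewrite edist_lerpl //.
apply: le_trans (ler_piMl (edist_ge0 _ _) t1) _.
apply: le_trans (g_lip I0 sL) _; have /andP[q1 q2] := sL.
by rewrite sub0r normrN ger0_norm.
Qed.

Lemma star_convex : convex_set (star g L).
Proof.
move=> x y l; rewrite !inE => xS yS.
have h : star g L (lerp (1 - l%:num) x y).
  apply: (star_lerp L0 g_lip g_chords) => //.
  by rewrite subr_ge0 lerBlDr lerDl; apply/andP; split.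
suff -> : conv l x y = lerp (1 - l%:num) x y by [].
by rewrite /lerp subKr; case: x y {xS yS h} => [? ?] [? ?].
Qed.

(** The star is closed, and it is open off the curve, so it contains each component of the
    complement that it meets. From a point outside the star, the ray away from [g 0] never meets it
    and leaves every ball. *)
Lemma star_region : star g L = region_bounded_by g 0 L.
Proof.
rewrite /region_bounded_by; set C := g @` `[0, L].
apply/seteqP; split=> z.
  move=> Sz; have [Cz|Cz] := pselect (C z); [by left|right; split => //].
  exists (L + edist (g 0) z + 1) => w [B [Bz BC Bc] Bw].
  suff BS : B `<=` star g L.
    rewrite ballEmdist /=; change (edist z w < L + edist (g 0) z + 1).
    have h1 := star_bounded (BS _ Bw); have := edtri (g 0) z w; rewrite (edC z (g 0)); lra.
  have <- : B `&` star g L = B; last by move=> ? [].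
  apply: Bc.
  - by exists z.
  - exists (star g L)°; first exact: open_interior.
    apply/seteqP; split=> x [Bx Sx]; split => //; last exact: interior_subset.
    have [d d0 h] := star_interior Sx (BC _ Bx).
    by apply/nbhs_ballP; exists d => //= y; rewrite ballEmdist; exact: h.
  - exists (star g L) => //; rewrite -[star g L]setCK; apply: open_closedC.
    rewrite openE => x Sx; apply/nbhs_ballP; apply: contrapT => no; apply: Sx.
    apply: star_closed => d d0; apply: contrapT => no'; apply: no; exists d => //= y.
    by rewrite ballEmdist /= => xy Sy; apply: no'; exists y.
case=> [[s]|[Cz [r hr]]].
  by rewrite /= in_itv /= => sL <-; exact: star_curve.
apply: contrapT => NSz.
pose o := g 0.
have oz : 0 < edist o z.
  rewrite lt_def edist_ge0 andbT; apply/eqP => /ed0_eq e; apply: NSz; rewrite -e; exact: star_curve.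
pose ray (k : R) : euclid2 R := lerp (1 + k) o z.
have rayN k : 0 <= k -> ~ star g L (ray k).
  move=> k0 Sr; apply: NSz.
  have k1 : 0 < 1 + k by lra.
  have -> : z = lerp (1 + k)^-1 o (ray k).
    rewrite /ray /lerp /= [LHS]surjective_pairing; congr pair; field; lra.
  apply: (star_lerp L0 g_lip g_chords) => //; first exact: star_curve.
  by rewrite invr_ge0 (ltW k1) invf_le1 //; lra.
pose T := (`|r| + 1) / edist o z.
have T0 : 0 <= T by rewrite divr_ge0 ?edist_ge0 ?addr_ge0.
have ray0 : ray 0 = z by rewrite /ray addr0 lerp1.
have inray : (connected_component (~` C) z) (ray T).
  exists (ray @` `[0, T]); last by exists T => //=; rewrite in_itv /= T0 lexx.
  split.
  - by exists 0 => //=; rewrite in_itv /= T0 lexx.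
  - move=> ? [k /=]; rewrite in_itv /= => /andP[k0 _] <- Ck; apply: (rayN k k0).
    by case: Ck => s /=; rewrite in_itv /= => sL <-; exact: star_curve.
  - apply: connected_continuous_connected; first exact: segment_connected.
    apply: (@lipschitz_within_continuous _ _ _ _ _ (edist o z)) => s t sT tT.
    change (edist (ray s) (ray t) <= edist o z * `|s - t|).
    by rewrite /ray edist_lerp mulrC (_ : 1 + s - (1 + t) = s - t) //; ring.
have := hr _ inray; rewrite ballEmdist /=; change (edist z (ray T) < r -> False).
rewrite -{1}ray0 /ray edist_lerp addr0.
rewrite (_ : 1 - (1 + T) = - T); last by ring.
rewrite normrN ger0_norm // /T divfK ?gt_eqF // => h.
have := ler_norm r; lra.
Qed.

Hypothesis g_moves : forall s t, 0 <= s -> s < t -> t <= L -> exists2 u, s <= u <= t & g u <> g s.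
Hypothesis g_noncollinear : ~ collinear L g.

(** A chord between the two arcs cut off by a double point [c] interlaces with the degenerate chord
    from [c] to [c], hence passes through [c]. Unless the double point is the closing one, both arcs
    leave [c], and all points of the curve are on one line. *)
Lemma convex_curve_simple s t : 0 <= s -> s < t -> t <= L -> g s = g t -> s = 0 /\ t = L.
Proof.
move=> s0 st tL gst; apply: contrapT => nst; apply: g_noncollinear.
pose c := g s.
have segcc m : seg c c m -> m = c.
  by move=> [k _ ->]; rewrite /lerp -mulrDl subrK mul1r -mulrDl subrK mul1r; case: (c).
have through v (w : R) : s <= v <= t -> 0 <= w <= L -> w <= s \/ t <= w -> det3 c (g v) (g w) = 0.
  move=> /andP[sv vt] /andP[w0 wL] hw.
  have [k _ cE] : seg (g v) (g w) c.
    case: hw => [ws|tw].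
      have [m m1 m2] := g_chords w0 ws sv vt tL.
      by rewrite -gst in m2; rewrite -(segcc _ m2); exact: segC.
    have [m m1 m2] := g_chords s0 sv vt tw wL.
    by rewrite -gst in m1; rewrite -(segcc _ m1).
  by rewrite cE /det3 /lerp /=; ring.
have [v0 v0I gv0] := g_moves s0 st tL.
have [w0 w0L [w0I gw0]] : exists2 w : R, 0 <= w <= L & (w <= s \/ t <= w) /\ g w <> c.
  have [s0'|s0'] := ltP 0 s.
    have [e|ne] := pselect (g 0 = c); last by exists 0 => //; split => //; left.
    have [|u /andP[u0 us] gu] := @g_moves 0 s (lexx _) s0'; first by lra.
    by exists u; [lra|split; [left|rewrite -e]].
  have sE : s = 0 by lra.
  have tL' : t < L.
    by rewrite lt_def tL andbT; apply/eqP => e; apply: nst; rewrite sE e.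
  have [|u /andP[u0 us] gu] := @g_moves t L _ tL' (lexx _); first lra.
  by exists u; [lra|split; [right|rewrite /c gst]].
have line u : 0 <= u <= L -> det3 c (g w0) (g u) = 0.
  move=> uL; have [us|us] := leP u s; last first.
    have [tu|tu] := leP t u; last first.
      have : det3 c (g u) (g w0) = 0 by apply: through => //; lra.
      by rewrite /det3; lra.
    apply: (@det3_parallel _ _ (g v0)) => //; apply: through => //; by right.
  by apply: (@det3_parallel _ _ (g v0)) => //; apply: through => //; left.
move=> x y z xL yL zL.
have h1 := det3_parallel gw0 (line _ xL) (line _ yL).
have h2 := det3_parallel gw0 (line _ xL) (line _ zL).
have h3 := det3_parallel gw0 (line _ yL) (line _ zL).
move: h1 h2 h3; rewrite /det3; lra.
Qed.

Lemma convex_curve_simple_closed : simple_closed_curve g 0 L.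
Proof.
split; last exact: convex_curve_simple.
split => //; split; first exact: ltW.
by apply: (@lipschitz_within_continuous _ _ _ _ _ 1) => s t sL tL; rewrite mul1r; exact: g_lip.
Qed.

End ConvexRegion.

(** * Length of curves *)

Section Length.
Variables (R : realType) (X : metricType R).
Implicit Types (g h : R -> X) (f : R -> R) (a b c x y : R) (s t : R) (p q : seq R).

Fixpoint polygon_length g a p : R :=
  if p is x :: p' then mdist (g a) (g x) + polygon_length g x p' else 0.

Lemma polygonal_lengthE g a b p : polygonal_length g a b p = polygon_length g a p.
Proof.
rewrite /polygonal_length; elim: p a => [|x p IH] a /=; first by rewrite big_nil.
by rewrite big_nat_recl //= -IH.
Qed.

Lemma path_le_last a p : path <=%R a p -> a <= last a p.
Proof. by elim: p a => //= x p IH a /andP[ax /IH h]; exact: le_trans ax h. Qed.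

Lemma path_ltW a p : path <%R a p -> path <=%R a p.
Proof. by elim: p a => //= x p IH a /andP[/ltW -> /IH]. Qed.

(* Nondecreasing sequences are closed under inserting a point, unlike partitions. *)
Lemma polygon_length_strict g a p : path <=%R a p -> exists q,
  [/\ path <%R a q, last a q = last a p & polygon_length g a q = polygon_length g a p].
Proof.
elim: p a => [|x p IH] a /=; first by exists [::].
move=> /andP[ax /IH[q [h1 h2 h3]]].
have [e|ne] := eqVneq a x; first by exists q; rewrite e mdistxx add0r.
by exists (x :: q) => /=; rewrite lt_neqAle ne ax h1 h2 h3.
Qed.

Lemma polygon_le_length g a b p : path <=%R a p -> last a p = b ->
  ((polygon_length g a p)%:E <= curve_length g a b)%E.
Proof.
move=> pp pb; have [q [q1 q2 <-]] := polygon_length_strict g pp.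
apply: ereal_sup_ubound; exists q; last by rewrite polygonal_lengthE.
by split => //; rewrite q2 pb.
Qed.

Lemma length_le_bound g a b (M : \bar R) :
  (forall p, path <%R a p -> last a p = b -> ((polygon_length g a p)%:E <= M)%E) ->
  (curve_length g a b <= M)%E.
Proof.
move=> H; apply: ge_ereal_sup => _ [p [p1 /eqP p2] <-].
by rewrite polygonal_lengthE; exact: H.
Qed.

Lemma polygon_le_potential g f a b p :
  (forall s t, a <= s -> s <= t -> t <= b -> mdist (g s) (g t) <= f t - f s) ->
  path <=%R a p -> last a p = b -> polygon_length g a p <= f b - f a.
Proof.
elim: p a => [|x p IH] a H /=; first by move=> _ <-; rewrite subrr.
move=> /andP[ax pp] pb; have xb : x <= b by rewrite -pb; exact: path_le_last.
have h1 : polygon_length g x p <= f b - f x.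
  by apply: IH => // s t s1 s2 s3; apply: H => //; exact: le_trans s1.
have := H _ _ (lexx a) ax xb; lra.
Qed.

Lemma length_le_potential g f a b :
  (forall s t, a <= s -> s <= t -> t <= b -> mdist (g s) (g t) <= f t - f s) ->
  (curve_length g a b <= (f b - f a)%:E)%E.
Proof.
move=> H; apply: length_le_bound => p pp pb; rewrite lee_fin.
by apply: polygon_le_potential pb => //; exact: path_ltW.
Qed.

Lemma length_ge0 g a b : a <= b -> (0 <= curve_length g a b)%E.
Proof.
move=> ab; apply: le_trans (@polygon_le_length g a b [:: b] _ _) => //=.
  by rewrite lee_fin addr0 mdist_ge0.
by rewrite ab.
Qed.

Lemma polygon_length_cat g a p q :
  polygon_length g a (p ++ q) = polygon_length g a p + polygon_length g (last a p) q.
Proof. by elim: p a => [|x p IH] a /=; rewrite ?add0r // IH addrA. Qed.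

Lemma polygon_length_insert g a c b p : a <= c -> c <= b -> path <=%R a p -> last a p = b ->
  exists p1 p2, [/\ path <=%R a p1, last a p1 = c, path <=%R c p2, last c p2 = b &
    polygon_length g a p <= polygon_length g a p1 + polygon_length g c p2].
Proof.
elim: p a => [|x p IH] a ac cb /=.
  move=> _ ab; have ca : c = a by apply/eqP; rewrite eq_le ac ab cb.
  by exists [::], [::]; split => //; rewrite ?ca //= addr0.
move=> /andP[ax pp] pb; have [cx|/ltW xc] := leP c x.
  exists [:: c], (x :: p); split => //=; first by rewrite ac.
    by rewrite cx.
  by rewrite addr0 addrA lerD2r metric_triangle.
have [p1 [p2 [h1 h2 h3 h4 h5]]] := IH x xc cb pp pb.
by exists (x :: p1), p2; split => //=; rewrite ?ax // -addrA lerD2l.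
Qed.

Section Rectifiable.
Variables (g : R -> X) (a b : R).
Hypotheses (ab : a <= b) (g_rect : (curve_length g a b < +oo)%E).

Lemma length_mono s t : a <= s -> s <= t -> t <= b ->
  (curve_length g s t <= curve_length g a b)%E.
Proof.
move=> as_ st tb; apply: length_le_bound => p pp pt.
apply: le_trans (@polygon_le_length g a b (s :: p ++ [:: b]) _ _).
- rewrite lee_fin /= polygon_length_cat /= addr0.
  have := mdist_ge0 (g a) (g s); have := mdist_ge0 (g (last s p)) (g b); lra.
- by rewrite /= as_ cat_path path_ltW //= pt tb.
- by rewrite /= last_cat.
Qed.

Definition len s t := fine (curve_length g s t).

Lemma lenE s t : a <= s -> s <= t -> t <= b -> curve_length g s t = (len s t)%:E.
Proof.
move=> as_ st tb; rewrite /len fineK // ge0_fin_numE ?length_ge0 //.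
exact: le_lt_trans (length_mono as_ st tb) g_rect.
Qed.

Lemma len_ge s t p : a <= s -> s <= t -> t <= b -> path <=%R s p -> last s p = t ->
  polygon_length g s p <= len s t.
Proof.
by move=> as_ st tb pp pt; rewrite -lee_fin -lenE //; exact: polygon_le_length.
Qed.

Lemma len_le s t (M : R) : a <= s -> s <= t -> t <= b ->
  (forall p, path <%R s p -> last s p = t -> polygon_length g s p <= M) -> len s t <= M.
Proof.
move=> as_ st tb H; rewrite -lee_fin -lenE //; apply: length_le_bound => p pp pt.
by rewrite lee_fin; exact: H.
Qed.

Lemma len_approx s t (e : R) : a <= s -> s <= t -> t <= b -> 0 < e ->
  exists p, [/\ path <%R s p, last s p = t & len s t - e < polygon_length g s p].
Proof.
move=> as_ st tb e0; apply: contrapT => no.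
suff : len s t <= len s t - e by lra.
apply: len_le => // p pp pt; rewrite leNgt; apply/negP => h; apply: no; by exists p.
Qed.

Lemma mdist_le_len s t : a <= s -> s <= t -> t <= b -> mdist (g s) (g t) <= len s t.
Proof.
move=> as_ st tb; have := @len_ge s t [:: t] as_ st tb; rewrite /= addr0 st.
exact.
Qed.

Lemma len_ge0 s t : a <= s -> s <= t -> t <= b -> 0 <= len s t.
Proof. by move=> as_ st tb; apply: le_trans (mdist_ge0 _ _) (mdist_le_len as_ st tb). Qed.

Lemma len_cat s t c : a <= s -> s <= t -> t <= c -> c <= b -> len s c = len s t + len t c.
Proof.
move=> as_ st tc cb; have sc := le_trans st tc.
have at_ := le_trans as_ st; have tb := le_trans tc cb.
apply/eqP; rewrite eq_le; apply/andP; split.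
  apply: len_le => // p /path_ltW pp pc.
  have [p1 [p2 [h1 h2 h3 h4 h5]]] := polygon_length_insert g st tc pp pc.
  by apply: le_trans h5 _; apply: lerD; exact: len_ge.
rewrite -lerBrDr; apply: len_le => // p pp pt.
rewrite lerBrDr addrC -lerBrDr; apply: len_le => // q pq qc.
rewrite lerBrDr addrC -[X in _ + polygon_length g X _]pt -polygon_length_cat.
apply: len_ge => //; last by rewrite last_cat pt.
by rewrite cat_path path_ltW //= pt path_ltW.
Qed.

Lemma len_xx s : a <= s -> s <= b -> len s s = 0.
Proof. by move=> as_ sb; have := len_cat as_ (lexx s) (lexx s) sb; lra. Qed.

(** A polygon that is optimal up to [e] stays so when a vertex is inserted on its first edge; along
    that edge the length therefore exceeds the chord by at most [e]. *)
Lemma len_right s (e : R) : a <= s -> s < b -> 0 < e -> exists x, [/\ s < x, x <= b &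
  forall t, s <= t -> t <= x -> len s t <= mdist (g s) (g t) + e].
Proof.
move=> as_ sb e0; have [p [pp pb h]] := len_approx as_ (ltW sb) (lexx b) e0.
case: p pp pb h => [|x p] /=; first by move=> _ h; move: sb; rewrite h ltxx.
move=> /andP[sx pp] pb h.
have xb : x <= b by rewrite -pb; exact/path_le_last/path_ltW.
exists x; split => // t st tx; have tb := le_trans tx xb.
have at_ := le_trans as_ st.
have h1 := len_cat as_ st tb (lexx b).
have h2 : polygon_length g t (x :: p) <= len t b by apply: len_ge => //=; rewrite tx path_ltW.
move: h2 => /=; have := metric_triangle (g s) (g t) (g x); lra.
Qed.

(** The counterpart at the last edge, which is reached by induction on the list. *)
Lemma polygon_length_left c t p : a <= c -> c < t -> t <= b -> path <%R c p -> last c p = t ->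
  exists x, [/\ c <= x, x < t & forall s, x <= s -> s <= t ->
    polygon_length g c p <= len c s + mdist (g s) (g t)].
Proof.
elim: p c => [|x p IH] c ac ct tb /=; first by move=> _ e; move: ct; rewrite e ltxx.
move=> /andP[cx pp] pt; have xt : x <= t by rewrite -pt; exact/path_le_last/path_ltW.
case: p pp pt IH => [|y p] pp pt IH.
  exists c; split => // s cs st /=; rewrite addr0 [x]pt.
  apply: le_trans (metric_triangle _ (g s) _) _; rewrite lerD2r.
  by apply: mdist_le_len => //; exact: le_trans st tb.
have xt' : x < t.
  have /andP[xy pp'] : (x < y) && path <%R y p := pp.
  apply: lt_le_trans xy _; rewrite -pt; exact/path_le_last/path_ltW.
have ax := le_trans ac (ltW cx).
have [z [z1 z2 z3]] := IH x ax xt' tb pp pt.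
exists z; split => //; first exact: le_trans (ltW cx) z1.
move=> s zs st; have h := z3 s zs st.
have sb := le_trans st tb; have xs := le_trans z1 zs.
have h1 := len_cat ac (ltW cx) xs sb.
have h2 := mdist_le_len ac (ltW cx) (le_trans xs sb).
move: h; set P := polygon_length g x _ => h; lra.
Qed.

Lemma len_left t (e : R) : a < t -> t <= b -> 0 < e -> exists x, [/\ a <= x, x < t &
  forall s, x <= s -> s <= t -> len s t <= mdist (g s) (g t) + e].
Proof.
move=> at_ tb e0; have [p [pp pt h]] := len_approx (lexx a) (ltW at_) tb e0.
have [x [x1 x2 x3]] := polygon_length_left (lexx a) at_ tb pp pt.
exists x; split => // s xs st; have h1 := x3 s xs st.
have h2 := len_cat (lexx a) (le_trans x1 xs) st tb; lra.
Qed.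

Hypothesis g_cont : {within `[a, b], continuous g}.

Lemma len_continuous : {within `[a, b], continuous (len a)}.
Proof.
apply/within_continuous_realP => t tab e e0; have /andP[at_ tb] := tab.
have e2 : 0 < e / 2 by rewrite divr_gt0.
have [d d0 hd] := (within_continuousP g a b).1 g_cont t tab _ e2.
have [d1 d10 h1] : exists2 d1 : R, 0 < d1 & forall s, t <= s -> s <= b -> s - t < d1 ->
    len t s <= mdist (g t) (g s) + e / 2.
  have [bt|tb'] := leP b t.
    exists 1 => // s ts sb _; have -> : s = t by lra.
    by rewrite len_xx // mdistxx add0r ltW.
  have [x [x1 x2 x3]] := len_right at_ tb' e2.
  by exists (x - t); [rewrite subr_gt0|move=> s ts sb h; apply: x3 => //; lra].
have [d2 d20 h2] : exists2 d2 : R, 0 < d2 & forall s, a <= s -> s <= t -> t - s < d2 ->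
    len s t <= mdist (g s) (g t) + e / 2.
  have [ta|at'] := leP t a.
    exists 1 => // s ts sb _; have -> : s = t by lra.
    by rewrite len_xx // mdistxx add0r ltW.
  have [x [x1 x2 x3]] := len_left at' tb e2.
  by exists (t - x); [rewrite subr_gt0|move=> s ts sb h; apply: x3 => //; lra].
exists (Num.min d (Num.min d1 d2)); first by rewrite !lt_min d0 d10.
move=> s /andP[as_ sb]; rewrite !lt_min => /and3P[hs hs1 hs2].
have h := hd s _ hs; rewrite as_ sb in h; have {}h := h isT.
have [ts|/ltW st] := leP t s.
  rewrite (len_cat (lexx a) at_ ts sb) opprD addrA subrr add0r normrN.
  rewrite ger0_norm ?len_ge0 //.
  have := h1 s ts sb; move: hs1; rewrite distrC ger0_norm ?subr_ge0 // => -> /(_ isT); lra.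
rewrite (len_cat (lexx a) as_ st tb) addrC addKr.
rewrite ger0_norm ?len_ge0 //.
have := h2 s as_ st; move: hs2; rewrite ger0_norm ?subr_ge0 // => -> /(_ isT).
rewrite (metric_sym (g s)); lra.
Qed.

Theorem arclength_parametrization : exists (beta : R -> X) (L : R), [/\ 0 <= L,
  forall s t, 0 <= s <= L -> 0 <= t <= L -> mdist (beta s) (beta t) <= `|s - t|,
  (forall (s t : R) (f : R -> R), 0 <= s -> s <= t -> t <= L ->
    (forall u v, s <= u -> u <= v -> v <= t -> mdist (beta u) (beta v) <= f v - f u) ->
    t - s <= f t - f s) &
  reparametrization g a b beta 0 L].
Proof.
pose th := len a; pose L := len a b.
have th0 : th a = 0 by exact: len_xx.
have thD s t : a <= s -> s <= t -> t <= b -> th t - th s = len s t.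
  by move=> h1 h2 h3; rewrite /th (len_cat (lexx a) h1 h2 h3) addrC addKr.
have thmono s t : a <= s -> s <= t -> t <= b -> th s <= th t.
  by move=> h1 h2 h3; rewrite -subr_ge0 thD // len_ge0.
have L0 : 0 <= L by exact: len_ge0.
have inv s : exists t, 0 <= s <= L -> a <= t <= b /\ th t = s.
  have [sL|] := pselect (0 <= s <= L); last by exists 0.
  have /andP[s0 s1] := sL.
  have [||t] := @IVT R th a b s ab; first exact: len_continuous.
    by rewrite th0 ge_min le_max s0 s1 orbT.
  by rewrite in_itv /= => tab tht; exists t.
(* A right inverse of the length may jump where [g] is constant; [tauK] shows this to be harmless,
   since parameters with the same length have the same image. *)
have [tau tauP] := choice inv.
have lip1 s t : a <= s -> s <= t -> t <= b -> mdist (g s) (g t) <= `|th s - th t|.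
  move=> h1 h2 h3; rewrite distrC ger0_norm ?thD ?len_ge0 //; exact: mdist_le_len.
have lip s t : a <= s <= b -> a <= t <= b -> mdist (g s) (g t) <= `|th s - th t|.
  move=> /andP[s1 s2] /andP[t1 t2]; have [st|/ltW ts] := leP s t; first exact: lip1.
  by rewrite metric_sym distrC; exact: lip1.
have tauK t : a <= t <= b -> g (tau (th t)) = g t.
  move=> tab; have /andP[t1 t2] := tab.
  have thL : 0 <= th t <= L by rewrite -th0 !thmono // lexx.
  have [h1 h2] := tauP _ thL.
  apply: mdist_positivity; apply/eqP; rewrite eq_le mdist_ge0 andbT.
  by apply: le_trans (lip _ _ h1 tab) _; rewrite h2 subrr normr0.
exists (g \o tau), L; split => //.
- move=> s t sL tL /=; have [h1 h2] := tauP _ sL; have [h3 h4] := tauP _ tL.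
  by apply: le_trans (lip _ _ h1 h3) _; rewrite h2 h4.
- move=> s t f s0 st tL H.
  have [->|sNt] := eqVneq s t; first by rewrite !subrr.
  have sL : 0 <= s <= L by rewrite s0 (le_trans st).
  have tL' : 0 <= t <= L by rewrite tL andbT (le_trans s0).
  have [h1 h2] := tauP _ sL; have [h3 h4] := tauP _ tL'.
  have /andP[s1 s2] := h1; have /andP[t1 t2] := h3.
  have st' : tau s <= tau t.
    rewrite leNgt; apply/negP => /ltW h; have := thmono _ _ t1 h s2; rewrite h2 h4 => ts.
    by move: sNt; rewrite eq_le st ts.
  have e : t - s = len (tau s) (tau t) by rewrite -thD // h2 h4.
  rewrite e; apply: len_le => // p pp pt.
  have -> : f t - f s = f (th (tau t)) - f (th (tau s)) by rewrite h2 h4.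
  apply: (@polygon_le_potential g (f \o th) _ _ p _ _ pt); last exact: path_ltW.
  move=> u v su uv vt.
  have au := le_trans s1 su; have vb := le_trans vt t2.
  rewrite -(tauK u) ?au ?(le_trans uv) // -(tauK v) ?vb ?(le_trans au) // /=.
  apply: H; [rewrite -h2|  |rewrite -h4]; apply: thmono => //.
    exact: le_trans uv _.
  by exact: le_trans au _.
- exists th; split => //; first exact: len_continuous.
    move=> s t; rewrite !in_itv /= => /andP[s1 s2] /andP[t1 t2] st; exact: thmono.
  by move=> t; rewrite in_itv /= => tab; rewrite tauK.
Qed.

End Rectifiable.

End Length.

Lemma length_le_dominated (R : realType) (X Y : metricType R) (g : R -> X) (h : R -> Y) (a b : R) :
  (forall s t, a <= s -> s <= t -> t <= b -> mdist (h s) (h t) <= mdist (g s) (g t)) ->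
  (curve_length h a b <= curve_length g a b)%E.
Proof.
move=> H; apply: length_le_bound => p pp pb.
apply: le_trans (polygon_le_length g (path_ltW pp) pb); rewrite lee_fin.
elim: p a H pp pb => [|x p IH] a H //= /andP[ax pp] pb.
have xb : x <= b by rewrite -pb; exact/path_le_last/path_ltW.
apply: lerD; first by apply: H => //; exact: ltW.
by apply: IH => // s t xs; apply: H; apply: le_trans xs; exact: ltW.
Qed.

(** * Change of the starting point *)

Section Rotation.
Variables (R : realType) (L c : R).
Hypotheses (c0 : 0 <= c) (cL : c <= L).
Implicit Types (s t u v : R).

(** The new starting point is [g (L - c)]; if the curve is closed, the two branches agree at
    [t = c]. *)
Definition rotate (T : Type) (g : R -> T) t := if t <= c then g (t + (L - c)) else g (t - c).

Lemma rotateL (T : Type) (g : R -> T) t : t <= c -> rotate g t = g (t + (L - c)).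
Proof. by rewrite /rotate => ->. Qed.

Lemma rotateR (T : Type) (g : R -> T) t : g 0 = g L -> c <= t -> rotate g t = g (t - c).
Proof.
move=> gc ct; rewrite /rotate; have [tc|//] := leP t c.
have -> : t = c by lra.
by rewrite addrC subrK subrr gc.
Qed.

Lemma rotate_closed (T : Type) (g : R -> T) : g 0 = g L -> rotate g 0 = rotate g L.
Proof. by move=> gc; rewrite rotateL // rotateR // add0r. Qed.

Lemma rotate_lipschitz (X : metricType R) (g : R -> X) : g 0 = g L ->
  (forall s t, 0 <= s <= L -> 0 <= t <= L -> mdist (g s) (g t) <= `|s - t|) ->
  forall s t, 0 <= s <= L -> 0 <= t <= L -> mdist (rotate g s) (rotate g t) <= `|s - t|.
Proof.
move=> gc gl.
have [p1 p2] := conj c0 cL.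
have le s t : 0 <= s -> s <= t -> t <= L -> mdist (rotate g s) (rotate g t) <= t - s.
  move=> s0 st tL.
  have gl' u v : 0 <= u -> u <= v -> v <= L -> mdist (g u) (g v) <= v - u.
    move=> u0 uv vL; apply: le_trans (gl _ _ _ _) _; [lra|lra|].
    by rewrite distrC ger0_norm // subr_ge0.
  have [tc|/ltW ct] := leP t c.
    rewrite !rotateL ?(le_trans st) //; apply: le_trans (gl' _ _ _ _ _) _; lra.
  have [cs|/ltW sc] := leP c s.
    rewrite !rotateR //; apply: le_trans (gl' _ _ _ _ _) _; lra.
  rewrite rotateL // rotateR //; apply: le_trans (metric_triangle _ (g L) _) _.
  rewrite -{2}gc; have := gl' (s + (L - c)) L; have := gl' 0 (t - c) => h1 h2.
  by apply: (@le_trans _ _ ((L - (s + (L - c))) + (t - c - 0))); [apply: lerD; [apply: h2|apply: h1]|]; lra.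
move=> s t /andP[s0 sL] /andP[t0 tL]; have [st|/ltW ts] := leP s t.
  by rewrite distrC ger0_norm ?subr_ge0 //; exact: le.
by rewrite metric_sym ger0_norm ?subr_ge0 //; exact: le.
Qed.

Lemma rotate_arclength (X : metricType R) (g : R -> X) : g 0 = g L ->
  (forall (s t : R) (f : R -> R), 0 <= s -> s <= t -> t <= L ->
    (forall u v, s <= u -> u <= v -> v <= t -> mdist (g u) (g v) <= f v - f u) ->
    t - s <= f t - f s) ->
  forall (s t : R) (f : R -> R), 0 <= s -> s <= t -> t <= L ->
    (forall u v, s <= u -> u <= v -> v <= t -> mdist (rotate g u) (rotate g v) <= f v - f u) ->
    t - s <= f t - f s.
Proof.
move=> gc al.
have [p1 p2] := conj c0 cL.
have left s t (f : R -> R) : 0 <= s -> s <= t -> t <= c ->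
    (forall u v, s <= u -> u <= v -> v <= t -> mdist (rotate g u) (rotate g v) <= f v - f u) ->
    t - s <= f t - f s.
  move=> s0 st tc H.
  have := al (s + (L - c)) (t + (L - c)) (fun u => f (u - (L - c))).
  rewrite !addrK => h; suff : t + (L - c) - (s + (L - c)) <= f t - f s by lra.
  apply: h; [lra|lra|lra|] => u v u1 uv v1.
  have hu := rotateL g (_ : u - (L - c) <= c); have hv := rotateL g (_ : v - (L - c) <= c).
  rewrite !subrK in hu hv; rewrite -hu -?hv; [|lra..].
  by apply: H; lra.
have right s t (f : R -> R) : c <= s -> s <= t -> t <= L ->
    (forall u v, s <= u -> u <= v -> v <= t -> mdist (rotate g u) (rotate g v) <= f v - f u) ->
    t - s <= f t - f s.
  move=> s0 st tL H.
  have := al (s - c) (t - c) (fun u => f (u + c)).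
  rewrite !subrK => h; suff : t - c - (s - c) <= f t - f s by lra.
  apply: h; [lra|lra|lra|] => u v u1 uv v1.
  have hu := rotateR gc (_ : c <= u + c); have hv := rotateR gc (_ : c <= v + c).
  rewrite !addrK in hu hv; rewrite -hu -?hv; [|lra..].
  by apply: H; lra.
move=> s t f s0 st tL H.
have [tc|/ltW ct] := leP t c; first exact: left.
have [cs|/ltW sc] := leP c s; first exact: right.
have h1 : c - s <= f c - f s by apply: left => // u v u1 uv vc; apply: H => //; exact: le_trans vc ct.
have h2 : t - c <= f t - f c by apply: right => // u v u1 uv vc; apply: H => //; exact: le_trans sc u1.
lra.
Qed.

Lemma rotate_chords (g : R -> euclid2 R) : g 0 = g L ->
  (forall s t u v, 0 <= s -> s <= t -> t <= u -> u <= v -> v <= L ->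
    cross4 (g s) (g t) (g u) (g v)) ->
  forall s t u v, 0 <= s -> s <= t -> t <= u -> u <= v -> v <= L ->
    cross4 (rotate g s) (rotate g t) (rotate g u) (rotate g v).
Proof.
move=> gc ch s t u v s0 st tu uv vL; have [p1 p2] := conj c0 cL.
have [vc|/ltW cv] := leP v c; first by rewrite !rotateL; [apply: ch|..]; lra.
rewrite (rotateR gc cv).
have [uc|/ltW cu] := leP u c.
  by rewrite !rotateL; [apply: cross4C; apply: ch|..]; lra.
rewrite (rotateR gc cu).
have [tc|/ltW ct] := leP t c.
  by rewrite !rotateL; [do 2 apply: cross4C; apply: ch|..]; lra.
rewrite (rotateR gc ct).
have [sc|/ltW cs] := leP s c.
  by rewrite !rotateL; [do 3 apply: cross4C; apply: ch|..]; lra.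
rewrite (rotateR gc cs); apply: ch; lra.
Qed.

Lemma rotate_onto (T : Type) (g : R -> T) t : g 0 = g L -> 0 <= t <= L ->
  exists2 s, 0 <= s <= L & rotate g s = g t.
Proof.
move=> gc /andP[t0 tL]; have [p1 p2] := conj c0 cL.
have [tc|/ltW ct] := leP t (L - c).
  by exists (t + c); [lra|rewrite rotateR ?addrK //; lra].
by exists (t - (L - c)); [lra|rewrite rotateL ?subrK //; lra].
Qed.

Lemma rotate_antipodal (X : metricType R) (g : R -> X) (d : R) s : g 0 = g L ->
  0 <= s -> s <= L / 2 -> d <= mdist (rotate g s) (rotate g (s + L / 2)) ->
  exists s', [/\ 0 <= s', s' <= L / 2 & d <= mdist (g s') (g (s' + L / 2))].
Proof.
move=> gc s0 sL; have [p1 p2] := conj c0 cL.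
have [sc|/ltW cs] := leP (s + L / 2) c.
  rewrite !rotateL; [|lra..]; exists (s + (L - c)); split; [lra|lra|].
  by rewrite addrAC.
rewrite [rotate g (s + L / 2)]rotateR //.
have [sc|/ltW cs'] := leP s c.
  rewrite rotateL // metric_sym; exists (s + L / 2 - c); split; [lra|lra|].
  by rewrite (_ : s + L / 2 - c + L / 2 = s + (L - c)) //; field.
rewrite rotateR //; exists (s - c); split; [lra|lra|].
by rewrite addrAC.
Qed.

End Rotation.

Lemma rotateK (R : realType) (L c : R) (T : Type) (g : R -> T) t : 0 <= c -> c <= L ->
  g 0 = g L -> 0 <= t <= L -> rotate L (L - c) (rotate L c g) t = g t.
Proof.
move=> c0 cL gc /andP[t0 tL].
have [tc|/ltW ct] := leP t (L - c).
  by rewrite rotateL // subKr rotateR ?addrK //; lra.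
rewrite rotateR //; last exact: rotate_closed.
by rewrite rotateL ?subrK //; lra.
Qed.

(** * Majorization *)

Section ArcLengthCurve.
Variables (R : realType) (X : metricType R).
Hypotheses (geoX : geodesic_space X) (catX : CAT0 X).
Variables (beta : R -> X) (L : R).
Hypotheses (beta_closed : beta 0 = beta L)
  (beta_lip : forall s t, 0 <= s <= L -> 0 <= t <= L -> mdist (beta s) (beta t) <= `|s - t|)
  (beta_arclength : forall (s t : R) (f : R -> R), 0 <= s -> s <= t -> t <= L ->
    (forall u v, s <= u -> u <= v -> v <= t -> mdist (beta u) (beta v) <= f v - f u) ->
    t - s <= f t - f s).
Implicit Types (s t u v : R) (z w : euclid2 R).

(** Since [beta] is 1-Lipschitz and closed, both arcs between two such points are geodesics, and in
    a CAT(0) space they coincide: [beta] runs forth and back. *)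
Definition antipodal_pair := exists s : R,
  [/\ 0 <= s, s <= L / 2 & L / 2 <= mdist (beta s) (beta (s + L / 2))].

Let lip s t : 0 <= s -> s <= t -> t <= L -> mdist (beta s) (beta t) <= t - s.
Proof.
move=> s0 st tL; apply: le_trans (beta_lip _ _) _; [lra|lra|].
by rewrite distrC ger0_norm // subr_ge0.
Qed.

Let lip_around s t : 0 <= s -> s <= t -> t <= L -> mdist (beta s) (beta t) <= L - t + s.
Proof.
move=> s0 st tL; rewrite metric_sym.
apply: le_trans (metric_triangle _ (beta L) _) _.
have p1 := lip (le_trans s0 st) tL (lexx _); rewrite -{2}beta_closed.
have p2 := lip (lexx _) s0 (le_trans st tL); lra.
Qed.

(* Comparison in the cone at beta 0: geodesics from beta 0 to beta m and backwards to
   beta (m + L / 2) that together are a geodesic near beta 0 make up a geodesic. *)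
Lemma geodesic_through m e : 0 < m -> m < L / 2 -> 0 < e -> e <= m -> e <= L / 2 - m ->
  m <= mdist (beta 0) (beta m) -> L / 2 - m <= mdist (beta 0) (beta (m + L / 2)) ->
  2 * e <= mdist (beta e) (beta (L - e)) ->
  L / 2 <= mdist (beta m) (beta (m + L / 2)).
Proof.
move=> m0 mL e0 em eL h1 h2 h3.
pose A := m; pose B := L / 2 - m.
have A0 : 0 < A by []. have B0 : 0 < B by rewrite subr_gt0.
have k1 : mdist (beta 0) (beta m) <= m by have := @lip 0 m; rewrite subr0; apply; lra.
have k2 : mdist (beta 0) (beta (m + L / 2)) <= B.
  apply: le_trans (lip_around _ _ _) _; rewrite /B; lra.
have dA : mdist (beta 0) (beta m) = A by apply/eqP; rewrite eq_le k1.
have dB : mdist (beta 0) (beta (m + L / 2)) = B by apply/eqP; rewrite eq_le k2.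
have u01 : 0 <= e / A <= 1 by rewrite divr_ge0 ?(ltW e0) ?(ltW A0) //= ler_pdivrMr // mul1r.
have v01 : 0 <= e / B <= 1 by rewrite divr_ge0 ?(ltW e0) ?(ltW B0) //= ler_pdivrMr // mul1r.
have xE : beta e = geo geoX (beta 0) (beta m) (e / A).
  have l1 : mdist (beta 0) (beta e) <= e by have := @lip 0 e; rewrite subr0; apply; lra.
  have l2 : mdist (beta e) (beta m) <= m - e by apply: lip; lra.
  have l3 := metric_triangle (beta 0) (beta e) (beta m).
  apply: geo_unique => //; rewrite dA ?mulrBl ?mul1r divfK ?gt_eqF // /A; lra.
have yE : beta (L - e) = geo geoX (beta 0) (beta (m + L / 2)) (e / B).
  have l1 : mdist (beta 0) (beta (L - e)) <= e.
    apply: le_trans (lip_around _ _ _) _; lra.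
  have l2 : mdist (beta (L - e)) (beta (m + L / 2)) <= L / 2 - m - e.
    rewrite metric_sym; apply: le_trans (lip _ _ _) _; lra.
  have l3 := metric_triangle (beta 0) (beta (L - e)) (beta (m + L / 2)).
  apply: geo_unique => //; rewrite dB ?mulrBl ?mul1r divfK ?gt_eqF // /B; lra.
set D := mdist (beta m) (beta (m + L / 2)).
have D0 : 0 <= D by exact: mdist_ge0.
have := geo_cone geoX catX (beta 0) (beta m) (beta (m + L / 2)) u01 v01.
rewrite -xE -yE dA dB -/D => H.
have H2 : (2 * e) ^+ 2 <= mdist (beta e) (beta (L - e)) ^+ 2.
  by rewrite ler_sqr ?nnegrE ?mdist_ge0 // mulr_ge0 // ltW.
have {H H2} := le_trans H2 H.
(* For the planar triangle with sides [A], [B], [D], this is the squared distance of the points at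
   distance [e] from the apex on its two sides. That it is at least the square of [2 * e] means that
   the angle is straight, that is, [A + B <= D]. *)
have -> : e / A * (e / A - e / B) * A ^+ 2 + e / B * (e / B - e / A) * B ^+ 2
    + e / A * (e / B) * D ^+ 2 = e ^+ 2 / (A * B) * (D ^+ 2 - (A - B) ^+ 2).
  by field; rewrite !gt_eqF.
have -> : (2 * e) ^+ 2 = e ^+ 2 / (A * B) * (4 * (A * B)) by field; rewrite !gt_eqF.
rewrite ler_pM2l; last by rewrite divr_gt0 ?exprn_gt0 // mulr_gt0.
move=> H; have {H} : (A + B) ^+ 2 <= D ^+ 2 by lra.
rewrite ler_sqr ?nnegrE //; last by rewrite addr_ge0 // ltW.
rewrite /A /B; lra.
Qed.

Lemma antipodal_of_fold m : 0 < L -> m <= mdist (beta 0) (beta m) ->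
  L / 2 - m <= mdist (beta 0) (beta (m + L / 2)) -> m = 0 \/ m = L / 2 -> antipodal_pair.
Proof.
move=> L0 h1 h2 h; exists 0; rewrite add0r; split; [by []|lra|].
by case: h h1 h2 => -> h1 h2; rewrite ?subr0 ?add0r in h1 h2.
Qed.

End ArcLengthCurve.

Lemma rotate_majorant (R : realType) (X : metricType R) (beta : R -> X) (L c : R) g F :
  0 <= c -> c <= L -> beta 0 = beta L ->
  majorant (rotate L c beta) L g F -> majorant beta L (rotate L (L - c) g) F.
Proof.
move=> c0 cL bc [gc gl gch Fl Fg].
have c0' : 0 <= L - c by rewrite subr_ge0.
have cL' : L - c <= L by lra.
split => //.
- exact: rotate_closed.
- exact: (@rotate_lipschitz R L (L - c) c0' cL' (euclid2 R)).
- exact: rotate_chords.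
- move=> t tL; rewrite -[RHS](rotateK c0 cL bc tL) /rotate.
  by case: ifP => h; rewrite Fg //; lra.
Qed.

Section Dichotomy.
Variables (R : realType) (X : metricType R).
Hypotheses (geoX : geodesic_space X) (catX : CAT0 X).
Variables (beta : R -> X) (L : R).
Hypotheses (L0 : 0 < L) (beta_closed : beta 0 = beta L)
  (beta_lip : forall s t, 0 <= s <= L -> 0 <= t <= L -> mdist (beta s) (beta t) <= `|s - t|)
  (beta_arclength : forall (s t : R) (f : R -> R), 0 <= s -> s <= t -> t <= L ->
    (forall u v, s <= u -> u <= v -> v <= t -> mdist (beta u) (beta v) <= f v - f u) ->
    t - s <= f t - f s).
Implicit Types (s t u v : R) (z w : euclid2 R).

(* A collinear majorant makes the curve geodesic on both sides of its starting point; when this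
   happens for two starting points, the curve is a geodesic run forth and back. *)
Theorem antipodal_or_majorant : antipodal_pair beta L \/
  exists g F, majorant beta L g F /\ ~ collinear L g.
Proof.
have p := L0.
have [g [F [gM gS]]] := majorant_exists geoX catX L0 beta_closed beta_lip.
have [gC|] := pselect (collinear L g); last by right; exists g, F.
have [m [m0 mL h1 h2]] := collinear_fold L0 beta_closed beta_arclength gM gS gC.
have [me|mN] := pselect (m = 0 \/ m = L / 2).
  by left; exact: antipodal_of_fold h1 h2 me.
have {}m0 : 0 < m by rewrite lt_def m0 andbT; apply/eqP => e; apply: mN; left.
have {}mL : m < L / 2 by rewrite lt_def mL andbT; apply/eqP => e; apply: mN; right.
(* The new starting point is [beta (m / 2)], inside the geodesic from [beta 0] to [beta m]. *)
pose c := L - m / 2.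
have c0 : 0 <= c by rewrite /c; lra.
have cL : c <= L by rewrite /c; lra.
pose beta' := rotate L c beta.
have bc' : beta' 0 = beta' L by exact: rotate_closed.
have bl' := rotate_lipschitz c0 cL beta_closed beta_lip.
have ba' := rotate_arclength c0 cL beta_closed beta_arclength.
have anti : antipodal_pair beta' L -> antipodal_pair beta L.
  by move=> [s [s0 sL h]]; exact: (rotate_antipodal c0 cL beta_closed s0 sL h).
have [g' [F' [gM' gS']]] := majorant_exists geoX catX L0 bc' bl'.
have [gC'|gN] := pselect (collinear L g'); last first.
  right; exists (rotate L (L - c) g'), F'; split; first exact: rotate_majorant.
  have gc' := mj_closed gM'; have c0' : 0 <= L - c by rewrite subr_ge0.
  have cL' : L - c <= L by lra.
  move=> gC'; apply: gN => s t u sL tL uL.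
  have [s' s'L <-] := rotate_onto c0' cL' gc' sL.
  have [t' t'L <-] := rotate_onto c0' cL' gc' tL.
  have [u' u'L <-] := rotate_onto c0' cL' gc' uL.
  exact: gC'.
left; apply: anti.
have [m' [m'0 m'L h1' h2']] := collinear_fold L0 bc' ba' gM' gS' gC'.
have [me|mN'] := pselect (m' = 0 \/ m' = L / 2).
  exact: antipodal_of_fold h1' h2' me.
have {}m'0 : 0 < m' by rewrite lt_def m'0 andbT; apply/eqP => e; apply: mN'; left.
have {}m'L : m' < L / 2 by rewrite lt_def m'L andbT; apply/eqP => e; apply: mN'; right.
(* The bound [m / 2] keeps [beta (m / 2 - e)] and [beta (m / 2 + e)] on the geodesic from [beta 0]
   to [beta m], so they are [2 * e] apart; the other two bounds are those of [geodesic_through]. *)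
pose e := Num.min (m / 2) (Num.min m' (L / 2 - m')).
have e0 : 0 < e by rewrite !lt_min m'0 subr_gt0 m'L; lra.
have em : e <= m / 2 by rewrite /e ge_min lexx.
have em' : e <= m' by rewrite /e !ge_min lexx !orbT.
have eL' : e <= L / 2 - m' by rewrite /e !ge_min lexx !orbT.
exists m'; split; [exact: ltW|exact: ltW|].
apply: (geodesic_through geoX catX bc' bl' m'0 m'L e0 em' eL' h1' h2').
have -> : beta' e = beta (m / 2 + e).
  by rewrite /beta' rotateL /c; [congr beta; ring|lra].
have -> : beta' (L - e) = beta (m / 2 - e).
  by rewrite /beta' rotateR // /c; [congr beta; ring|lra].
have lip s t : 0 <= s -> s <= t -> t <= L -> mdist (beta s) (beta t) <= t - s.
  move=> s0 st tL; apply: le_trans (beta_lip _ _) _; [lra|lra|].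
  by rewrite distrC ger0_norm // subr_ge0.
have l1 : mdist (beta 0) (beta (m / 2 - e)) <= m / 2 - e - 0 by apply: lip; lra.
have l2 : mdist (beta (m / 2 + e)) (beta m) <= m - (m / 2 + e) by apply: lip; lra.
have l3 := metric_triangle (beta 0) (beta (m / 2 - e)) (beta m).
have l4 := metric_triangle (beta (m / 2 - e)) (beta (m / 2 + e)) (beta m).
rewrite metric_sym; lra.
Qed.

End Dichotomy.

(** * From majorants and antipodal pairs to convex figures *)

Section Conclusion.
Variables (R : realType) (X : metricType R).
Hypotheses (geoX : geodesic_space X) (catX : CAT0 X).
Variables (alpha : R -> X) (a b : R) (beta : R -> X) (L : R).
Hypotheses (alpha_closed : closed_curve alpha a b) (L_ge0 : 0 <= L)
  (beta_lip : forall s t, 0 <= s <= L -> 0 <= t <= L -> mdist (beta s) (beta t) <= `|s - t|)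
  (beta_arclength : forall (s t : R) (f : R -> R), 0 <= s -> s <= t -> t <= L ->
    (forall u v, s <= u -> u <= v -> v <= t -> mdist (beta u) (beta v) <= f v - f u) ->
    t - s <= f t - f s)
  (beta_repar : reparametrization alpha a b beta 0 L)
  (beta_closed : beta 0 = beta L).
Implicit Types (s t u v : R) (z w : euclid2 R).

(** Lengths are preserved because the inequalities form a circle: [F] does not increase length, an
    arc of [g] has length at most [t - s], and arc length parametrization of [beta] bounds the
    length of its image below by [t - s]. *)
Lemma majorant_majorizes g F : 0 < L -> majorant beta L g F -> ~ collinear L g ->
  majorizes (star g L) alpha a b.
Proof.
move=> L0 [gc gl gch Fl Fg] gN.
have mono s t : 0 <= s -> s <= t -> t <= L -> edist (g s) (g t) <= t - s.
  move=> s0 st tL; apply: le_trans (gl _ _ _ _) _; [lra|lra|].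
  by rewrite distrC ger0_norm // subr_ge0.
have len_g s t : 0 <= s -> s <= t -> t <= L -> (curve_length g s t <= (t - s)%:E)%E.
  move=> s0 st tL; apply: (@length_le_potential _ _ g id) => u v u0 uv vt.
  by apply: mono => //; [exact: le_trans u0|exact: le_trans vt _].
have len_F s t : (curve_length (F \o g) s t <= curve_length g s t)%E.
  by apply: length_le_dominated => u v _ _ _; exact: Fl.
have gm s t : 0 <= s -> s < t -> t <= L -> exists2 u, s <= u <= t & g u <> g s.
  move=> s0 st tL; apply: contrapT => no.
  have gE u : s <= u <= t -> g u = g s.
    by move=> ust; apply: contrapT => h; apply: no; exists u.
  have := @beta_arclength s t (fun=> 0) s0 (ltW st) tL; rewrite subrr => H.
  suff : t - s <= 0 by lra.
  apply: H => u v su uv vt; rewrite -!Fg; [|lra..].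
  by rewrite !gE ?mdistxx; lra.
exists g, 0, L, F; split; last first.
  have [theta [tc tm ta tb tE]] := beta_repar.
  exists theta; split => // t tab; rewrite tE //= Fg //.
  have := tab; rewrite in_itv /= => /andP[at_ tb'].
  have abab : a <= b by exact: le_trans tb'.
  have aI : a \in `[a, b] by rewrite in_itv /= lexx.
  have bI : b \in `[a, b] by rewrite in_itv /= lexx andbT.
  by rewrite -[X in X <= _ <= _]ta -[X in _ <= _ <= X]tb !tm.
split.
- exact: convex_curve_simple_closed.
- apply: le_lt_trans (len_g _ _ (lexx _) L_ge0 (lexx _)) _; exact: ltry.
- exact: star_region.
- by move=> h u v _ _; apply: length_le_dominated => s t _ _ _; exact: Fl.
- move=> s t s0 st tL; apply/eqP; rewrite eq_le len_F /=.
  apply: le_trans (len_g _ _ s0 st tL) _.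
  have fin : (curve_length (F \o g) s t < +oo)%E.
    by apply: le_lt_trans (len_F _ _) _; apply: le_lt_trans (len_g _ _ s0 st tL) _; exact: ltry.
  rewrite (lenE fin (lexx _) st (lexx _)) lee_fin.
  have := @beta_arclength s t (len (F \o g) s) s0 st tL.
  rewrite (len_xx fin (lexx _) st) subr0; apply=> u v su uv vt.
  have us := le_trans s0 su; have vL := le_trans vt tL.
  rewrite -(Fg u) ?us ?(le_trans uv) // -(Fg v) ?vL ?(le_trans us) //.
  rewrite (len_cat fin (lexx _) su uv vt) addrC addKr.
  exact: (mdist_le_len fin).
Qed.

Lemma segment_convex (x y : euclid2 R) : convex_set (segment x y).
Proof.
move=> z w l; rewrite !inE => -[s s01 zE] [t t01 wE].
have l01 : 0 <= (1 - l%:num : R) <= 1.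
  by rewrite subr_ge0 lerBlDr lerDl; apply/andP; split.
have lE k : (1 - k) *: x + k *: y = lerp k x y by [].
exists ((1 - (1 - l%:num)) * s + (1 - l%:num) * t); first exact: lerp_conv.
have -> : conv l z w = lerp (1 - l%:num) z w.
  by rewrite /lerp subKr; case: z w {zE wE} => [? ?] [? ?].
by rewrite lE zE wE !lE lerp_lerp.
Qed.

(** Every [beta u] lies between the antipodal points [p] and [q] at distance [phi u] from [p], hence
    on the geodesic that [F] follows; [g] records this distance on a segment of length [L / 2]. *)
Lemma antipodal_degenerate : antipodal_pair beta L -> exists D : set (euclid2 R),
  convex_set D /\ degenerately_majorizes D alpha a b.
Proof.
move=> [s0 [s00 s0L hd]].
have lip s t : 0 <= s -> s <= t -> t <= L -> mdist (beta s) (beta t) <= t - s.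
  move=> s1 st tL; apply: le_trans (beta_lip _ _) _; [lra|lra|].
  by rewrite distrC ger0_norm // subr_ge0.
have lip_around s t : 0 <= s -> s <= t -> t <= L -> mdist (beta s) (beta t) <= L - t + s.
  move=> s1 st tL; rewrite metric_sym.
  apply: le_trans (metric_triangle _ (beta L) _) _.
  have p1 := lip _ _ (le_trans s1 st) tL (lexx _); rewrite -{2}beta_closed.
  have p2 := lip _ _ (lexx _) s1 (le_trans st tL); lra.
pose p := beta s0; pose q := beta (s0 + L / 2).
have pL := L_ge0.
have dpq : mdist p q = L / 2.
  apply/eqP; rewrite eq_le hd andbT /p /q; apply: le_trans (lip _ _ _ _ _) _; lra.
pose phi u := mdist p (beta u).
have phiq u : 0 <= u <= L -> mdist (beta u) q = L / 2 - phi u.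
  move=> /andP[u0 uL]; apply/eqP; rewrite eq_le; apply/andP; split; last first.
    by rewrite -dpq lerBlDl metric_triangle.
  rewrite lerBrDl /phi /p /q.
  have [us|/ltW su] := leP u s0.
    rewrite metric_sym.
    have h1 := @lip u s0 u0 us _; have h2 := @lip_around u (s0 + L / 2) u0 _ _.
    apply: le_trans (lerD (h1 _) (h2 _ _)) _; lra.
  have [us|/ltW su'] := leP u (s0 + L / 2).
    have h1 := @lip s0 u s00 su uL; have h2 := @lip u (s0 + L / 2) u0 us _.
    apply: le_trans (lerD h1 (h2 _)) _; lra.
  have h1 := @lip_around s0 u s00 su uL; have h2 := @lip (s0 + L / 2) u _ su' uL.
  rewrite (metric_sym (beta u)); apply: le_trans (lerD h1 (h2 _)) _; lra.
have phi0 u : 0 <= phi u by exact: mdist_ge0.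
have phiL u : 0 <= u <= L -> phi u <= L / 2.
  by move=> uL; have := mdist_ge0 (beta u) q; rewrite phiq // subr_ge0.
have phi_lip s t : mdist (beta s) (beta t) >= `|phi s - phi t|.
  have h1 := metric_triangle p (beta s) (beta t); have h2 := metric_triangle p (beta t) (beta s).
  rewrite (metric_sym (beta t)) in h2; rewrite ler_norml /phi; lra.
have [theta [tc tm ta tb tE]] := beta_repar.
have [ab [_ ac] aab] := alpha_closed.
have thI t : a <= t <= b -> 0 <= theta t <= L.
  move=> /andP[h1 h2]; rewrite -[X in X <= _ <= _]ta -[X in _ <= _ <= X]tb.
  by rewrite !tm // in_itv /= ?lexx ?h1 ?h2 ?(ltW ab).
have onto u : 0 <= u <= L -> exists2 t, a <= t <= b & theta t = u.
  move=> /andP[u0 uL]; have [|t] := @IVT R theta a b u (ltW ab) tc.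
    by rewrite ta tb ge_min le_max u0 uL orbT.
  by rewrite in_itv /= => tab tht; exists t.
pose x : euclid2 R := (0, 0); pose y : euclid2 R := (L / 2, 0).
pose g t : euclid2 R := (phi (theta t), 0).
pose F z := geo geoX p q (z.1 / (L / 2)).
have edist0 (r r' : R) : edist (r, 0) (r', 0) = `|r - r'|.
  by rewrite /Defs.edist /= subrr expr0n addr0 sqrtr_sqr.
have L2 : 0 <= L / 2 by rewrite divr_ge0.
have dxy : mdist x y = L / 2.
  by rewrite mdistE2 edist0 sub0r normrN ger0_norm.
(* For [L = 0] the quotient is 0, which is right because [r] is then 0 too. *)
have divK r : 0 <= r -> r <= L / 2 -> 0 <= r / (L / 2) <= 1 /\ r / (L / 2) * (L / 2) = r.
  move=> r0 rL; have [LE|LN] := eqVneq (L / 2) 0.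
    rewrite LE invr0 !mulr0 lexx ler01; split => //.
    by apply/eqP; rewrite eq_le r0 -LE rL.
  have Lp : 0 < L / 2 by rewrite lt_def LN.
  by rewrite divr_ge0 //= ler_pdivrMr // mul1r divfK.
have segP z : segment x y z -> [/\ 0 <= z.1, z.1 <= L / 2 & z.2 = 0].
  move=> [k /andP[k0 k1] ->]; split => /=.
  - by rewrite scaler0 add0r mulr_ge0.
  - by rewrite scaler0 add0r ler_piMl.
  - by rewrite !scaler0 addr0.
have Psegm (r : R) : 0 <= r -> r <= L / 2 -> segment x y (r, 0).
  move=> r0 rL; have [k1 k2] := divK r r0 rL; exists (r / (L / 2)) => //.
  by congr pair; rewrite /= ?scaler0 ?addr0 ?add0r //; rewrite -[LHS]k2.
have phi_s0 u : s0 <= u <= s0 + L / 2 -> phi u = u - s0.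
  move=> /andP[h1 h2]; have uL : 0 <= u <= L by lra.
  have k1 := @lip s0 u s00 h1 _; have k2 := @lip u (s0 + L / 2) _ h2 _.
  have := phiq _ uL; rewrite -/q in k2 *; rewrite -/p -/(phi u) in k1.
  have := k1 _; have := k2 _ _; lra.
exists (segment x y); split; first exact: segment_convex.
exists x, y, g, F; split => //.
- split; last first.
    apply/seteqP; split => z.
      move=> [t /=]; rewrite in_itv /= => tab <-.
      by apply: Psegm; [exact: phi0|exact/phiL/thI].
    move=> /segP[z0 zL z2].
    have [|t tab tE'] := onto (s0 + z.1); first by lra.
    exists t; first by rewrite /= in_itv.
    rewrite /g tE' phi_s0; last by lra.
    by rewrite addrC addKr; case: z z2 {z0 zL tE'} => ? ? /= ->.
  split => //; last by rewrite /g ta tb /phi beta_closed.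
  split; first exact: ltW.
  apply/within_continuousP => t tab e e0.
  have [d d0 h] := (within_continuousP _ _ _).1 ac t tab e e0.
  exists d => // t' tab' tt'; apply: le_lt_trans (h _ tab' tt').
  change (edist (g t) (g t') <= mdist (alpha t) (alpha t')).
  by rewrite edist0 !tE ?in_itv //; exact: phi_lip.
- rewrite dxy; have -> : 2 * (L / 2) = theta b - theta a by rewrite ta tb; field.
  apply/eqP; rewrite eq_le; apply/andP; split.
    apply: length_le_potential => s t as_ st tb'.
    change (edist (g s) (g t) <= theta t - theta s).
    rewrite edist0; apply: le_trans (phi_lip _ _) _.
    have sI : a <= s <= b by rewrite as_ (le_trans st).
    have tI : a <= t <= b by rewrite tb' andbT (le_trans as_).
    have /andP[th1 _] := thI _ sI; have /andP[_ th2] := thI _ tI.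
    by apply: lip => //; apply: tm.
  have [LE|LN] := eqVneq L 0.
    by rewrite ta tb LE subrr; exact/length_ge0/ltW.
  have Lp : 0 < L by rewrite lt_def LN.
  (* The polygon through the two ends of the segment, reached at [t0] and [t1], already has length
     [L]; the order of [t0] and [t1] comes from [0 < L]. *)
  have [|t0 t0I e1] := onto s0; first by lra.
  have [|t1 t1I e2] := onto (s0 + L / 2); first by lra.
  have t01 : t0 <= t1.
    rewrite leNgt; apply/negP => /ltW h; have := tm t1 t0 _ _ h; rewrite !in_itv /= e1 e2.
    move=> /(_ t1I t0I); have := Lp; lra.
  have /andP[t0a _] := t0I; have /andP[_ t1b] := t1I.
  apply: le_trans (@polygon_le_length _ _ g a b [:: t0; t1; b] _ _) => //; last first.
    by rewrite /= t0a t01 t1b.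
  rewrite lee_fin /= addr0.
  change (theta b - theta a <= edist (g a) (g t0) + (edist (g t0) (g t1) + edist (g t1) (g b))).
  rewrite !edist0 ta tb e1 e2.
  have -> : phi s0 = 0 by exact: mdistxx.
  have -> : phi (s0 + L / 2) = L / 2 by exact: dpq.
  have -> : phi L = phi 0 by rewrite /phi beta_closed.
  have k1 := ler_norm (phi 0 - 0); have k2 := ler_norm (L / 2 - phi 0).
  have k3 : `|0 - L / 2| = L / 2 by rewrite sub0r normrN ger0_norm.
  rewrite k3; lra.
- move=> z w /segP[z0 zL z2] /segP[w0 wL w2].
  have [k1 k2] := divK _ z0 zL; have [k3 k4] := divK _ w0 wL.
  rewrite /F mdist_geo // dpq mdistE2 -[X in _ * X = _](ger0_norm L2) -normrM mulrBl k2 k4.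
  have -> : z = (z.1, 0) by rewrite -z2; case: (z).
  have -> : w = (w.1, 0) by rewrite -w2; case: (w).
  by rewrite edist0.
- move=> t tab; rewrite tE // /F /=.
  have tab' : a <= t <= b by move: tab; rewrite in_itv.
  have uI := thI _ tab'; have [k1 k2] := divK _ (phi0 (theta t)) (phiL _ uI).
  apply: geo_unique => //; first by rewrite dpq k2.
  by rewrite phiq // dpq mulrBl mul1r k2.
Qed.

End Conclusion.

Theorem mainTheorem4 (R : realType) (X : metricType R)
    (X_geodesic : geodesic_space X) (X_CAT0 : CAT0 X)
    (alpha : R -> X) (a b : R)
    (alpha_closed : closed_curve alpha a b)
    (alpha_rectifiable : rectifiable alpha a b) :
  exists D : set (euclid2 R),
    convex_set D /\
    (majorizes D alpha a b \/ degenerately_majorizes D alpha a b).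
Proof.
have [ab [_ ac] aab] := alpha_closed.
have [beta [L [L_ge0 lip al rep]]] :=
  arclength_parametrization (ltW ab) alpha_rectifiable ac.
have bc : beta 0 = beta L.
  have [theta [_ _ ta tb tE]] := rep.
  by rewrite -ta -tb -!tE // in_itv /= lexx ?(ltW ab) ?andbT // ltW.
have degenerate : antipodal_pair beta L -> exists D : set (euclid2 R),
    convex_set D /\ (majorizes D alpha a b \/ degenerately_majorizes D alpha a b).
  move=> /(antipodal_degenerate X_geodesic X_CAT0 alpha_closed L_ge0 lip rep bc) [D [D1 D2]].
  by exists D; split => //; right.
(* A curve of length 0 is constant, and its figure is a point. *)
have [L0|L0] := ltP 0 L; last first.
  apply: degenerate; exists 0; have LE : L = 0 by apply/eqP; rewrite eq_le L0.
  by rewrite LE mul0r lexx mdist_ge0.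
case: (antipodal_or_majorant X_geodesic X_CAT0 L0 bc lip al) => [|[g [F [gM gN]]]].
  exact: degenerate.
exists (star g L); split; last first.
  by left; exact: (majorant_majorizes L_ge0 al rep L0 gM gN).
exact: (star_convex L0 (mj_lip gM) (mj_chords gM)).
Qed.
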